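(* Let $M$ be a compact complex manifold, let $x_1,\dots,x_h$ be distinct points of $M$, let $\pi:\tilde M\to M$ be the blow up of $M$ at these $h$ points, let $E_i=\pi^{-1}(x_i)$ be the exceptional divisors, and let $n_1,\dots,n_h$ be positive integers. For any positive holomorphic line bundle $L$ on $M$ and any holomorphic line bundle $K$ on $M$, there exists an integer $k\gg 0$ (that is, there exist arbitrarily large integers $k$) such that the line bundle $$\pi^*(L^{\otimes k}\otimes K)\otimes\Big[\sum_{i=1}^h -n_iE_i\Big]$$ on $\tilde M$ is positive.
   Context: Line bundle means holomorphic complex line bundle. Blow up: at a point $x$ of an $n$-dimensional complex manifold, choose local holomorphic coordinates $z=(z_1,\dots,z_n)$ centered at $x$ on a neighborhood $U$ of $x$, and set $\tilde U=\{(z,l)\in U\times\mathbb{P}^{n-1}: z_il_j=z_jl_i \text{ for all } i,j\}$ with $\pi(z,l)=z$. The blow up at $x$ is obtained from $M\setminus\{x\}$ and $\tilde U$ by gluing along $\pi:\tilde U\setminus\pi^{-1}(x)\cong U\setminus\{x\}$; it is independent of coordinates, and $\pi^{-1}(x)\cong\mathbb{P}^{n-1}$ is the exceptional divisor. The blow up at finitely many distinct points is obtained by doing this at each of them. Line bundle of a divisor: if a divisor $D$ (a locally finite integer combination of irreducible analytic hypersurfaces) has local defining meromorphic functions $f_\alpha$ on an open cover $\{U_\alpha\}$, then $[D]$ is the holomorphic line bundle with transition functions $g_{\alpha\beta}=f_\alpha/f_\beta$ on $U_\alpha\cap U_\beta$. Positivity: given a Hermitian metric $\langle\cdot,\cdot\rangle$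 on a holomorphic line bundle $F$ over a complex manifold, the Chern connection $D$ is the unique connection on $F$ compatible with the metric ($d\langle s,t\rangle = \langle Ds,t\rangle+\langle s,Dt\rangle$) and with the complex structure (the $(0,1)$-part of $D$ equals $\bar\partial$). Its curvature form $\Theta$ is the 2-form, independent of the choice of local frame $e$, with $D^2(e)=e\otimes\Theta$; for a holomorphic frame $e$ with $h=\langle e,e\rangle$, $\Theta = d(h^{-1}\partial h)$. A real $(1,1)$-form $\omega$ (i.e. $\bar\omega=\omega$) is positive if $(v,w)\mapsto -2i\,\omega(v,\bar w)$ is a positive definite Hermitian inner product on each holomorphic tangent space; equivalently $-i\omega(v,\bar v)>0$ for every nonzero holomorphic tangent vector $v$. The line bundle $F$ is positive if it carries a Hermitian metric for which $\frac{i}{2\pi}\Theta$ is a positive $(1,1)$-form. *)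

(* Defs.v *)
From HB Require Import structures.
From mathcomp Require Import all_boot all_order all_algebra.
From mathcomp Require Import complex.
From mathcomp Require Import all_classical all_reals all_analysis.
Import numFieldNormedType.Exports.
Import Order.TTheory GRing.Theory Num.Theory.

Set Implicit Arguments.
Unset Strict Implicit.
Unset Printing Implicit Defensive.

Local Open Scope classical_set_scope.
Local Open Scope ring_scope.
Local Open Scope complex_scope.

(* [numFieldNormedType] only covers abstract number fields; these instances
   give the concrete type R[i] the topology of its modulus. *)
HB.instance Definition _ (R : rcfType) := GRing.ComAlgebra.copy R[i] R[i]^o.
HB.instance Definition _ (R : rcfType) := Vector.copy R[i] R[i]^o.
HB.instance Definition _ (R : rcfType) := NormedModule.copy R[i] R[i]^o.

(* Calculus on open subsets W of C^n = 'rV[R[i]]_n.  Functions are total and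
   only their values on W matter. *)
Section LocalAnalysis.
Context {R : realType} {n : nat}.
Local Notation C := R[i].
Local Notation V := 'rV[R[i]]_n.
Implicit Types (W : set V) (f g h : V -> C) (u v z : V).

(* complex (Frechet) differentiability at every point of W *)
Definition holomorphic (Y : normedModType C) W (f : V -> Y) : Prop :=
  forall z, W z -> differentiable f z.

(* the directional derivative along the real line t |-> z + t v *)
Definition rderivable f v z : Prop :=
  derivable (fun t : R => complex.Re (f (z + t%:C *: v))) 0 1 /\
  derivable (fun t : R => complex.Im (f (z + t%:C *: v))) 0 1.

Definition rderive f v z : C :=
  (derive1 (fun t : R => complex.Re (f (z + t%:C *: v))) 0) +i*
  (derive1 (fun t : R => complex.Im (f (z + t%:C *: v))) 0).

(* C^k in the real sense *)
Fixpoint Ck (k : nat) W f : Prop :=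
  if k is k'.+1 then
    forall v, (forall z, W z -> rderivable f v z) /\ Ck k' W (rderive f v)
  else forall z, W z -> {for z, continuous f}.

Definition smooth W f : Prop := forall k, Ck k W f.

(* complex-valued 1-forms: [eta z v] is the value at z on the real tangent
   vector v, where T_z(C^n) = C^n and the complex structure J is 'i *: _ *)
Definition smooth_form1 W (eta : V -> V -> C) : Prop :=
  (forall z, W z -> forall (a : R) u v,
     eta z (a%:C *: u + v) = a%:C * eta z u + eta z v) /\
  (forall v, smooth W (eta^~ v)).

Definition differential f : V -> V -> C := fun z v => rderive f v z.

Definition part01 (eta : V -> V -> C) : V -> V -> C :=
  fun z v => 2^-1 * (eta z v + 'i * eta z ('i *: v)).

Definition dbar f : V -> V -> C := part01 (differential f).

Definition ext_d (eta : V -> V -> C) : V -> V -> V -> C :=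
  fun z u v => rderive (eta^~ v) u z - rderive (eta^~ u) v z.

(* In a frame e, a connection is given by the 1-form theta with
   D e = e (x) theta, and D (f e) = e (x) (df + f theta). *)
Definition covariant (theta : V -> V -> C) f : V -> V -> C :=
  fun z v => differential f z v + f z * theta z v.

(* theta is the form, in a holomorphic frame e with <e, e> = h, of the
   connection compatible with the metric and with the complex structure;
   the sections are s = f e and t = g e. *)
Definition chern_form W h (theta : V -> V -> C) : Prop :=
  [/\ smooth_form1 W theta,
      forall f, smooth W f -> forall z v, W z ->
        part01 (covariant theta f) z v = dbar f z v &
      forall f g, smooth W f -> smooth W g -> forall z v, W z ->
        differential (fun w => f w * conjc (g w) * h w) z v =
        covariant theta f z v * conjc (g z) * h z +
        f z * conjc (covariant theta g z v) * h z].

(* D^2 e = e (x) (d theta + theta /\ theta), and theta /\ theta = 0 in rank 1 *)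
Definition curvature (theta : V -> V -> C) : V -> V -> V -> C := ext_d theta.

(* Complexified tangent vectors a + i b are encoded as pairs (a, b) of real
   ones; [hol v] = (v - i J v) / 2 is the holomorphic tangent vector
   \sum_j v_j d/dz_j. *)
Definition hol v : V * V := (2^-1 *: v, - (2^-1 *: ('i *: v))).

Definition cconj (p : V * V) : V * V := (p.1, - p.2).

Definition cextend (om : V -> V -> V -> C) z (p q : V * V) : C :=
  om z p.1 q.1 - om z p.2 q.2 + 'i * (om z p.1 q.2 + om z p.2 q.1).

Definition form_pairing (om : V -> V -> V -> C) z v w : C :=
  - (2 * 'i) * cextend om z (hol v) (cconj (hol w)).

Definition real_form W (om : V -> V -> V -> C) : Prop :=
  forall z u v, W z -> conjc (om z u v) = om z u v.

Definition form11 W (om : V -> V -> V -> C) : Prop :=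
  forall z u v, W z -> om z ('i *: u) ('i *: v) = om z u v.

Definition positive_form W (om : V -> V -> V -> C) : Prop :=
  [/\ real_form W om, form11 W om &
      forall z, W z ->
      [/\ forall (a : C) u v w, form_pairing om z (a *: u + v) w =
            a * form_pairing om z u w + form_pairing om z v w,
          forall v w, form_pairing om z w v = conjc (form_pairing om z v w) &
          forall v, v != 0 -> 0 < form_pairing om z v v]].

End LocalAnalysis.

Section DifferentiableGerm.
Context {K : numFieldType} {V W : normedModType K}.

Lemma differentiable_near0 (f : V -> W) (z : V) :
  (\near z, f z = 0) -> differentiable f z.
Proof.
move=> f0; have fz : f z = 0 by exact: nbhs_singleton f0.
have e : f \o shift z = cst (f z) + \0 +o_ (0 : V) id.
  apply/eqaddoP => _/posnumP[eps].
  move: f0; rewrite (near_shift 0) subr0 => f0.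
  near=> x.
  have -> : (f \o shift z - (cst (f z) + \0)) x = 0.
    have fx : f (shift z x) = 0 by exact: (near f0 x).
    by rewrite !fctE /= in fx *; rewrite fx fz addr0 subr0.
  by rewrite normr0 mulr_ge0.
have c : continuous (\0 : V -> W) by exact: cst_continuous.
by apply/diff_locallyP; rewrite (diff_unique c e).
Unshelve. all: by end_near. Qed.

Lemma near_eq_differentiable (f g : V -> W) (z : V) :
  (\near z, f z = g z) -> differentiable f z -> differentiable g z.
Proof.
move=> fg df; have -> : g = f + (g - f) by apply/funext => x /=; rewrite !fctE addrC subrK.
apply: differentiableD => //; apply: differentiable_near0.
by near=> x; rewrite !fctE (near fg x) ?subrr.
Unshelve. all: by end_near. Qed.

End DifferentiableGerm.

Record chart (R : realType) (n : nat) (T : topologicalType) := Chart {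
  dom : set T;
  coord : T -> 'rV[R[i]]_n;
  param : 'rV[R[i]]_n -> T;
  open_dom : open dom;
  open_coord_dom : open (coord @` dom);
  coordK : forall x, dom x -> param (coord x) = x;
  continuous_coord : forall x, dom x -> {for x, continuous coord};
  continuous_param :
    forall z, (coord @` dom) z -> {for z, continuous param}
}.

Definition holomorphic_transition (R : realType) (n : nat)
    (T : topologicalType) (c d : chart R n T) : Prop :=
  holomorphic (coord c @` (dom c `&` dom d)) (coord d \o param c).

Record cmanifold (R : realType) (n : nat) := CManifold {
  points :> topologicalType;
  hausdorff_points : hausdorff_space points;
  second_countable_points : @second_countable points;
  atlas : set (chart R n points);
  atlas_cover : forall x, exists2 c, atlas c & dom c x;
  atlas_holomorphic :
    forall c d, atlas c -> atlas d -> holomorphic_transition c d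
}.

Arguments atlas {R n} _.

Section Maps.
Context {R : realType} {n : nat}.
Local Notation C := R[i].
Implicit Types M N : cmanifold R n.

(* membership in the maximal atlas *)
Definition holomorphic_chart M (c : chart R n M) : Prop :=
  forall d, atlas M d ->
    holomorphic_transition c d /\ holomorphic_transition d c.

(* in the next three definitions the sets A are meant to be open *)
Definition holomorphic_fun M (A : set M) (f : M -> C) : Prop :=
  forall c, atlas M c ->
    holomorphic (coord c @` (A `&` dom c)) (f \o param c).

Definition smooth_fun M (A : set M) (f : M -> C) : Prop :=
  forall c, atlas M c -> smooth (coord c @` (A `&` dom c)) (f \o param c).

Definition holomorphic_on M N (A : set M) (f : M -> N) : Prop :=
  (forall x, A x -> {for x, continuous f}) /\
  (forall c d, atlas M c -> atlas N d ->
     holomorphic (coord c @` (A `&` dom c `&` f @^-1` dom d))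
       (coord d \o f \o param c)).

Definition biholomorphic_on M N (A : set M) (B : set N) (f : M -> N) : Prop :=
  exists g : N -> M,
    [/\ forall x, A x -> B (f x) /\ g (f x) = x,
        forall y, B y -> A (g y) /\ f (g y) = y,
        holomorphic_on A f & holomorphic_on B g].

Record holomap M N := HoloMap {
  holomap_fun :> M -> N;
  holomapP : holomorphic_on setT holomap_fun
}.

End Maps.

(* A line bundle is given by a trivializing cover and transition functions:
   a section is s = s_a e_a with s_a = g_ab s_b, that is, e_b = g_ab e_a. *)
Record line_bundle (R : realType) (n : nat) (M : cmanifold R n) := LineBundle {
  lb_index : Type;
  lb_open : lb_index -> set M;
  lb_trans : lb_index -> lb_index -> M -> R[i];
  open_lb_open : forall a, open (lb_open a);
  lb_cover : forall x, exists a, lb_open a x;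
  lb_trans_holomorphic : forall a b,
    holomorphic_fun (lb_open a `&` lb_open b) (lb_trans a b);
  lb_trans_neq0 : forall a b x,
    lb_open a x -> lb_open b x -> lb_trans a b x != 0;
  lb_cocycle : forall a b c x,
    lb_open a x -> lb_open b x -> lb_open c x ->
    lb_trans a b x * lb_trans b c x = lb_trans a c x
}.

Section ChartLemmas.
Context {R : realType} {n : nat}.
Implicit Types M N : cmanifold R n.

Lemma open_coord_image (T : topologicalType) (c : chart R n T) (A : set T) :
  open A -> open (coord c @` (A `&` dom c)).
Proof.
move=> oA; rewrite openE => _ [x [Ax cx] <-].
have icx : (coord c @` dom c) (coord c x) by exists x.
suff : \forall z \near coord c x, (A `&` dom c) (param c z) /\
                                  (coord c @` dom c) z.
  apply: filterS => z [[Az cz] [y cy yz]]; exists (param c z) => //.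
  by rewrite -yz coordK.
  apply: filterI; last by apply: open_nbhs_nbhs; split; [exact: open_coord_dom|].
  apply: (continuous_param icx); rewrite coordK //.
  by apply: open_nbhs_nbhs; split=> //; exact: openI oA (open_dom c).
Qed.

Lemma holomorphic_funS M (A B : set M) (f : M -> R[i]) :
  A `<=` B -> holomorphic_fun B f -> holomorphic_fun A f.
Proof.
by move=> AB hf c Mc _ [x [Ax cx] <-]; apply: hf => //; exists x; split=> //; exact: AB.
Qed.

Lemma holomorphic_funM M (A : set M) (f g : M -> R[i]) :
  holomorphic_fun A f -> holomorphic_fun A g ->
  holomorphic_fun A (fun x => f x * g x).
Proof.
move=> hf hg c Mc z Az.
exact: (differentiableM (hf c Mc z Az) (hg c Mc z Az)).
Qed.

Lemma holomorphic_funX M (A : set M) (f : M -> R[i]) k :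
  holomorphic_fun A f -> holomorphic_fun A (fun x => f x ^+ k).
Proof.
move=> hf; elim: k => [|k IH].
  by move=> c Mc z _; exact: (differentiable_cst (1 : R[i]) z).
rewrite (_ : (fun _ => _) = (fun x => f x * f x ^+ k)).
  exact: holomorphic_funM.
by apply/funext => x; rewrite exprS.
Qed.

Lemma holomorphic_fun_pullback M N (p : holomap M N) (B : set N)
    (f : N -> R[i]) :
  open B -> holomorphic_fun B f -> holomorphic_fun (p @^-1` B) (f \o p).
Proof.
move=> oB hf c Mc _ [x [Bx cx] <-].
have [d Nd dpx] := atlas_cover (p x).
have [cp dp] := holomapP p.
have op (D : set N) : open D -> open (p @^-1` D).
  by move=> oD; apply: open_comp => // y _; exact: cp.
have dcd : differentiable (coord d \o p \o param c) (coord c x).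
  by apply: dp => //; exists x.
have dfd : differentiable (f \o param d)
                          ((coord d \o p \o param c) (coord c x)).
  by apply: hf => //; exists (p x) => //=; rewrite coordK.
apply: near_eq_differentiable (differentiable_comp dcd dfd).
near=> z.
have [y [dy cy] <-] : (coord c @` (p @^-1` dom d `&` dom c)) z.
  near: z; apply: open_nbhs_nbhs; split; last by exists x.
  by apply: open_coord_image; apply: op; exact: open_dom.
by rewrite /= coordK// coordK.
Unshelve. all: by end_near. Qed.

End ChartLemmas.

Section LineBundles.
Context {R : realType} {n : nat}.
Implicit Types M N : cmanifold R n.

Program Definition lb_tensor M (L K : line_bundle M) : line_bundle M :=
  {| lb_index := (lb_index L * lb_index K)%type;
     lb_open := fun a => lb_open a.1 `&` lb_open a.2;
     lb_trans := fun a b x => lb_trans a.1 b.1 x * lb_trans a.2 b.2 x |}.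
Next Obligation. by move=> M L K a; apply: openI; exact: open_lb_open. Qed.
Next Obligation.
move=> M L K x; have [a ax] := lb_cover L x; have [b bx] := lb_cover K x.
by exists (a, b).
Qed.
Next Obligation.
move=> M L K a b; apply: holomorphic_funM.
- apply: (holomorphic_funS _ (@lb_trans_holomorphic _ _ _ _ a.1 b.1)).
  by move=> x [[? ?] [? ?]].
- apply: (holomorphic_funS _ (@lb_trans_holomorphic _ _ _ _ a.2 b.2)).
  by move=> x [[? ?] [? ?]].
Qed.
Next Obligation.
by move=> M L K a b x [? ?] [? ?]; rewrite mulf_neq0 ?lb_trans_neq0.
Qed.
Next Obligation.
by move=> M L K a b c x [? ?] [? ?] [? ?]; rewrite mulrACA !lb_cocycle.
Qed.

Program Definition lb_pow M (L : line_bundle M) (k : nat) : line_bundle M :=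
  {| lb_index := lb_index L;
     lb_open := fun a => lb_open a;
     lb_trans := fun a b x => lb_trans a b x ^+ k |}.
Next Obligation. by move=> M L k a; exact: open_lb_open. Qed.
Next Obligation. by move=> M L k x; exact: lb_cover. Qed.
Next Obligation.
by move=> M L k a b; apply: holomorphic_funX; exact: lb_trans_holomorphic.
Qed.
Next Obligation.
by move=> M L k a b x ? ?; rewrite expf_neq0 ?lb_trans_neq0.
Qed.
Next Obligation.
by move=> M L k a b c x ? ? ?; rewrite -exprMn lb_cocycle.
Qed.

Program Definition lb_pullback M N (p : holomap M N) (L : line_bundle N) :
    line_bundle M :=
  {| lb_index := lb_index L;
     lb_open := fun a => p @^-1` lb_open a;
     lb_trans := fun a b => lb_trans a b \o p |}.
Next Obligation.
move=> M N p L a; apply: open_comp; last exact: open_lb_open.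
by move=> x _; exact: (holomapP p).1.
Qed.
Next Obligation. by move=> M N p L x; exact: lb_cover. Qed.
Next Obligation.
move=> M N p L a b.
have oab : open (lb_open a `&` lb_open b) by apply: openI; exact: open_lb_open.
exact: (holomorphic_fun_pullback (p := p) oab (@lb_trans_holomorphic _ _ _ L a b)).
Qed.
Next Obligation. by move=> M N p L a b x ? ?; exact: lb_trans_neq0. Qed.
Next Obligation. by move=> M N p L a b c x ? ? ?; exact: lb_cocycle. Qed.

(* h a = <e_a, e_a> *)
Definition hermitian_metric M (L : line_bundle M)
    (h : lb_index L -> M -> R) : Prop :=
  [/\ forall a, smooth_fun (lb_open a) (fun x => (h a x)%:C),
      forall a x, lb_open a x -> 0 < h a x &
      forall a b x, lb_open a x -> lb_open b x ->
        (h b x)%:C = `|lb_trans a b x| ^+ 2 * (h a x)%:C].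

(* The Chern form is written in each frame e_a and each chart c; it is unique
   there, so these local forms are those of one global connection. *)
Definition positive M (L : line_bundle M) : Prop :=
  exists2 h : lb_index L -> M -> R, hermitian_metric h &
  forall a c, atlas M c ->
    let W := coord c @` (lb_open a `&` dom c) in
    exists2 theta,
      chern_form W (fun z => (h a (param c z))%:C) theta &
      positive_form W
        (fun z u v => 'i / (2 * pi)%:C * curvature theta z u v).

(* f is a local equation of the hypersurface E on U: it vanishes exactly on E,
   and divides every holomorphic germ that vanishes on E *)
Definition hypersurface_equation M (E U : set M) (f : M -> R[i]) : Prop :=
  [/\ holomorphic_fun U f,
      forall x, U x -> (f x = 0 <-> E x) &
      forall x (V : set M) (g : M -> R[i]),
        open V -> U x -> V x -> holomorphic_fun V g ->
        (forall y, V y -> E y -> g y = 0) ->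
        exists (V' : set M) (q : M -> R[i]),
          [/\ open V', V' x, V' `<=` U `&` V, holomorphic_fun V' q &
              forall y, V' y -> g y = q y * f y]].

(* f is a local defining meromorphic function on U of the divisor
   \sum_i m_i E_i; its values on the support are irrelevant *)
Definition divisor_equation M (r : nat) (E : 'I_r -> set M) (m : 'I_r -> int)
    (U : set M) (f : M -> R[i]) : Prop :=
  forall x, U x ->
  exists (V : set M) (u : M -> R[i]) (e : 'I_r -> M -> R[i]),
    [/\ open V /\ V x,
        V `<=` U,
        holomorphic_fun V u /\ (forall y, V y -> u y != 0),
        forall i, hypersurface_equation (E i) V (e i) &
        forall y, V y -> (forall i, ~ E i y) ->
          f y = u y * \prod_i e i y ^ m i].

(* D represents the line bundle of \sum_i m_i E_i *)
Definition is_divisor_bundle M (r : nat) (E : 'I_r -> set M) (m : 'I_r -> int)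
    (D : line_bundle M) : Prop :=
  exists f : lb_index D -> M -> R[i],
    (forall a, divisor_equation E m (lb_open a) (f a)) /\
    (forall a b x, lb_open a x -> lb_open b x -> (forall i, ~ E i x) ->
       lb_trans a b x = f a x / f b x).

End LineBundles.

(* P^{n-1} as the set of lines of C^n *)
Definition proj_space (R : realType) (n : nat) :=
  {l : {vspace 'rV[R[i]]_n} | \dim l == 1%N}.

Section BlowUp.
Context {R : realType} {n : nat}.
Local Notation V := 'rV[R[i]]_n.

(* one choice of homogeneous coordinates *)
Definition hcoord (l : proj_space R n) : V := vpick (val l).

(* the blow up at 0 of the open set U of C^n *)
Definition blowup_model (U : set V) : set (V * proj_space R n) :=
  [set q | U q.1 /\ forall i j,
     q.1 0 i * hcoord q.2 0 j = q.1 0 j * hcoord q.2 0 i].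

(* the standard chart (l_i / l_j for i <> j, and z_j) of the blow up model on
   the open set l_j <> 0; these charts define its complex structure *)
Definition blowup_chart (j : 'I_n) (q : V * proj_space R n) : V :=
  \row_i (if i == j then q.1 0 j else hcoord q.2 0 i / hcoord q.2 0 j).

(* [p] is the blow up at the points x_i: it is biholomorphic away from them,
   and over a coordinate neighbourhood of x_i there is a biholomorphism phi
   with the blow up model that commutes with the projections *)
Definition is_blowup (M N : cmanifold R n) (r : nat) (x : 'I_r -> M)
    (p : holomap N M) : Prop :=
  biholomorphic_on (~` (p @^-1` range x)) (~` range x) p /\
  forall i, exists (c : chart R n M) (phi : N -> V * proj_space R n),
    [/\ [/\ holomorphic_chart c, dom c (x i), coord c (x i) = 0 &
            forall j, j != i -> ~ dom c (x j)],
        set_bij (p @^-1` dom c) (blowup_model (coord c @` dom c)) phi,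
        forall y, dom c (p y) -> (phi y).1 = coord c (p y) &
        forall j, exists b : chart R n N,
          [/\ holomorphic_chart b,
              dom b = [set y | dom c (p y) /\ hcoord (phi y).2 0 j != 0] &
              forall y, dom b y -> coord b y = blowup_chart j (phi y)]].

End BlowUp.

(* Main.v *)
(* A Hermitian metric h is positive iff the complex Hessian (Levi form) of log h
   is negative definite in every chart.  The metric is sought as h_L^k h_K h_D
   with h_L positive and h_K arbitrary.  In a frame of D with local equation f,
   let h_D be |f|^-2 \prod_i S_i^(-n_i) off the exceptional divisors, where S_i
   is a positive function on M \ {x_i} equal to |z|^2 near x_i.  In a chart w of
   the blow up at x_i one has z = w_j t, where t is w with its j-th entry
   replaced by 1 and w_j is a unit times the equation of E_i.  The powers of w_j
   cancel, so that h_D = |g|^2 |t|^(-2 n_i) with g holomorphic and nowhere zero: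
   h_D extends smoothly across E_i, the Levi form of its logarithm is
   semidefinite (<= 0), and it is negative on the nonzero vectors killed by the
   differential of the blow up.  The remaining terms are pulled
   back from the compact M, where the Levi form of log h_L^k dominates them for
   all large k.
   The curvature is defined through C^oo functions, so holomorphic functions
   must first be shown to be smooth; this goes through Goursat and Cauchy. *)
From HB Require Import structures.
From mathcomp Require Import all_boot all_order all_algebra.
From mathcomp Require Import complex.
From mathcomp Require Import all_classical all_reals all_analysis.
From mathcomp Require Import ring lra.
Require Import Defs.
Import numFieldNormedType.Exports.
Import Order.TTheory GRing.Theory Num.Theory.

Set Implicit Arguments.
Unset Strict Implicit.
Unset Printing Implicit Defensive.

Local Open Scope classical_set_scope.
Local Open Scope ring_scope.
Local Open Scope complex_scope.

(** * Real-valued norms of complex normed spaces *)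

Section RealNorm.
Context {R : realType}.
Local Notation C := R[i].

(** The factors S_i^(-n_i) are singular at x_i, so h_L^k h_K times their product is not a metric on
    M. Near x_i the i-th factor is left out and handed to the blow up, where with |f|^-2 it becomes
    the smooth function [B] of [local_model]. What stays downstairs, [rest o], is smooth and
    positive near the point considered, and k is found by compactness of M alone. On vectors not
    killed by dp the base term is negative and [B] adds something <= 0; on the others the base term
    vanishes and [B] is negative whatever k is. Two definitions shape the rest. A divisor is given
    by local equations with arbitrary values on the support, so h_D is the continuous extension of a
    function known only off the exceptional divisors; it is well defined because their complement is
    dense. And smoothness is defined by iterated directional derivatives, so the total differential,
    linearity in the direction, symmetry of second derivatives and the chain rule are derived before
    Levi forms can be handled. *)

Definition nrm {V : normedModType C} (x : V) : R := complex.Re `|x|.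

Section OneSpace.
Context {V : normedModType C}.
Implicit Types x y : V.

Lemma nrmE x : `|x| = (nrm x)%:C.
Proof.
have := ger0_Im (normr_ge0 x); rewrite /nrm.
by case: `|x| => a b /= ->.
Qed.

Lemma nrm_ge0 x : 0 <= nrm x.
Proof. by rewrite -lecR -nrmE normr_ge0. Qed.

Lemma nrm0 : nrm (0 : V) = 0.
Proof. by rewrite /nrm normr0. Qed.

Lemma nrm_eq0 x : nrm x = 0 -> x = 0.
Proof. by move=> h; apply/eqP; rewrite -normr_eq0 nrmE h. Qed.

Lemma nrmD x y : nrm (x + y) <= nrm x + nrm y.
Proof. by rewrite -lecR rmorphD /= -!nrmE ler_normD. Qed.

Lemma nrmN x : nrm (- x) = nrm x.
Proof. by rewrite /nrm normrN. Qed.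

Lemma nrmB x y : nrm (x - y) <= nrm x + nrm y.
Proof. by rewrite (le_trans (nrmD _ _))// nrmN. Qed.

Lemma nrmBC x y : nrm (x - y) = nrm (y - x).
Proof. by rewrite -nrmN opprB. Qed.

Lemma nrm_leD x y : nrm x <= nrm y + nrm (x - y).
Proof. by rewrite -{1}(subrK y x) addrC nrmD. Qed.

Lemma nrmZ (a : C) x : nrm (a *: x) = nrm (a : C) * nrm x.
Proof. by apply: complexI; rewrite rmorphM /= -!nrmE normrZ. Qed.

(** Norms over [R[i]] are themselves elements of [R[i]]. From here on neighbourhoods, continuity and
    differentiability are expressed with real radii, so that estimates are settled by [lra] and
    [nra]. *)
Lemma near_nrmP (P : set V) z :
  (\forall y \near z, P y) <->
  exists2 d : R, 0 < d & forall e, nrm e < d -> P (z + e).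
Proof.
split.
  move=> /nbhs_normP[d d0 h].
  have dE : d = (complex.Re d)%:C by move: (ger0_Im (ltW d0)); case: (d) => a b /= ->.
  exists (complex.Re d); first by rewrite -ltcR -dE.
  move=> e ed; apply: h => /=; rewrite opprD addrA subrr sub0r normrN nrmE.
  by rewrite dE ltcR.
move=> [d d0 h]; apply/nbhs_normP; exists d%:C => /=; first by rewrite ltcR.
move=> y /= yd; rewrite -(subrKC z y); apply: h.
by rewrite -ltcR -nrmE distrC.
Qed.

End OneSpace.

Section TwoSpaces.
Context {V W : normedModType C}.

Lemma nrm_cvgP (f : V -> W) z :
  {for z, continuous f} <->
  forall e : R, 0 < e -> exists2 d : R, 0 < d &
    forall h, nrm h < d -> nrm (f (z + h) - f z) < e.
Proof.
split.
  move=> /cvgrPdist_lt cf e e0.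
  have /cf/near_nrmP[d d0 h] : 0 < e%:C by rewrite ltcR.
  by exists d => // x /h; rewrite nrmE ltcR nrmBC.
move=> h; apply/cvgrPdist_lt => e e0.
have eE : e = (complex.Re e)%:C by move: (ger0_Im (ltW e0)); case: (e) => a b /= ->.
have /h[d d0 H] : 0 < complex.Re e by rewrite -ltcR -eE.
apply/near_nrmP; exists d => // x /H.
by rewrite distrC nrmE eE ltcR.
Qed.

Lemma diff_nrm (f : V -> W) z : differentiable f z ->
  forall e : R, 0 < e -> exists2 d : R, 0 < d &
    forall h, nrm h < d -> nrm (f (z + h) - f z - 'd f z h) <= e * nrm h.
Proof.
move=> /diff_locallyP[_ h] e e0.
move: h => /eqaddoP/(_ e%:C); rewrite ltcR => /(_ e0).
move=> /near_nrmP[d d0 H]; exists d => // x /H.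
rewrite add0r !fctE /= !nrmE -rmorphM lecR /=.
by rewrite opprD addrA [x + z]addrC.
Qed.

(** The bound [B] supplies the continuity of [L], which [diff_unique] requires besides the remainder
    estimate. *)
Lemma nrm_diff (f : V -> W) z (L : {linear V -> W}) (B : R) :
  (forall h, nrm (L h) <= B * nrm h) ->
  (forall e : R, 0 < e -> exists2 d : R, 0 < d &
    forall h, nrm h < d -> nrm (f (z + h) - f z - L h) <= e * nrm h) ->
  differentiable f z /\ 'd f z = L :> (V -> W).
Proof.
move=> bL h.
have cL : continuous L.
  move=> x; apply/nrm_cvgP => e e0.
  have B1 : 0 < `|B| + 1 by rewrite ltr_pwDr.
  exists (e / (`|B| + 1)); first exact: divr_gt0.
  move=> y yd; rewrite addrC linearD /= addKr.
  apply: le_lt_trans (bL _) _; rewrite ltr_pdivlMr// in yd.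
  apply: le_lt_trans yd; rewrite mulrC ler_wpM2l ?nrm_ge0//.
  by rewrite (le_trans (ler_norm B))// lerDl.
have e : f \o shift z = cst (f z) + L +o_ (0 : V) id.
  apply/eqaddoP => e e0.
  have eE : e = (complex.Re e)%:C by move: (ger0_Im (ltW e0)); case: (e) => a b /= ->.
  have /h[d d0 H] : 0 < complex.Re e by rewrite -ltcR -eE.
  apply/near_nrmP; exists d => // x /H.
  rewrite add0r !fctE /= !nrmE {2}eE -rmorphM lecR /=.
  by rewrite opprD addrA [x + z]addrC.
have dL := diff_unique cL e.
by split=> //; apply/diff_locallyP; rewrite dL.
Qed.

Lemma nrm_diff_le (f : V -> W) z : differentiable f z ->
  exists B : R, forall h, nrm ('d f z h) <= B * nrm h.
Proof.
move=> df; have [k k0 hk] := linear_lipschitz (diff_continuous df).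
exists (complex.Re k) => h.
have kE : k = (complex.Re k)%:C by move: (ger0_Im (ltW k0)); case: (k) => a b /= ->.
by rewrite -lecR rmorphM /= -!nrmE -kE.
Qed.

End TwoSpaces.

Implicit Types z w : C.

Lemma nrmM z w : nrm (z * w) = nrm z * nrm w.
Proof. by rewrite -nrmZ. Qed.

Lemma nrmX z k : nrm (z ^+ k) = nrm z ^+ k.
Proof.
elim: k => [|k IH]; last by rewrite !exprS nrmM IH.
by rewrite !expr0 /nrm normr1.
Qed.

Lemma nrmC_def z : nrm z = Num.sqrt ((complex.Re z) ^+ 2 + (complex.Im z) ^+ 2).
Proof. by rewrite /nrm normc_def. Qed.

Lemma nrmR (x : R) : nrm (x%:C : C) = `|x|.
Proof. by rewrite nrmC_def /= expr0n /= addr0 sqrtr_sqr. Qed.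

Lemma nrmi : nrm ('i : C) = 1.
Proof. by rewrite nrmC_def /= expr0n /= add0r expr1n sqrtr1. Qed.

Lemma nrm1 : nrm (1 : C) = 1.
Proof. by rewrite /nrm normr1. Qed.

Lemma nrmV z : nrm z^-1 = (nrm z)^-1.
Proof.
apply: complexI; rewrite -nrmE normfV.
by rewrite nrmE fmorphV.
Qed.

Lemma Re_nrm z : `|complex.Re z| <= nrm z.
Proof. by rewrite nrmC_def -sqrtr_sqr ler_wsqrtr// lerDl sqr_ge0. Qed.

Lemma Im_nrm z : `|complex.Im z| <= nrm z.
Proof. by rewrite nrmC_def -sqrtr_sqr ler_wsqrtr// lerDr sqr_ge0. Qed.

Lemma nrm_ReIm z : nrm z <= `|complex.Re z| + `|complex.Im z|.
Proof.
rewrite [z in nrm z]complexE (le_trans (nrmD _ _))// nrmM nrmi mul1r !nrmR.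
exact: lexx.
Qed.

Lemma cReD z w : complex.Re (z + w) = complex.Re z + complex.Re w.
Proof. by case: z w => [a b] [c d]. Qed.
Lemma cImD z w : complex.Im (z + w) = complex.Im z + complex.Im w.
Proof. by case: z w => [a b] [c d]. Qed.
Lemma cReN z : complex.Re (- z) = - complex.Re z.
Proof. by case: z. Qed.
Lemma cImN z : complex.Im (- z) = - complex.Im z.
Proof. by case: z. Qed.
Lemma cReM z w : complex.Re (z * w) =
  complex.Re z * complex.Re w - complex.Im z * complex.Im w.
Proof. by case: z w => [a b] [c d]. Qed.
Lemma cImM z w : complex.Im (z * w) =
  complex.Re z * complex.Im w + complex.Im z * complex.Re w.
Proof. by case: z w => [a b] [c d]. Qed.

Lemma conjcE z : conjc z = (complex.Re z) -i* (complex.Im z).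
Proof. by case: z. Qed.

End RealNorm.

(** * Curves and contour integrals *)

Section CurveDerivative.
Context {R : realType}.
Local Notation C := R[i].

Lemma near0_absP (P : R -> Prop) :
  (\forall s \near (0 : R), P s) <->
  exists2 d : R, 0 < d & forall s, `|s| < d -> P s.
Proof.
split.
  move=> /nbhs_normP[d d0 h]; exists d => // s sd; apply: h => /=.
  by rewrite sub0r normrN.
move=> [d d0 h]; apply/nbhs_normP; exists d => // s /=.
by rewrite sub0r normrN; exact: h.
Qed.

Lemma is_derive_epsP (f : R -> R) (t l : R) :
  is_derive t (1 : R) f l <->
  forall e, 0 < e -> exists2 d : R, 0 < d &
    forall s, `|s| < d -> `|f (t + s) - f t - s * l| <= e * `|s|.
Proof.
split=> [df e e0|h].
  have := @ex_derive _ _ _ _ _ _ _ df; rewrite /derivable => cf.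
  have := @derive_val _ _ _ _ _ _ _ df; rewrite /derive => lE.
  move: cf; rewrite lE => /cvgrPdist_le/(_ e e0).
  rewrite near_withinE => /near0_absP[d d0 H]; exists d => // s /H.
  have [->|s0] := eqVneq s 0.
    by rewrite addr0 subrr mul0r subrr normr0 mulr0.
  move=> /(_ isT) /=.
  rewrite -(ler_pM2l (_ : 0 < `|s|)) ?normr_gt0// -normrM mulrC.
  suff -> : (l - s^-1 *: (f (s *: (1:R) + t) - f t)) * s =
    - (f (t + s) - f t - s * l) by rewrite normrN [e * _]mulrC.
  by rewrite /GRing.scale /= mulr1 [s + t]addrC; field.
suff cv : (fun s : R => s^-1 *: ((f \o shift t) (s *: (1:R)) - f t)) @ 0^' --> l.
  by split; [exact: cvgP cv|exact: cvg_lim cv].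
apply/cvgrPdist_le => e /h[d d0 H]; rewrite near_withinE.
apply/near0_absP; exists d => // s /H Hs s0.
rewrite -(ler_pM2l (_ : 0 < `|s|)) ?normr_gt0// -normrM mulrC /=.
suff -> : (l - s^-1 *: (f (s *: (1:R) + t) - f t)) * s =
    - (f (t + s) - f t - s * l) by rewrite normrN [_ * e]mulrC.
by rewrite /GRing.scale /= mulr1 [s + t]addrC; field.
Qed.

(** The source is normed over [R] and the target over [R[i]], hence an explicit remainder
    inequality; without a quotient, [s = 0] is not a special case. *)
Definition cderiv (g : R -> C) (t : R) (l : C) : Prop :=
  forall e, 0 < e -> exists2 d : R, 0 < d &
    forall s, `|s| < d -> nrm (g (t + s) - g t - s%:C * l) <= e * `|s|.

Lemma cderivP g t l : cderiv g t l <->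
  is_derive t (1 : R) (fun s => complex.Re (g s)) (complex.Re l) /\
  is_derive t (1 : R) (fun s => complex.Im (g s)) (complex.Im l).
Proof.
have reE s : complex.Re (g (t + s)) - complex.Re (g t) - s * complex.Re l =
    complex.Re (g (t + s) - g t - s%:C * l).
  by rewrite !cReD !cReN cReM /= mul0r subr0.
have imE s : complex.Im (g (t + s)) - complex.Im (g t) - s * complex.Im l =
    complex.Im (g (t + s) - g t - s%:C * l).
  by rewrite !cImD !cImN cImM /= mul0r addr0.
split=> [h|[/is_derive_epsP h1 /is_derive_epsP h2] e e0].
  split; apply/is_derive_epsP => e /h[d d0 H]; exists d => // s /H.
    by rewrite reE; apply: le_trans (Re_nrm _).
  by rewrite imE; apply: le_trans (Im_nrm _).
have e20 : 0 < e / 2 by lra.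
have [d1 d10 H1] := h1 _ e20; have [d2 d20 H2] := h2 _ e20.
exists (Num.min d1 d2); first by rewrite lt_min d10.
move=> s; rewrite lt_min => /andP[/H1 H1s /H2 H2s].
rewrite (le_trans (nrm_ReIm _))// -reE -imE.
by rewrite (le_trans (lerD H1s H2s))// -mulrDl -splitr.
Qed.

Lemma cderiv_cst c t : cderiv (fun=> c) t 0.
Proof. by move=> e e0; exists 1 => // s _; rewrite subrr mulr0 subrr nrm0 mulr_ge0// ltW. Qed.

Lemma cderivD f g t l m : cderiv f t l -> cderiv g t m ->
  cderiv (fun s => f s + g s) t (l + m).
Proof.
move=> /cderivP[a b] /cderivP[c d]; apply/cderivP; split.
  rewrite cReD (_ : (fun _ => _) = (fun s => complex.Re (f s)) + (fun s => complex.Re (g s))).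
    exact: is_deriveD.
  by apply/funext => s; rewrite cReD.
rewrite cImD (_ : (fun _ => _) = (fun s => complex.Im (f s)) + (fun s => complex.Im (g s))).
  exact: is_deriveD.
by apply/funext => s; rewrite cImD.
Qed.

Lemma cderivM f g t l m : cderiv f t l -> cderiv g t m ->
  cderiv (fun s => f s * g s) t (l * g t + f t * m).
Proof.
move=> /cderivP[a b] /cderivP[c d]; apply/cderivP; split.
  rewrite (_ : (fun _ => _) = (fun s => complex.Re (f s)) * (fun s => complex.Re (g s))
     - (fun s => complex.Im (f s)) * (fun s => complex.Im (g s))).
    apply: is_derive_eq; rewrite cReD !cReM /GRing.scale /=; ring.
  by apply/funext => s; rewrite cReM.
rewrite (_ : (fun _ => _) = (fun s => complex.Re (f s)) * (fun s => complex.Im (g s))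
     + (fun s => complex.Im (f s)) * (fun s => complex.Re (g s))).
  apply: is_derive_eq; rewrite cImD !cImM /GRing.scale /=; ring.
by apply/funext => s; rewrite cImM.
Qed.

Lemma cderivZ c f t l : cderiv f t l -> cderiv (fun s => c * f s) t (c * l).
Proof.
by move=> h; have := cderivM (cderiv_cst c t) h; rewrite mul0r add0r.
Qed.

Lemma cderivN f t l : cderiv f t l -> cderiv (fun s => - f s) t (- l).
Proof.
move=> h; rewrite -mulN1r (_ : (fun _ => _) = fun s => (-1) * f s).
  exact: cderivZ.
by apply/funext => s; rewrite mulN1r.
Qed.

Lemma cderivB f g t l m : cderiv f t l -> cderiv g t m ->
  cderiv (fun s => f s - g s) t (l - m).
Proof. by move=> hf hg; apply: cderivD => //; exact: cderivN. Qed.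

Lemma cderiv_conj f t l : cderiv f t l -> cderiv (fun s => conjc (f s)) t (conjc l).
Proof.
move=> /cderivP[a b]; apply/cderivP; split.
  by rewrite conjcE /= (_ : (fun _ => _) = (fun s => complex.Re (f s)))//;
    apply/funext => s; rewrite conjcE.
rewrite conjcE /= (_ : (fun _ => _) = - (fun s => complex.Im (f s))).
  exact: is_deriveN.
by apply/funext => s; rewrite conjcE.
Qed.

Lemma cderiv_ofreal (f : R -> R) t l : is_derive t (1 : R) f l ->
  cderiv (fun s => (f s)%:C) t l%:C.
Proof. by move=> h; apply/cderivP; split => //=; exact: is_derive_cst. Qed.

Lemma cderiv_id t : cderiv (fun s => s%:C) t 1.
Proof. by apply: cderiv_ofreal; exact: is_derive_id. Qed.

Lemma cderiv_near f g t l :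
  (exists2 d : R, 0 < d & forall s, `|s| < d -> f (t + s) = g (t + s)) ->
  cderiv f t l -> cderiv g t l.
Proof.
move=> [d d0 fg] h e /h[d' d'0 H].
exists (Num.min d d'); first by rewrite lt_min d0.
move=> s; rewrite lt_min => /andP[sd /H].
have := fg 0; rewrite normr0 addr0 => /(_ d0) ->.
by rewrite fg.
Qed.

Lemma cderiv_cont (g : R -> C) t l : cderiv g t l ->
  forall e, 0 < e -> exists2 d : R, 0 < d &
    forall s, `|s| < d -> nrm (g (t + s) - g t) < e.
Proof.
move=> h e e0; have [d d0 H] := h 1 ltr01.
have l0 : 0 < nrm l + 2 by rewrite (lt_le_trans (ltr0n _ 2))// lerDr nrm_ge0.
exists (Num.min d (e / (nrm l + 2))).
  by rewrite lt_min d0 divr_gt0.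
move=> s; rewrite lt_min => /andP[/H Hs]; rewrite ltr_pdivlMr// => se.
have := nrm_leD (g (t + s) - g t) (s%:C * l).
rewrite nrmM nrmR; rewrite mul1r in Hs => a.
have s0 := normr_ge0 s; nra.
Qed.

(* The constant 2 comes from bounding the real and imaginary parts separately. *)
Lemma mean_value_ineq (g g' : R -> C) (a b M : R) : a <= b ->
  (forall t, a <= t <= b -> cderiv g t (g' t)) ->
  (forall t, a <= t <= b -> nrm (g' t) <= M) ->
  nrm (g b - g a) <= 2 * M * (b - a).
Proof.
move=> ab dg bg.
have mv (F F' : R -> R) : (forall t, a <= t <= b -> is_derive t (1:R) F (F' t)) ->
   (forall t, a <= t <= b -> `|F' t| <= M) -> `|F b - F a| <= M * (b - a).
  move=> dF bF.
  have c1 : {within `[a, b], continuous F}.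
    by apply: derivable_within_continuous => t; rewrite in_itv /= => /dF[].
  have c2 t : t \in `]a, b[ -> is_derive t (1:R) F (F' t).
    by rewrite in_itv /= => /andP[/ltW ? /ltW ?]; apply: dF; apply/andP.
  have [c] := MVT_segment ab c2 c1.
  rewrite in_itv /= => cab ->.
  by rewrite normrM [`|b - a|]ger0_norm ?subr_ge0// ler_wpM2r ?subr_ge0// bF.
rewrite (le_trans (nrm_ReIm _))// !cReD !cImD !cReN !cImN.
have := mv (fun t => complex.Re (g t)) (fun t => complex.Re (g' t)).
have := mv (fun t => complex.Im (g t)) (fun t => complex.Im (g' t)).
move=> /(_ (fun t h => ((cderivP _ _ _).1 (dg t h)).2)).
move=> /(_ (fun t h => le_trans (Im_nrm _) (bg t h))) hi.
move=> /(_ (fun t h => ((cderivP _ _ _).1 (dg t h)).1)).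
move=> /(_ (fun t h => le_trans (Re_nrm _) (bg t h))) hr.
lra.
Qed.

Lemma cderiv0_eq (g : R -> C) a b :
  (forall t, Num.min a b <= t <= Num.max a b -> cderiv g t 0) -> g a = g b.
Proof.
wlog ab : a b / a <= b => [wl|].
  have [ab|/ltW ba] := lerP a b.
    by have := wl _ _ ab; rewrite (min_idPl ab) (max_idPr ab).
  have := wl _ _ ba; rewrite (min_idPl ba) (max_idPr ba) => h dg.
  exact/esym/h.
rewrite (min_idPl _)// (max_idPr _)// => h.
apply: esym; apply/eqP; rewrite -subr_eq0; apply/eqP/nrm_eq0/le_anti.
rewrite nrm_ge0 andbT.
have := @mean_value_ineq g (fun=> 0) a b 0 ab h.
by rewrite mulr0 mul0r; apply => t _; rewrite nrm0.
Qed.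

End CurveDerivative.

Section CurveIntegral.
Context {R : realType}.
Local Notation C := R[i].
Local Notation mu := (@lebesgue_measure R).

(** The integral from [- N] is an antiderivative to the right of [- N] only. Two of these differ by
    a constant, so after normalization at 0 they agree and glue to a function on the whole line. *)
Lemma antiderivative_exists (f : R -> R) : continuous f ->
  exists G : R -> R, forall x, is_derive x (1 : R) G (f x).
Proof.
move=> cf.
pose P N x : R := (\int[mu]_(t in `[- N, x]) f t)%R.
have dP (N x : R) : - N < x -> is_derive x (1:R) (P N) (f x).
  move=> Nx.
  have int : mu.-integrable `[- N, x + 1] (EFin \o f).
    apply: continuous_compact_integrable; first exact: segment_compact.
    exact: continuous_subspaceT.
  have xx : x < x + 1 by rewrite ltrDl.
  have [d e] := continuous_FTC1_closed xx int Nx (cf x).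
  by split; [exact: d|rewrite -derive1E e].
have dPP (N N' x : R) : - N < x -> - N' < x -> cderiv (fun t => (P N t - P N' t)%:C) x 0.
  move=> h h'; have := is_deriveB (dP N x h) (dP N' x h').
  by rewrite subrr => /cderiv_ofreal.
have PP (N N' x : R) : - N < x -> - N' < x -> 0 < N -> 0 < N' ->
    P N x - P N 0 = P N' x - P N' 0.
  move=> h h' N0 N'0.
  suff /complexI : (P N x - P N' x)%:C = (P N 0 - P N' 0)%:C by lra.
  apply: (@cderiv0_eq _ (fun t => (P N t - P N' t)%:C)) => t /andP[t1 t2].
  apply: dPP.
  - by apply: lt_le_trans t1; rewrite lt_min h oppr_lt0.
  - by apply: lt_le_trans t1; rewrite lt_min h' oppr_lt0.
exists (fun x => P (`|x| + 1) x - P (`|x| + 1) 0) => x.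
have xx : - (`|x| + 2) < x by have := ler_norm (- x); rewrite normrN; lra.
have x0 := normr_ge0 x.
apply/is_derive_epsP => e e0.
have [d d0 H] := (is_derive_epsP _ _ _).1 (dP _ _ xx) e e0.
exists (Num.min d 1); first by rewrite lt_min d0 ltr01.
move=> s; rewrite lt_min => /andP[/H Hs s1].
have n1 := ler_norm (- x); have n2 := ler_norm (- (x + s)).
have n3 := ler_norm (- s); have n4 := normr_ge0 (x + s).
rewrite !normrN in n1 n2 n3.
(* The base point of the glued function moves with its argument; [|x| + 2] serves all points within
   distance 1 of [x]. *)
rewrite (PP (`|x + s| + 1) (`|x| + 2) (x + s)); try lra.
rewrite (PP (`|x| + 1) (`|x| + 2) x); try lra.
have -> : forall u v w z : R, u - v - (w - v) - z = u - w - z by move=> *; ring.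
exact: Hs.
Qed.

Definition ccont (g : R -> C) : Prop := forall t e, 0 < e ->
  exists2 d : R, 0 < d & forall s, `|s| < d -> nrm (g (t + s) - g t) < e.

Lemma ccontP (g : R -> C) : ccont g ->
  continuous (fun t => complex.Re (g t)) /\ continuous (fun t => complex.Im (g t)).
Proof.
move=> h; split=> t; apply/cvgrPdist_lt => e /(h t)[d d0 H];
  apply/nbhs_normP; exists d => // s /= sd.
- have /H : `|s - t| < d by rewrite distrC.
  rewrite subrKC -cReN -cReD; apply: le_lt_trans; rewrite nrmBC; exact: Re_nrm.
- have /H : `|s - t| < d by rewrite distrC.
  rewrite subrKC -cImN -cImD; apply: le_lt_trans; rewrite nrmBC; exact: Im_nrm.
Qed.

Lemma cprim_exists (g : R -> C) : ccont g ->
  exists G : R -> C, forall t, cderiv G t (g t).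
Proof.
move=> /ccontP[/antiderivative_exists[G1 h1] /antiderivative_exists[G2 h2]].
by exists (fun t => G1 t +i* G2 t) => t; apply/cderivP; split; [exact: h1|exact: h2].
Qed.

Definition cprim (g : R -> C) : R -> C :=
  xget (fun=> 0) [set G | forall t, cderiv G t (g t)].

Lemma cprimP g t : ccont g -> cderiv (cprim g) t (g t).
Proof.
move=> /cprim_exists[G hG]; move: t.
by have /(_ (ex_intro _ G hG)) := @xgetPex _ (fun=> 0) [set G | forall t, cderiv G t (g t)].
Qed.

(* Junk unless [g] is continuous. *)
Definition cint (a b : R) (g : R -> C) : C := cprim g b - cprim g a.

(** Two antiderivatives differ by a constant, so the one picked by [cprim] may be replaced by an
    explicit one; all integrals below are computed in this way. *)
Lemma cintE a b g G : (forall t, cderiv G t (g t)) -> cint a b g = G b - G a.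
Proof.
move=> hG; have /(_ (ex_intro _ G hG)) := @xgetPex _ (fun=> 0) [set G | forall t, cderiv G t (g t)].
rewrite -/(cprim g) => hP.
have : cprim g b - G b = cprim g a - G a.
  apply: (@cderiv0_eq _ (fun t => cprim g t - G t)) => t _.
  by rewrite -(subrr (g t)); apply: cderivB.
by move=> h; rewrite /cint -[cprim g b](subrK (G b)) h; ring.
Qed.

Lemma cint_split a b c g : cint a b g + cint b c g = cint a c g.
Proof. by rewrite /cint addrC subrKA. Qed.

Lemma ccont_cst (k : C) : ccont (fun=> k).
Proof. by move=> t e e0; exists 1 => // s _; rewrite subrr nrm0. Qed.

Lemma ccont_cderiv g g' : (forall t, cderiv g t (g' t)) -> ccont g.
Proof. by move=> h t; exact: cderiv_cont. Qed.

Lemma ccontD f g : ccont f -> ccont g -> ccont (fun t => f t + g t).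
Proof.
move=> hf hg t e e0; have e2 : 0 < e / 2 by lra.
have [d1 d10 H1] := hf t _ e2; have [d2 d20 H2] := hg t _ e2.
exists (Num.min d1 d2); first by rewrite lt_min d10.
move=> s; rewrite lt_min => /andP[/H1 H1s /H2 H2s].
rewrite opprD addrACA (le_lt_trans (nrmD _ _))//; lra.
Qed.

Lemma ccontM f g : ccont f -> ccont g -> ccont (fun t => f t * g t).
Proof.
move=> hf hg t e e0.
have f0 := nrm_ge0 (f t); have g0 := nrm_ge0 (g t).
have k0 : 0 < nrm (f t) + nrm (g t) + 1 by lra.
pose k := Num.min 1 (e / (nrm (f t) + nrm (g t) + 1)).
(* The bound [k <= 1] absorbs the product of the two increments into the linear terms. *)
have k1 : 0 < k by rewrite lt_min ltr01 divr_gt0.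
have [d1 d10 H1] := hf t _ k1; have [d2 d20 H2] := hg t _ k1.
exists (Num.min d1 d2); first by rewrite lt_min d10.
move=> s; rewrite lt_min => /andP[/H1 H1s /H2 H2s].
rewrite (_ : _ - _ = (f (t + s) - f t) * (g (t + s) - g t) +
   (f (t + s) - f t) * g t + f t * (g (t + s) - g t)); last by ring.
have := nrmD ((f (t + s) - f t) * (g (t + s) - g t) +
   (f (t + s) - f t) * g t) (f t * (g (t + s) - g t)).
have := nrmD ((f (t + s) - f t) * (g (t + s) - g t))
   ((f (t + s) - f t) * g t).
rewrite !nrmM.
set a := nrm _ in H1s *; set b := nrm _ in H2s *.
have a0 : 0 <= a := nrm_ge0 _; have b0 : 0 <= b := nrm_ge0 _.
have : k <= 1 by rewrite /k ge_min lexx.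
have : k * (nrm (f t) + nrm (g t) + 1) <= e.
  by rewrite -ler_pdivlMr// /k ge_min lexx orbT.
move=> h1 h2 h3 h4; apply: le_lt_trans h4 _.
nra.
Qed.

Lemma ccontB f g : ccont f -> ccont g -> ccont (fun t => f t - g t).
Proof.
move=> hf hg; rewrite (_ : (fun _ => _) = fun t => f t + (-1) * g t).
  by apply: ccontD => //; apply: ccontM => //; exact: ccont_cst.
by apply/funext => t; rewrite mulN1r.
Qed.

Lemma cintD a b f g : ccont f -> ccont g ->
  cint a b (fun t => f t + g t) = cint a b f + cint a b g.
Proof.
move=> hf hg; rewrite (@cintE _ _ _ (fun t => cprim f t + cprim g t)).
  by rewrite /cint opprD addrACA.
by move=> t; apply: cderivD; exact: cprimP.
Qed.

Lemma cintZ a b k f : ccont f -> cint a b (fun t => k * f t) = k * cint a b f.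
Proof.
move=> hf; rewrite (@cintE _ _ _ (fun t => k * cprim f t)).
  by rewrite /cint mulrBr.
by move=> t; apply: cderivZ; exact: cprimP.
Qed.

Lemma cintB a b f g : ccont f -> ccont g ->
  cint a b (fun t => f t - g t) = cint a b f - cint a b g.
Proof.
move=> hf hg; rewrite (@cintE _ _ _ (fun t => cprim f t - cprim g t)).
  by rewrite /cint; ring.
by move=> t; apply: cderivB; exact: cprimP.
Qed.

Lemma cint_le a b g M : a <= b -> ccont g ->
  (forall t, a <= t <= b -> nrm (g t) <= M) ->
  nrm (cint a b g) <= 2 * M * (b - a).
Proof.
move=> ab hg h; apply: (@mean_value_ineq _ _ g) => // t _; exact: cprimP.
Qed.

Lemma cint_affine a b (k l : C) :
  cint a b (fun t => k + l * t%:C) = k * (b - a)%:C + l * ((b ^+ 2 - a ^+ 2) / 2)%:C.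
Proof.
rewrite (@cintE _ _ _ (fun t => k * t%:C + l * (2^-1 * (t%:C * t%:C)))).
  by rewrite !rmorphM !rmorphB /= !rmorphXn /= fmorphV /= rmorphMn /= rmorph1; ring.
move=> t; have := cderivD (cderivZ k (cderiv_id t))
  (cderivZ l (cderivZ 2^-1 (cderivM (cderiv_id t) (cderiv_id t)))).
rewrite (_ : k * 1 + _ = k + l * t%:C)//.
by field.
Qed.

End CurveIntegral.

(** * Goursat's and Cauchy's theorems *)

Section Goursat.
Context {R : realType}.
Local Notation C := R[i].

Lemma nested_intervals (a b : nat -> R) :
  (forall n, a n <= a n.+1) -> (forall n, b n.+1 <= b n) ->
  (forall n, a n <= b n) -> exists x, forall n, a n <= x <= b n.
Proof.
move=> ai bd ab.
have am n m : (n <= m)%N -> a n <= a m.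
  by move=> /subnK <-; elim: (m - n)%N => [|k IH]; [|exact: le_trans (ai _)].
have bm n m : (n <= m)%N -> b m <= b n.
  by move=> /subnK <-; elim: (m - n)%N => [|k IH]; [|exact: le_trans (bd _) _].
have ub n : ubound (range a) (b n).
  move=> _ [m _ <-]; have [nm|/ltnW mn] := leqP n m.
    by rewrite (le_trans (ab m))// bm.
  by rewrite (le_trans (am _ _ mn)).
exists (sup (range a)) => n; apply/andP; split.
  by apply: ub_le_sup; [exists (b 0%N); exact: ub|exists n].
by apply: ge_sup; [exists (a 0%N), 0%N|exact: ub].
Qed.

Lemma exp2_gt (K : R) : exists n, K < 2 ^+ n.
Proof.
exists (Num.bound K); have [K0|K0] := leP 0 K; last first.
  by rewrite (lt_le_trans K0)// exprn_ge0.
rewrite (lt_le_trans (archi_boundP K0))// -natrX ler_nat.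
exact/ltnW/ltn_expl.
Qed.

Variable F : R -> R -> C.

(** Complex differentiability at x + iy of a function of two real variables. *)
Definition complex_differentiable2 (x y : R) : Prop :=
  exists A : C, forall e : R, 0 < e -> exists2 d : R, 0 < d &
    forall s t : R, `|s| < d -> `|t| < d ->
    nrm (F (x + s) (y + t) - F x y - A * (s%:C + 'i * t%:C)) <= e * (`|s| + `|t|).

(** The contour integral of F(x + iy) dz along the boundary of [a, b] x [c, d], counterclockwise. *)
Definition rectint (a b c d : R) : C :=
  cint a b (F^~ c) - cint a b (F^~ d) + 'i * (cint c d (F b) - cint c d (F a)).

Hypothesis contx : forall y, ccont (F^~ y).
Hypothesis conty : forall x, ccont (F x).

Lemma rectint_split a b c d m k :
  rectint a b c d = (rectint a m c k + rectint m b c k) +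
                    (rectint a m k d + rectint m b k d).
Proof.
rewrite /rectint -(cint_split a m b (F^~ c)) -(cint_split a m b (F^~ d)).
rewrite -(cint_split c k d (F b)) -(cint_split c k d (F a)).
ring.
Qed.

(** The contour integral of an affine function of z vanishes, so only the deviation from it counts.
    The 4 combines the 2 of [cint_le] with the two sides in each direction. *)
Lemma rectint_le a b c d (k A : C) (M : R) : a <= b -> c <= d ->
  (forall x y, a <= x <= b -> c <= y <= d ->
     nrm (F x y - (k + A * (x%:C + 'i * y%:C))) <= M) ->
  nrm (rectint a b c d) <= 4 * M * (b - a + (d - c)).
Proof.
move=> ab cd h.
pose T x y : C := k + A * (x%:C + 'i * y%:C).
have Tx y : (T^~ y) = (fun x : R => (k + A * 'i * y%:C) + A * x%:C).
  by apply/funext => x; rewrite /T; ring.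
have Ty x : T x = (fun y : R => (k + A * x%:C) + A * 'i * y%:C).
  by apply/funext => y; rewrite /T; ring.
have ca (p q : C) : ccont (fun x : R => p + q * x%:C).
  apply: ccontD; first exact: ccont_cst.
  apply: ccontM; first exact: ccont_cst.
  by apply: ccont_cderiv => t; exact: cderiv_id.
have cTx y : ccont (T^~ y) by rewrite Tx.
have cTy x : ccont (T x) by rewrite Ty.
have i2 : 'i * 'i = -1 :> C by rewrite -expr2 sqr_i.
have T0 : cint a b (T^~ c) - cint a b (T^~ d) + 'i * (cint c d (T b) - cint c d (T a)) = 0.
  rewrite !Tx !Ty !cint_affine !rmorphB /=.
  transitivity (A * 'i * (b%:C - a%:C) * (c%:C - d%:C) + ('i * 'i) * A * 0 + 'i * A * (b%:C - a%:C) * (d%:C - c%:C)).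
    ring.
  ring.
have -> : rectint a b c d = rectint a b c d - 0 by rewrite subr0.
rewrite -T0 /rectint.
have -> : forall x y z w x' y' z' w' i : C, x - y + i * (z - w) - (x' - y' + i * (z' - w')) =
  (x - x') - (y - y') + i * ((z - z') - (w - w')) by move=> *; ring.
have M0 : 0 <= M by apply: le_trans (h a c _ _); rewrite ?nrm_ge0 ?lexx ?ab ?cd.
have H1 y : c <= y <= d -> nrm (cint a b (F^~ y) - cint a b (T^~ y)) <= 2 * M * (b - a).
  move=> yy; rewrite -cintB//; apply: cint_le => //; last by move=> t tt; exact: h.
  exact: ccontB.
have H2 x : a <= x <= b -> nrm (cint c d (F x) - cint c d (T x)) <= 2 * M * (d - c).
  move=> yy; rewrite -cintB//; apply: cint_le => //; last by move=> t tt; exact: h.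
  exact: ccontB.
have := H1 c; have := H1 d; have := H2 a; have := H2 b.
rewrite !lexx ab cd => /(_ isT) h1 /(_ isT) h2 /(_ isT) h3 /(_ isT) h4.
have comb (p q r s : C) (P Q : R) : nrm p <= P -> nrm q <= P -> nrm r <= Q -> nrm s <= Q ->
    nrm (p - q + 'i * (r - s)) <= 2 * P + 2 * Q.
  move=> hp hq hr hs; rewrite (le_trans (nrmD _ _))// nrmM nrmi mul1r.
  have := nrmB p q; have := nrmB r s; lra.
rewrite (_ : 4 * M * _ = 2 * (2 * M * (b - a)) + 2 * (2 * M * (d - c))); last by ring.
apply: comb; [exact: h4|exact: h3|exact: h1|exact: h2].
Qed.

(* Bisection: if the integral over the rectangle exceeds e times the square of
   its half perimeter, so does the integral over one of its quarters. *)
Theorem goursat a b c d : a <= b -> c <= d ->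
  (forall x y, a <= x <= b -> c <= y <= d -> complex_differentiable2 x y) ->
  rectint a b c d = 0.
Proof.
move=> ab cd dF; apply/nrm_eq0/le_anti; rewrite nrm_ge0 andbT leNgt; apply/negP => I0.
have [e e0 Ie] : exists2 e, 0 < e & e * (b - a + (d - c)) ^+ 2 < nrm (rectint a b c d).
  pose k := (b - a + (d - c)) ^+ 2 + 1.
  have k0 : 0 < k by rewrite ltr_pwDr// sqr_ge0.
  exists (nrm (rectint a b c d) / k); first exact: divr_gt0.
  by rewrite mulrAC ltr_pdivrMr// ltr_pM2l// /k ltrDl.
pose bad (q : (R * R) * (R * R)) :=
  e * (q.1.2 - q.1.1 + (q.2.2 - q.2.1)) ^+ 2 < nrm (rectint q.1.1 q.1.2 q.2.1 q.2.2).
(* A pair of booleans selects a quarter. The default [(true, true)] in [next] never matters, as a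
   bad rectangle has a bad quarter. *)
pose half (i : bool) (p : R * R) : R * R :=
  if i then (p.1, (p.1 + p.2) / 2) else ((p.1 + p.2) / 2, p.2).
pose quarter (ij : bool * bool) q := (half ij.1 q.1, half ij.2 q.2).
pose next q := quarter (xget (true, true) [set ij | bad (quarter ij q)]) q.
have bad_next q : bad q -> bad (next q).
  move=> bq; have : exists ij, bad (quarter ij q).
    apply: contrapT => /forallNP nb.
    have nb' ij : nrm (rectint (quarter ij q).1.1 (quarter ij q).1.2
       (quarter ij q).2.1 (quarter ij q).2.2) <= e * (q.1.2 - q.1.1 + (q.2.2 - q.2.1)) ^+ 2 / 4.
      have := nb ij; rewrite /bad => /negP; rewrite -leNgt => /le_trans; apply.
      rewrite le_eqVlt; apply/orP; left; apply/eqP.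
      by case: ij => -[] [] /=; field.
    move: bq; rewrite /bad (rectint_split _ _ _ _ ((q.1.1 + q.1.2) / 2) ((q.2.1 + q.2.2) / 2)).
    have := nb' (true, true); have := nb' (true, false).
    have := nb' (false, true); have := nb' (false, false) => /=.
    set i1 := rectint _ _ _ _; set i2 := rectint _ _ _ _.
    set i3 := rectint _ _ _ _; set i4 := rectint _ _ _ _ => h1 h2 h3 h4.
    have := nrmD (i4 + i2) (i3 + i1); have := nrmD i4 i2; have := nrmD i3 i1.
    lra.
  by move=> /(@xgetPex _ (true, true) [set ij | bad (quarter ij q)]).
pose q n := iter n next ((a, b), (c, d)).
have bq n : bad (q n) by elim: n => [|n IH] //=; exact: bad_next.
have half_le i p : p.1 <= p.2 ->
  [/\ p.1 <= (half i p).1, (half i p).2 <= p.2, (half i p).1 <= (half i p).2 &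
      (half i p).2 - (half i p).1 = (p.2 - p.1) / 2].
  by case: p => u v /= uv; case: i => /=; split; lra.
have inv n : [/\ (q n).1.1 <= (q n).1.2, (q n).2.1 <= (q n).2.2,
    (q n).1.2 - (q n).1.1 = (b - a) / 2 ^+ n & (q n).2.2 - (q n).2.1 = (d - c) / 2 ^+ n].
  elim: n => [|n [h1 h2 h3 h4]]; first by rewrite expr0 !divr1.
  rewrite [q n.+1]/(next (q n)) /next; set ij := xget _ _.
  have [_ _ u1 v1] := half_le ij.1 _ h1; have [_ _ u2 v2] := half_le ij.2 _ h2.
  by split=> //=; rewrite ?v1 ?v2 ?h3 ?h4 exprSr invfM mulrA.
have [x xq] : exists x, forall n, (q n).1.1 <= x <= (q n).1.2.
  apply: nested_intervals => n; have [h1 h2 _ _] := inv n => //;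
    rewrite [q n.+1]/(next (q n)) /next; set ij := xget _ _;
    by have [] := half_le ij.1 _ h1.
have [y yq] : exists x, forall n, (q n).2.1 <= x <= (q n).2.2.
  apply: nested_intervals => n; have [h1 h2 _ _] := inv n => //;
    rewrite [q n.+1]/(next (q n)) /next; set ij := xget _ _;
    by have [] := half_le ij.2 _ h2.
have [A HA] := dF x y (xq 0%N) (yq 0%N).
(* In a rectangle of half perimeter [L] around the limit point the affine approximation is within
   [M = e / 8 * (2 * L)], and the bound [4 * M * L] is then exactly [e * L ^+ 2]. *)
have e8 : 0 < e / 8 by rewrite divr_gt0.
have [r r0 Hr] := HA _ e8.
have [n Hn] := exp2_gt ((b - a + (d - c)) / r).
have n0 : 0 < 2 ^+ n :> R by rewrite exprn_gt0.
have [h1 h2 h3 h4] := inv n.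
have sz : (q n).1.2 - (q n).1.1 + ((q n).2.2 - (q n).2.1) < r.
  rewrite h3 h4 -mulrDl ltr_pdivrMr//.
  by rewrite mulrC -ltr_pdivrMr.
have := bq n; rewrite /bad ltNge => /negP; apply.
set L := _ - _ + _ in sz *.
have -> : e * L ^+ 2 = 4 * (e / 8 * (2 * L)) * L by field.
apply: (@rectint_le _ _ _ _ (F x y - A * (x%:C + 'i * y%:C)) A) => // u v hu hv.
have := xq n; have := yq n => /andP[y1 y2] /andP[x1 x2].
move: hu hv => /andP[u1 u2] /andP[v1 v2].
have su : `|u - x| <= L by rewrite ler_norml /L; apply/andP; split; lra.
have sv : `|v - y| <= L by rewrite ler_norml /L; apply/andP; split; lra.
have := Hr (u - x) (v - y) (le_lt_trans su sz) (le_lt_trans sv sz).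
rewrite !subrKC !rmorphB /=.
have -> : F u v - F x y - A * (u%:C - x%:C + 'i * (v%:C - y%:C)) =
  F u v - (F x y - A * (x%:C + 'i * y%:C) + A * (u%:C + 'i * v%:C)) by ring.
move=> /le_trans; apply.
by rewrite ler_pM2l//; lra.
Qed.

End Goursat.

Section Cauchy.
Context {R : realType}.
Local Notation C := R[i].

Section PointwiseRules.
Context {V : normedModType C}.
Implicit Types f g : V -> C.

Lemma differentiable_mulf f g z : differentiable f z -> differentiable g z ->
  differentiable (fun x => f x * g x) z.
Proof. by move=> df dg; exact: (@differentiableM _ _ f g z df dg). Qed.

Lemma differentiable_subf f g z : differentiable f z -> differentiable g z ->
  differentiable (fun x => f x - g x) z.
Proof. by move=> df dg; exact: (@differentiableB _ _ _ f g z df dg). Qed.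

Lemma differentiable_invf f z : differentiable f z -> f z != 0 ->
  differentiable (fun x => (f x)^-1) z.
Proof. by move=> df f0; exact: (@differentiableV _ _ f z df f0). Qed.

End PointwiseRules.

Definition cis (t : R) : C := cos t +i* sin t.

Lemma nrm_cis t : nrm (cis t) = 1.
Proof. by rewrite nrmC_def /= cos2Dsin2 sqrtr1. Qed.

Lemma cisD s t : cis (s + t) = cis s * cis t.
Proof. by apply/eqP; rewrite eq_complex /= cosD sinD [X in _ && (_ == X)]addrC !eqxx. Qed.

Lemma cis0 : cis 0 = 1.
Proof. by rewrite /cis cos0 sin0. Qed.

Lemma cis2pi : cis (pi *+ 2) = 1.
Proof. by rewrite /cis cos2pi sin2pi. Qed.

Lemma cisN t : cis t * cis (- t) = 1.
Proof. by rewrite -cisD subrr cis0. Qed.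

Lemma cderiv_cis t : cderiv cis t ('i * cis t).
Proof.
apply/cderivP; split; first by rewrite cReM /= mul0r sub0r mul1r; exact: is_derive_cos.
by rewrite cImM /= mul0r add0r mul1r; exact: is_derive_sin.
Qed.

Lemma cderiv_cisN t : cderiv (fun s => cis (- s)) t (- 'i * cis (- t)).
Proof.
apply/cderivP; split.
  rewrite (_ : (fun _ => _) = cos); last by apply/funext => s /=; rewrite cosN.
  by rewrite cReM /= oppr0 mul0r sub0r sinN mulrNN mul1r; exact: is_derive_cos.
rewrite (_ : (fun _ => _) = - sin); last by apply/funext => s /=; rewrite sinN.
rewrite cImM /= oppr0 mul0r add0r cosN mulN1r.
by apply: is_deriveN; exact: is_derive_sin.
Qed.

Lemma ccont_cis : ccont cis.
Proof. exact: ccont_cderiv cderiv_cis. Qed.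

Lemma ccont_cisN : ccont (fun t => cis (- t)).
Proof. exact: ccont_cderiv cderiv_cisN. Qed.

(** The exponential of s + it. Being multiplicative, it need only be differentiated at 0. *)
Definition polar (s t : R) : C := (expR s)%:C * cis t.

Lemma polarD s s' t t' : polar (s + s') (t + t') = polar s t * polar s' t'.
Proof. by rewrite /polar expRD cisD rmorphM mulrACA. Qed.

Lemma nrm_polar s t : nrm (polar s t) = expR s.
Proof. by rewrite nrmM nrmR nrm_cis mulr1 ger0_norm// expR_ge0. Qed.

Lemma polar_diff0 (e : R) : 0 < e -> exists2 d : R, 0 < d &
  forall s t : R, `|s| < d -> `|t| < d ->
    nrm (polar s t - 1 - (s%:C + 'i * t%:C)) <= e * (`|s| + `|t|).
Proof.
move=> e0.
have dE : cderiv (fun s : R => (expR s)%:C) 0 1.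
  by apply: cderiv_ofreal; have := is_derive_expR (0:R); rewrite expR0.
have e3 : 0 < e / 3 by lra.
have [d1 d10 H1] := dE _ e3.
have [d2 d20 H2] := cderiv_cont dE e3.
have [d2' d20' H2'] := cderiv_cont dE ltr01.
(* A sixth rather than a third, because this error is multiplied by [expR s], bounded by 2. *)
have e6 : 0 < e / 6 by lra.
have [d3 d30 H3] := cderiv_cis 0 e6.
exists (Num.min (Num.min d1 d2) (Num.min d2' d3)); first by rewrite !lt_min d10 d20 d20' d30.
move=> s t; rewrite !lt_min => /andP[/andP[s1 s2] /andP[s3 _]] /andP[_ /andP[_ t3]].
have := H1 _ s1; have := H2 _ s2; have := H2' _ s3; have := H3 _ t3.
rewrite !add0r expR0 cis0 !mulr1.
have -> : polar s t - 1 - (s%:C + 'i * t%:C) =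
  ((expR s)%:C - 1 - s%:C) + (expR s)%:C * (cis t - 1 - t%:C * 'i) +
  ((expR s)%:C - 1) * ('i * t%:C) by rewrite /polar; ring.
set A := _ - s%:C; set B := _ - _ * 'i; set D := _ - 1%:C => hB hD' hD hA.
have hE : nrm (expR s)%:C <= 2.
  have := nrm_leD (expR s)%:C (1 : C); rewrite nrm1 -/D; lra.
apply: le_trans (nrmD _ _) _; rewrite !nrmM nrmi mul1r nrmR.
have := nrmD A ((expR s)%:C * B); rewrite nrmM => h.
have B0 := nrm_ge0 B; have E0 := nrm_ge0 (expR s)%:C.
have t0 := normr_ge0 t; have D0 := nrm_ge0 D; have s0 := normr_ge0 s.
have h1 : nrm (expR s)%:C * nrm B <= 2 * (e / 6 * `|t|) by apply: ler_pM.
have h2 : nrm D * `|t| <= e / 3 * `|t| by apply: ler_wpM2r => //; exact: ltW.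
have es := mulr_ge0 (ltW e0) s0; have et := mulr_ge0 (ltW e0) t0.
lra.
Qed.

Lemma polar_diff s t (e : R) : 0 < e -> exists2 d : R, 0 < d &
  forall s' t' : R, `|s'| < d -> `|t'| < d ->
    nrm (polar (s + s') (t + t') - polar s t - polar s t * (s'%:C + 'i * t'%:C))
      <= e * (`|s'| + `|t'|).
Proof.
move=> e0; have p0 : 0 < expR s := expR_gt0 s.
have [d d0 H] := polar_diff0 (divr_gt0 e0 p0).
exists d => // s' t' sd td; rewrite polarD.
have -> : polar s t * polar s' t' - polar s t - polar s t * (s'%:C + 'i * t'%:C) =
  polar s t * (polar s' t' - 1 - (s'%:C + 'i * t'%:C)) by ring.
rewrite nrmM nrm_polar mulrC -ler_pdivlMr//.
by rewrite mulrAC; exact: H.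
Qed.

Lemma diff_mul (g : C -> C) z h : differentiable g z -> 'd g z h = h * 'd g z 1.
Proof. by move=> dg; rewrite -[h in LHS]mulr1 -[h * 1]/(h *: (1 : C)) linearZ. Qed.

(* In logarithmic polar coordinates the circles are the vertical sides of a
   rectangle whose horizontal sides cancel by periodicity. *)
Lemma circle_integral_const (g : C -> C) (r r1 r2 : R) :
  (forall z, 0 < nrm z < r -> differentiable g z) -> 0 < r1 -> r1 <= r2 -> r2 < r ->
  cint 0 (pi *+ 2) (fun t => g (r1%:C * cis t)) =
  cint 0 (pi *+ 2) (fun t => g (r2%:C * cis t)).
Proof.
move=> dg r10 r12 r2r.
have r20 : 0 < r2 by lra.
(* Goursat's theorem is stated for functions continuous on all of R x R, while [g] is controlled
   only in the punctured disc. Freezing the radius beyond [r3] makes [F] total and continuous; since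
   [r2 < r3], nothing changes near the rectangle. *)
pose r3 := (r2 + r) / 2; have r30 : 0 < r3 by rewrite /r3; lra.
pose F s t := g (polar (Num.min s (ln r3)) t).
have bnd s : 0 < expR (Num.min s (ln r3)) < r.
  rewrite expR_gt0 /=; apply: (@le_lt_trans _ _ r3); last by rewrite /r3; lra.
  by rewrite -[leRHS]lnK ?posrE// ler_expR ge_min lexx orbT.
have gd s t : differentiable g (polar (Num.min s (ln r3)) t).
  by apply: dg; rewrite nrm_polar.
have contg s t e : 0 < e -> exists2 d : R, 0 < d & forall s' t', `|s'| < d -> `|t'| < d ->
    nrm (F (s + s') (t + t') - F s t) < e.
  move=> e0; have := differentiable_continuous (gd s t).
  move=> /nrm_cvgP/(_ e e0)[d d0 H].
  set s0 := Num.min s _ in H.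
  have [d' d'0 H'] := polar_diff s0 t ltr01.
  have k0 : 0 < 2 * (1 + expR s0) by have := expR_gt0 s0; lra.
  exists (Num.min d' (d / (2 * (1 + expR s0)))); first by rewrite lt_min d'0 divr_gt0.
  move=> s' t'; rewrite !lt_min !ltr_pdivlMr// => /andP[sd sd'] /andP[td td'].
  pose s1 := Num.min (s + s') (ln r3) - s0.
  have s1s : `|s1| <= `|s'|.
    rewrite /s1 /s0; have := ler_norm s'; have := ler_norm (- s'); rewrite normrN => h1 h2.
    have [a|a] := leP (s + s') (ln r3); have [b|b] := leP s (ln r3);
      rewrite ler_norml; apply/andP; split; lra.
  rewrite /F -(subrKC s0 (Num.min (s + s') _)) -/s1.
  rewrite -[polar (s0 + s1) _](subrKC (polar s0 t)); apply: H.
  have := H' s1 t' (le_lt_trans s1s sd) td; rewrite mul1r => h.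
  have := nrm_leD (polar (s0 + s1) (t + t') - polar s0 t) (polar s0 t * (s1%:C + 'i * t'%:C)).
  rewrite nrmM nrm_polar.
  have := nrmD (s1%:C : C) ('i * t'%:C); rewrite nrmM nrmi mul1r !nrmR => h2 h3.
  apply: le_lt_trans h3 _.
  have := expR_gt0 s0 => E0.
  have : expR s0 * nrm (s1%:C + 'i * t'%:C : C) <= expR s0 * (`|s'| + `|t'|).
    by rewrite ler_pM2l//; lra.
  nra.
have cx t : ccont (F^~ t).
  move=> s e /(contg s t)[d d0 H]; exists d => // s' sd.
  by have := H s' 0 sd; rewrite normr0 addr0; exact.
have cy s : ccont (F s).
  move=> t e /(contg s t)[d d0 H]; exists d => // t' td.
  by have := H 0 t'; rewrite normr0 addr0; apply.
have lr : ln r2 < ln r3 by rewrite ltr_ln ?posrE//; rewrite /r3; lra.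
have := @goursat _ F cx cy (ln r1) (ln r2) 0 (pi *+ 2).
have pi0 : 0 <= pi *+ 2 :> R by rewrite mulrn_wge0// pi_ge0.
rewrite ler_ln ?posrE// => /(_ r12 pi0).
have Fdiff : forall x y, ln r1 <= x <= ln r2 -> 0 <= y <= pi *+ 2 -> complex_differentiable2 F x y.
  move=> x y /andP[_ x2] _.
  have xs : x < ln r3 by lra.
  have xE : Num.min x (ln r3) = x by apply/min_idPl; exact: ltW.
  have dgx := gd x y; rewrite xE in dgx.
  pose p := polar x y; exists ('d g p 1 * p) => e e0.
  have [B hB] := nrm_diff_le dgx.
  have B0 : 0 <= B by have := hB 1; rewrite nrm1 mulr1; apply: le_trans; exact: nrm_ge0.
  have E0 := expR_gt0 x.
  have k0 : 0 < 2 * (1 + expR x) by lra.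
  have e1 : 0 < e / (2 * (1 + expR x)) by exact: divr_gt0.
  have [d d0 H] := diff_nrm dgx e1.
  have l0 : 0 < 2 * (B + 1) by lra.
  have e2 : 0 < Num.min 1 (e / (2 * (B + 1))) by rewrite lt_min ltr01 divr_gt0.
  have [d' d'0 H'] := polar_diff x y e2.
  exists (Num.min (Num.min d' (ln r3 - x)) (d / (2 * (1 + expR x)))).
    by rewrite !lt_min d'0 subr_gt0 xs divr_gt0.
  move=> s t; rewrite !lt_min !ltr_pdivlMr// => /andP[/andP[s1 s2] s3] /andP[/andP[t1 _] t3].
  have xsE : Num.min (x + s) (ln r3) = x + s.
    by apply/min_idPl; have := ler_norm s; lra.
  rewrite /F xE xsE -/p.
  have := H' s t s1 t1; rewrite -/p.
  pose q := polar (x + s) (y + t) - p; rewrite -/q => hq.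
  have st : nrm (s%:C + 'i * t%:C : C) <= `|s| + `|t|.
    by have := nrmD (s%:C : C) ('i * t%:C); rewrite nrmM nrmi mul1r !nrmR.
  have s0 := normr_ge0 s; have t0 := normr_ge0 t.
  have m1 : Num.min 1 (e / (2 * (B + 1))) <= 1 by rewrite ge_min lexx.
  have m2 : Num.min 1 (e / (2 * (B + 1))) * (2 * (B + 1)) <= e.
    by rewrite -ler_pdivlMr// ge_min lexx orbT.
  set mn := Num.min 1 _ in hq m1 m2 e2.
  have Es : expR x * nrm (s%:C + 'i * t%:C : C) <= expR x * (`|s| + `|t|) by rewrite ler_pM2l.
  have nq : nrm q <= (1 + expR x) * (`|s| + `|t|).
    have := nrm_leD q (p * (s%:C + 'i * t%:C)); rewrite nrmM nrm_polar => h.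
    apply: le_trans h _; nra.
  have qd : nrm q < d by apply: le_lt_trans nq _; nra.
  have := H q qd; rewrite (diff_mul _ dgx) -/p -[p + q]/(p + (_ - p)) subrKC => hg.
  rewrite (_ : _ - _ = (g (polar (x + s) (y + t)) - g p - q * 'd g p 1) +
     'd g p 1 * (q - p * (s%:C + 'i * t%:C))); last by ring.
  apply: le_trans (nrmD _ _) _; rewrite nrmM.
  have nB : nrm ('d g p 1) <= B by have := hB 1; rewrite nrm1 mulr1.
  have h1 : nrm (g (polar (x + s) (y + t)) - g p - q * 'd g p 1) <= e / 2 * (`|s| + `|t|).
    apply: le_trans hg _; rewrite (_ : e / 2 * _ = e / (2 * (1 + expR x)) * ((1 + expR x) * (`|s| + `|t|))).
      by rewrite ler_pM2l.
    by field; lra.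
  have h2 : nrm ('d g p 1) * nrm (q - p * (s%:C + 'i * t%:C)) <= B * (mn * (`|s| + `|t|)).
    by apply: ler_pM => //; exact: nrm_ge0.
  have : B * (mn * (`|s| + `|t|)) <= e / 2 * (`|s| + `|t|).
    by rewrite mulrA; apply: ler_wpM2r; [lra|clear -m2 e2; lra].
  lra.
move=> /(_ Fdiff); rewrite /rectint.
have -> : F^~ (pi *+ 2) = F^~ 0 by apply/funext => s; rewrite /F /polar cis2pi cis0.
rewrite subrr add0r => /eqP; rewrite mulf_eq0 => /orP[|].
  by rewrite eq_complex /= oner_eq0 andbF.
have Fr rr : 0 < rr -> rr <= r2 -> F (ln rr) = fun t => g (rr%:C * cis t).
  move=> rr0 rr2; apply/funext => t; rewrite /F /polar.
  have -> : Num.min (ln rr) (ln r3) = ln rr.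
    by apply/min_idPl; rewrite ler_ln ?posrE//; rewrite /r3; lra.
  by rewrite lnK.
by rewrite subr_eq0 !Fr// => /eqP.
Qed.

(** The difference quotient g(z) = (f z - f 0) / z is holomorphic off 0, so its circle integral does
    not depend on the radius, and it tends to f'(0) as the radius shrinks. Substituting f = z g + f
    0 gives the formula, as [cis (- t)] has integral 0. *)
Lemma cauchy_derivative1 (f : C -> C) (r0 r : R) : 0 < r -> r < r0 ->
  (forall z, nrm z < r0 -> differentiable f z) ->
  cint 0 (pi *+ 2) (fun t => f (r%:C * cis t) * cis (- t)) = (pi *+ 2 * r)%:C * 'd f 0 1.
Proof.
move=> rp rr0 df.
have r0p : 0 < r0 by lra.
have df0 : differentiable f 0 by apply: df; rewrite nrm0.
pose g z := (f z - f 0) * z^-1.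
have dg z : 0 < nrm z < r0 -> differentiable g z.
  move=> /andP[z0 zr]; apply: differentiable_mulf.
    by apply: differentiable_subf; [exact: df|exact: differentiable_cst].
  apply: (@differentiable_invf _ id); first by have h := is_diff_id z; apply: ex_diff.
  by apply/eqP => z00; rewrite z00 nrm0 ltxx in z0.
have pi0 : 0 <= pi *+ 2 :> R by rewrite mulrn_wge0// pi_ge0.
have cg s : 0 < s -> s < r0 -> ccont (fun t => g (s%:C * cis t)).
  move=> s0 sr t e e0.
  have nz u : nrm (s%:C * cis u) = s by rewrite nrmM nrmR nrm_cis mulr1 ger0_norm// ltW.
  have := differentiable_continuous (dg (s%:C * cis t) _); rewrite nz s0 => /(_ sr).
  move=> /nrm_cvgP/(_ e e0)[d d0 H].
  have [d' d'0 H'] := ccontM (ccont_cst s%:C) ccont_cis t d0.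
  by exists d' => // u /H'/H; rewrite subrKC.
have I : cint 0 (pi *+ 2) (fun t => g (r%:C * cis t)) = (pi *+ 2)%:C * 'd f 0 1.
  apply/eqP; rewrite -subr_eq0; apply/eqP/nrm_eq0/le_anti; rewrite nrm_ge0 andbT.
  apply/ler_addgt0Pr => e e0; rewrite add0r.
  have k0 : 0 < 2 * (pi *+ 2) + 1 :> R by lra.
  have [d d0 H] := diff_nrm df0 (divr_gt0 e0 k0).
  pose s := Num.min (r) (d / 2).
  have s0 : 0 < s by rewrite lt_min rp; lra.
  have sr : s <= r by rewrite ge_min lexx.
  have sd : s < d by apply: (@le_lt_trans _ _ (d / 2)); [rewrite ge_min lexx orbT|lra].
  rewrite -(circle_integral_const dg s0 sr rr0).
  have -> : (pi *+ 2)%:C * 'd f 0 1 = cint 0 (pi *+ 2) (fun=> 'd f 0 1).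
    rewrite (@cintE _ _ _ _ (fun t => 'd f 0 1 * t%:C)).
      by rewrite -mulrBr subr0 mulrC.
    by move=> t; rewrite -[X in cderiv _ _ X]mulr1; apply: cderivZ; exact: cderiv_id.
  rewrite -cintB; [|by apply: cg => //; lra|exact: ccont_cst].
  have := @cint_le _ 0 (pi *+ 2) (fun t => g (s%:C * cis t) - 'd f 0 1) (e / (2 * (pi *+ 2) + 1)) pi0.
  rewrite subr0 => h; apply: (le_trans (h _ _)).
  - by apply: ccontB; [apply: cg => //; lra|exact: ccont_cst].
  - move=> t _.
    have nz : nrm (s%:C * cis t) = s by rewrite nrmM nrmR nrm_cis mulr1 ger0_norm// ltW.
    have z0 : s%:C * cis t != 0 by apply/eqP => z0; move: s0; rewrite -nz z0 nrm0 ltxx.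
    have := H (s%:C * cis t); rewrite nz => /(_ sd); rewrite add0r (diff_mul _ df0) => h1.
    rewrite -(ler_pM2r s0) -[X in _ * X <= _]nz -nrmM; apply: le_trans h1.
    rewrite le_eqVlt; apply/orP; left; apply/eqP; congr nrm; rewrite /g.
    by set u := s%:C * cis t in z0 *; field.
  - rewrite (_ : _ * _ * _ = e * ((2 * (pi *+ 2)) / (2 * (pi *+ 2) + 1))); last by ring.
    by rewrite ler_piMr ?ltW// ltr_pdivrMr// mul1r ltrDl.
have cisN0 : cint 0 (pi *+ 2) (fun t => cis (- t)) = 0 :> C.
  rewrite (@cintE _ _ _ _ (fun t => 'i * cis (- t))).
    by rewrite oppr0 -mulrBr; have := cisN (pi *+ 2); rewrite cis2pi mul1r cis0 => ->; rewrite subrr mulr0.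
  move=> t; have := cderivZ 'i (cderiv_cisN t).
  by rewrite mulrA mulrN -expr2 sqr_i opprK mul1r.
rewrite (_ : (fun _ => _) = fun t => r%:C * g (r%:C * cis t) + f 0 * cis (- t)).
  rewrite cintD; first last.
  - by apply: ccontM; [exact: ccont_cst|exact: ccont_cisN].
  - by apply: ccontM; [exact: ccont_cst|exact: cg].
  rewrite !cintZ ?cisN0; [|exact: ccont_cisN|exact: cg].
  by rewrite I mulr0 addr0 rmorphM /=; ring.
apply/funext => t; rewrite /g.
have c0 : cis t != 0 by apply/eqP => c0; have := nrm_cis t; rewrite c0 nrm0; lra.
have -> : cis (- t) = (cis t)^-1 by apply: (mulfI c0); rewrite cisN divff.
have r0' : r%:C != 0 :> C by rewrite eq_complex /= eqxx andbT gt_eqF.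
by field; rewrite c0.
Qed.

End Cauchy.

(** * Derivatives of holomorphic functions are holomorphic *)

Section HolomorphicDerivative.
Context {R : realType} {V : normedModType R[i]}.
Local Notation C := R[i].
Implicit Types (f : V -> C) (v w z : V).

Lemma diff_line z v (t : C) :
  differentiable (fun t : C => z + t *: v) t /\
  'd (fun t : C => z + t *: v) t = (fun t : C => t *: v) :> (C -> V).
Proof.
have Ll : linear (fun t : C => t *: v).
  by move=> a u w /=; rewrite scalerDl -[a *: u]/(a * u) scalerA.
pose L : {linear C -> V} := HB.pack (fun t : C => t *: v)
  (GRing.isLinear.Build _ _ _ _ (fun t : C => t *: v) Ll).
apply: (@nrm_diff _ _ _ _ _ L (nrm v)) => [h|e e0]; first by rewrite nrmZ mulrC.
exists 1 => // h _; rewrite /L /= scalerDl addrA [_ + h *: v]addrC addrK subrr nrm0.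
by rewrite mulr_ge0 ?nrm_ge0// ltW.
Qed.

Lemma cderiv_line f z v (t : R) : differentiable f (z + t%:C *: v) ->
  cderiv (fun t : R => f (z + t%:C *: v)) t ('d f (z + t%:C *: v) v).
Proof.
move=> df e e0; have nv : 0 < nrm v + 1 by rewrite ltr_pwDr// nrm_ge0.
have [d d0 H] := diff_nrm df (divr_gt0 e0 nv).
exists (d / (nrm v + 1)); first exact: divr_gt0.
move=> s; rewrite ltr_pdivlMr// => sd.
have s0 := normr_ge0 s; have v0 := nrm_ge0 v.
rewrite rmorphD /= scalerDl addrA -[_%:C * _]/(_ *: ('d f _ v : C)) -linearZ.
have nsv : nrm (s%:C *: v) = `|s| * nrm v by rewrite nrmZ nrmR.
apply: le_trans (H _ _) _; rewrite nsv; first by nra.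
rewrite mulrAC ler_pdivrMr// -mulrA ler_pM2l//; nra.
Qed.

Lemma cauchy_derivative f z v (r0 r : R) : 0 < r -> r < r0 ->
  (forall t : C, nrm t < r0 -> differentiable f (z + t *: v)) ->
  cint 0 (pi *+ 2) (fun t => f (z + (r%:C * cis t) *: v) * cis (- t)) =
    (pi *+ 2 * r)%:C * 'd f z v.
Proof.
move=> rp rr0 df.
have dphi (t : C) : nrm t < r0 -> differentiable (fun t : C => f (z + t *: v)) t.
  move=> tr; apply: (@differentiable_comp _ _ _ _ (fun t : C => z + t *: v) f); last exact: df.
  exact: (diff_line z v t).1.
rewrite (cauchy_derivative1 rp rr0 dphi); congr (_ * _).
have d0 : differentiable f (z + (0 : C) *: v) by apply: df; rewrite nrm0; lra.
have [dl dlE] := diff_line z v 0.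
have := @diff_comp _ _ _ _ (fun t : C => z + t *: v) f 0 dl d0.
rewrite dlE.
move=> /(congr1 (fun h : C -> C => h 1)) /=.
by rewrite scale1r scale0r addr0.
Qed.

Section Local.
Variables (f : V -> C) (z0 : V) (rho B : R).
Hypothesis rho0 : 0 < rho.
Hypothesis df : forall z, nrm (z - z0) < 4 * rho -> differentiable f z.
Hypothesis fB : forall z, nrm (z - z0) < 4 * rho -> nrm (f z) <= B.

Let B0 : 0 <= B.
Proof. by apply: le_trans (nrm_ge0 _) (fB (z := z0) _); rewrite subrr nrm0 mulr_gt0. Qed.

Let pi2 : 0 < pi *+ 2 :> R.
Proof. by rewrite mulrn_wgt0// pi_gt0. Qed.

Lemma ccont_circle_comp (r : R) (z v : V) (g : V -> C) :
  (forall t, {for z + (r%:C * cis t) *: v, continuous g}) ->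
  ccont (fun t => g (z + (r%:C * cis t) *: v)).
Proof.
move=> cg t e e0; have /nrm_cvgP/(_ e e0)[d d0 H] := cg t.
have nv : 0 < nrm v + 1 by rewrite ltr_pwDr// nrm_ge0.
have [d' d'0 H'] := ccontM (ccont_cst r%:C) (@ccont_cis R) t (divr_gt0 d0 nv).
exists d' => // s /H'; rewrite ltr_pdivlMr// => hs.
have := H (((r%:C * cis (t + s)) - (r%:C * cis t)) *: v).
rewrite -addrA -scalerDl subrKC; apply; rewrite nrmZ.
by have := nrm_ge0 (r%:C * cis (t + s) - r%:C * cis t); nra.
Qed.

Lemma circle_dist (r : R) (v : V) t : 0 <= r -> nrm ((r%:C * cis t) *: v) = r * nrm v.
Proof. by move=> r0; rewrite nrmZ nrmM nrmR nrm_cis mulr1 ger0_norm. Qed.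

(** Cauchy's estimate on a circle in the complex line through [z] along [w]; the radius
    [rho / nrm w] keeps it at distance [rho] from [z]. Each use of Cauchy's formula costs part of
    the domain: [f] is bounded up to [4 * rho], its differential up to [2 * rho], the Lipschitz
    bound on the differential holds up to [rho]. *)
Lemma diff_bound z w : nrm (z - z0) < 2 * rho -> nrm ('d f z w) <= 2 * B / rho * nrm w.
Proof.
have rp := rho0.
move=> zr; have [->|w0] := eqVneq w 0; first by rewrite linear0 !nrm0 mulr0.
have nw : 0 < nrm w.
  by rewrite lt_def nrm_ge0 andbT; apply: contraNneq w0 => /nrm_eq0 ->.
pose r := rho / nrm w; have r0 : 0 < r by exact: divr_gt0.
have rw : r * nrm w = rho by rewrite /r divfK// gt_eqF.
have dd (t : C) : nrm t < 2 * r -> differentiable f (z + t *: w).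
  move=> tr; apply: df; rewrite addrAC.
  have := nrmD (z - z0) (t *: w); rewrite nrmZ => h.
  have := nrm_ge0 t; nra.
have r2 : r < 2 * r by lra.
have := cauchy_derivative r0 r2 dd.
move=> /(congr1 nrm); rewrite nrmM nrmR ger0_norm; last by rewrite mulr_ge0// ltW.
have := @cint_le _ 0 (pi *+ 2) (fun t => f (z + (r%:C * cis t) *: w) * cis (- t)) B (ltW pi2).
move=> /[swap] -> h.
have : pi *+ 2 * r * nrm ('d f z w) <= 2 * B * (pi *+ 2 - 0).
  apply: h => [|t _].
    apply: ccontM; last exact: ccont_cisN.
    apply: ccont_circle_comp => t; apply: differentiable_continuous.
    by apply: dd; rewrite nrmM nrmR nrm_cis mulr1 ger0_norm// ltW.
  rewrite nrmM nrm_cis mulr1; apply: fB.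
  rewrite addrAC; apply: le_lt_trans (nrmD _ _) _; rewrite circle_dist; last exact: ltW.
  lra.
rewrite subr0 -mulrA [2 * B * _]mulrC ler_pM2l// => h'.
rewrite (_ : 2 * B / rho * nrm w = 2 * B / r); last first.
  by rewrite -mulrA /r invfM invrK.
by rewrite ler_pdivlMr// mulrC.
Qed.

Let K := 2 * B / rho.
Let K0 : 0 <= K.
Proof. by rewrite /K mulr_ge0 ?invr_ge0 ?(ltW rho0)// mulr_ge0. Qed.

Lemma segment_ball z w (s r : R) : nrm (z - z0) < r -> nrm (z + w - z0) < r ->
  0 <= s <= 1 -> nrm (z + s%:C *: w - z0) < r.
Proof.
have rp := rho0.
move=> h1 h2 /andP[s0 s1].
have -> : z + s%:C *: w - z0 = (1 - s)%:C *: (z - z0) + s%:C *: (z + w - z0).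
  rewrite rmorphB /= scalerBl scale1r -[z + w - z0]addrAC [s%:C *: (_ + w)]scalerDr.
  by rewrite addrA subrK addrAC.
apply: le_lt_trans (nrmD _ _) _; rewrite !nrmZ !nrmR !ger0_norm ?subr_ge0//.
have [->|sn] := eqVneq s 0; first by lra.
have : 0 < s by rewrite lt_def sn. 
nra.
Qed.

Lemma lipschitz_local z w : nrm (z - z0) < 2 * rho -> nrm (z + w - z0) < 2 * rho ->
  nrm (f (z + w) - f z) <= 2 * K * nrm w.
Proof.
have rp := rho0.
move=> h1 h2.
have := @mean_value_ineq _ (fun s : R => f (z + s%:C *: w))
  (fun s => 'd f (z + s%:C *: w) w) 0 1 (K * nrm w) ler01.
rewrite scale1r scale0r addr0 subr0 mulr1 mulrA; apply.
  move=> s s01; apply: cderiv_line; apply: df.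
  by have := segment_ball h1 h2 s01; lra.
by move=> s s01; apply: diff_bound; exact: segment_ball.
Qed.

Let K2 := 8 * K / rho.
Let K20 : 0 <= K2.
Proof. by rewrite /K2 mulr_ge0 ?invr_ge0 ?(ltW rho0)// mulr_ge0. Qed.

(** Cauchy's formula for the difference of the two differentials, whose integrand is small by
    [lipschitz_local]. *)
Lemma diff_lipschitz z z' w : nrm (z - z0) < rho -> nrm (z' - z0) < rho ->
  nrm ('d f z w - 'd f z' w) <= K2 * nrm w * nrm (z - z').
Proof.
have rp := rho0.
move=> zr z'r; have [->|w0] := eqVneq w 0; first by rewrite (linear0 ('d f z)) (linear0 ('d f z')) subrr !nrm0 mulr0 mul0r.
have nw : 0 < nrm w.
  by rewrite lt_def nrm_ge0 andbT; apply: contraNneq w0 => /nrm_eq0 ->.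
pose r := rho / 2 / nrm w; have r0 : 0 < r by rewrite !divr_gt0.
have rw : r * nrm w = rho / 2 by rewrite /r divfK// gt_eqF.
have bb z1 (t : C) : nrm (z1 - z0) < rho -> nrm t < 2 * r -> nrm (z1 + t *: w - z0) < 2 * rho.
  move=> h tr; rewrite addrAC; apply: le_lt_trans (nrmD _ _) _; rewrite nrmZ; nra.
have dd z1 (t : C) : nrm (z1 - z0) < rho -> nrm t < 2 * r -> differentiable f (z1 + t *: w).
  by move=> h tr; apply: df; have := bb _ _ h tr; lra.
have r2 : r < 2 * r by lra.
have nr t : nrm (r%:C * cis t) < 2 * r.
  by rewrite nrmM nrmR nrm_cis mulr1 ger0_norm//; lra.
have cc z1 : nrm (z1 - z0) < rho -> ccont (fun t => f (z1 + (r%:C * cis t) *: w) * cis (- t)).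
  move=> h; apply: ccontM; last exact: ccont_cisN.
  by apply: ccont_circle_comp => t; apply: differentiable_continuous; exact: dd.
have e1 := cauchy_derivative r0 r2 (fun t => dd z t zr).
have e2 := cauchy_derivative r0 r2 (fun t => dd z' t z'r).
have := cintB 0 (pi *+ 2) (cc _ zr) (cc _ z'r).
rewrite e1 e2 -mulrBr => /(congr1 nrm); rewrite [in RHS]nrmM nrmR ger0_norm; last by rewrite mulr_ge0// ltW.
move=> h.
have : pi *+ 2 * r * nrm ('d f z w - 'd f z' w) <= 2 * (2 * K * nrm (z - z')) * (pi *+ 2 - 0).
  rewrite -h; apply: cint_le; first exact: ltW.
    by apply: ccontB; exact: cc.
  move=> t _; rewrite -mulrBl nrmM nrm_cis mulr1.
  have := @lipschitz_local (z' + (r%:C * cis t) *: w) (z - z').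
  have -> : z' + (r%:C * cis t) *: w + (z - z') = z + (r%:C * cis t) *: w.
    by rewrite addrAC subrKC.
  by apply; apply: bb.
rewrite subr0 -mulrA [leRHS]mulrC ler_pM2l// => h'.
rewrite (_ : K2 * nrm w * _ = 2 * (2 * K * nrm (z - z')) / r); last first.
  by rewrite /K2 /r; field; rewrite !gt_eqF.
by rewrite ler_pdivlMr// mulrC.
Qed.

Lemma taylor_local z w : nrm (z - z0) < rho -> nrm (z + w - z0) < rho ->
  nrm (f (z + w) - f z - 'd f z w) <= 2 * K2 * nrm w ^+ 2.
Proof.
have rp := rho0.
move=> h1 h2.
have := @mean_value_ineq _ (fun s : R => f (z + s%:C *: w) - 'd f z w * s%:C)
  (fun s => 'd f (z + s%:C *: w) w - 'd f z w) 0 1 (K2 * nrm w ^+ 2) ler01.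
rewrite scale1r scale0r addr0 subr0 !mulr1 mulr0 subr0 mulrA [f (z + w) - _ - _]addrAC; apply.
  move=> s s01; apply: cderivB.
    by apply: cderiv_line; apply: df; have := segment_ball h1 h2 s01; lra.
  by rewrite -[X in cderiv _ _ X]mulr1; apply: cderivZ; exact: cderiv_id.
move=> s s01; have := diff_lipschitz w (segment_ball h1 h2 s01) h1.
move=> /le_trans; apply; rewrite addrAC subrr add0r nrmZ nrmR.
move: s01 => /andP[s0 s1]; rewrite ger0_norm// expr2 [leRHS]mulrA.
apply: ler_wpM2l; first by rewrite mulr_ge0// nrm_ge0.
by rewrite ler_piMl ?nrm_ge0.
Qed.

(** Differentiation under Cauchy's integral: [taylor_local] bounds the remainder of [f]
    quadratically and uniformly along the circle. *)
Lemma differentiable_derivative v : differentiable (fun z => 'd f z v : C) z0.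
Proof.
have rp := rho0.
have nv : 0 < nrm v + 1 by rewrite ltr_pwDr// nrm_ge0.
have v0 := nrm_ge0 v.
pose r := rho / 2 / (nrm v + 1); have r0 : 0 < r by rewrite !divr_gt0.
have rw : r * (nrm v + 1) = rho / 2 by rewrite /r divfK// gt_eqF.
have r2 : r < 2 * r by lra.
have nr t : nrm (r%:C * cis t) = r.
  by rewrite nrmM nrmR nrm_cis mulr1 ger0_norm// ltW.
have zz : nrm (z0 - z0) < rho / 2 by rewrite subrr nrm0 divr_gt0.
have bb z (t : C) : nrm (z - z0) < rho / 2 -> nrm t <= r -> nrm (z + t *: v - z0) < rho.
  move=> h tr; rewrite addrAC; apply: le_lt_trans (nrmD _ _) _; rewrite nrmZ; nra.
have bb2 z (t : C) : nrm (z - z0) < rho / 2 -> nrm t < 2 * r -> nrm (z + t *: v - z0) < 4 * rho.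
  move=> h tr; rewrite addrAC; apply: le_lt_trans (nrmD _ _) _; rewrite nrmZ; nra.
have cau z : nrm (z - z0) < rho / 2 -> cint 0 (pi *+ 2)
    (fun t => f (z + (r%:C * cis t) *: v) * cis (- t)) = (pi *+ 2 * r)%:C * 'd f z v.
  by move=> h; apply: (cauchy_derivative r0 r2) => t tr; apply: df; exact: bb2.
have cc z : nrm (z - z0) < rho / 2 -> ccont (fun t => f (z + (r%:C * cis t) *: v) * cis (- t)).
  move=> h; apply: ccontM; last exact: ccont_cisN.
  apply: ccont_circle_comp => t; apply: differentiable_continuous; apply: df.
  by apply: bb2 => //; rewrite nr.
have cd w : ccont (fun t => 'd f (z0 + (r%:C * cis t) *: v) w * cis (- t)).
  apply: ccontM; last exact: ccont_cisN.
  apply: (@ccont_circle_comp _ _ _ (fun z => 'd f z w)) => t; apply/nrm_cvgP => e e0.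
  have k0 : 0 < K2 * nrm w + 1 by rewrite ltr_pwDr// mulr_ge0// nrm_ge0.
  have ht : nrm (z0 + (r%:C * cis t) *: v - z0) < rho by apply: bb; rewrite ?nr.
  exists (Num.min (e / (K2 * nrm w + 1)) (rho - nrm (z0 + (r%:C * cis t) *: v - z0))).
    by rewrite lt_min divr_gt0//= subr_gt0.
  move=> h; rewrite lt_min ltr_pdivlMr// => /andP[h1 h2].
  have hh : nrm (z0 + (r%:C * cis t) *: v + h - z0) < rho.
    by rewrite addrAC; apply: le_lt_trans (nrmD _ _) _; lra.
  apply: le_lt_trans (diff_lipschitz w hh ht) _.
  by rewrite addrAC subrr add0r; have := nrm_ge0 h; nra.
have P0 : 0 < pi *+ 2 * r by exact: mulr_gt0.
have P1 : (pi *+ 2 * r)%:C != 0 :> C by rewrite eq_complex /= eqxx andbT gt_eqF.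
(* The candidate differential: Cauchy's formula with [f] replaced by its derivative along [w]. *)
pose L w : C := ((pi *+ 2 * r)%:C)^-1 * cint 0 (pi *+ 2) (fun t => 'd f (z0 + (r%:C * cis t) *: v) w * cis (- t)).
have Llin : linear L.
  move=> a u w; rewrite /L.
  rewrite (_ : (fun t => _) = fun t => a * ('d f (z0 + (r%:C * cis t) *: v) u * cis (- t)) +
     'd f (z0 + (r%:C * cis t) *: v) w * cis (- t)); last first.
    by apply/funext => t; rewrite linearP /= mulrDl -mulrA.
  rewrite cintD//; last by apply: ccontM; [exact: ccont_cst|].
  by rewrite cintZ// mulrDr /GRing.scale /= mulrCA.
pose LL : {linear V -> C} := HB.pack L (GRing.isLinear.Build _ _ _ _ L Llin).
have bL h : nrm (LL h) <= 2 * K / r * nrm h.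
  rewrite /LL /= /L nrmM nrmV nrmR ger0_norm ?(ltW P0)//.
  rewrite ler_pdivrMl//.
  have := @cint_le _ 0 (pi *+ 2) _ (K * nrm h) (ltW pi2) (cd h).
  rewrite subr0 => H; apply: (le_trans (H _)).
    move=> t _; rewrite nrmM nrm_cis mulr1; apply: diff_bound.
    by have := bb z0 (r%:C * cis t) zz; rewrite nr => /(_ (lexx _)); lra.
  by rewrite le_eqVlt; apply/orP; left; apply/eqP; field; rewrite gt_eqF.
have [] := @nrm_diff _ _ _ (fun z => 'd f z v : C) z0 LL _ bL; last by [].
move=> e e0.
pose Q := 4 * K2 / r + 1.
have Q0 : 0 < Q by rewrite /Q ltr_pwDr// divr_ge0 ?(ltW r0)// mulr_ge0.
exists (Num.min (rho / 2) (e / Q)); first by rewrite lt_min !divr_gt0.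
move=> h; rewrite lt_min => /andP[h1]; rewrite ltr_pdivlMr// => h2.
have zh : nrm (z0 + h - z0) < rho / 2 by rewrite [z0 + h]addrC addrK.
have -> : 'd f (z0 + h) v - 'd f z0 v - LL h = ((pi *+ 2 * r)%:C)^-1 *
   cint 0 (pi *+ 2) (fun t => f (z0 + h + (r%:C * cis t) *: v) * cis (- t) -
      f (z0 + (r%:C * cis t) *: v) * cis (- t) -
      'd f (z0 + (r%:C * cis t) *: v) h * cis (- t)).
  rewrite cintB//; last by apply: ccontB; exact: cc.
  rewrite cintB; [|exact: cc|exact: cc].
  rewrite !cau// (_ : LL h = L h)// /L.
  set P := (pi *+ 2 * r)%:C in P1 *; set J := cint _ _ _.
  by rewrite !mulrBr !mulKf.
rewrite nrmM nrmV nrmR ger0_norm ?(ltW P0)// ler_pdivrMl//.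
have := @cint_le _ 0 (pi *+ 2) (fun t => f (z0 + h + (r%:C * cis t) *: v) * cis (- t) -
      f (z0 + (r%:C * cis t) *: v) * cis (- t) -
      'd f (z0 + (r%:C * cis t) *: v) h * cis (- t)) (2 * K2 * nrm h ^+ 2) (ltW pi2).
rewrite subr0 => H; apply: (le_trans (H _ _)).
- by apply: ccontB => //; apply: ccontB; exact: cc.
- move=> t _; rewrite -!mulrBl nrmM nrm_cis mulr1.
  rewrite [z0 + h + _]addrAC; apply: taylor_local; first by apply: bb; rewrite ?nr.
  by rewrite -[_ + _ + h]addrAC; apply: bb; rewrite ?nr.
have h0 := nrm_ge0 h.
have e1 : 4 * K2 / r * nrm h <= e by have := mulr_ge0 K20 h0; rewrite /Q in h2; lra.
rewrite (_ : 2 * (2 * K2 * nrm h ^+ 2) * (pi *+ 2) = (pi *+ 2 * r * nrm h) * (4 * K2 / r * nrm h)); last first.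
  by field; rewrite gt_eqF.
rewrite (_ : pi *+ 2 * r * (e * nrm h) = (pi *+ 2 * r * nrm h) * e); last by ring.
by apply: ler_wpM2l => //; rewrite mulr_ge0// ltW.
Qed.

End Local.

Lemma differentiable_derivative_near f z0 v : (\forall z \near z0, differentiable f z) ->
  differentiable (fun z => 'd f z v : C) z0.
Proof.
move=> /near_nrmP[d1 d10 H1].
have df0 : differentiable f z0 by rewrite -[z0]addr0; apply: H1; rewrite nrm0.
have /differentiable_continuous/nrm_cvgP/(_ 1 ltr01)[d2 d20 H2] := df0.
pose rho := Num.min d1 d2 / 4.
have r0 : 0 < rho by rewrite divr_gt0// lt_min d10.
have r4 : 4 * rho = Num.min d1 d2 by rewrite /rho; field.
apply: (@differentiable_derivative _ _ rho (nrm (f z0) + 1)) => // z;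
  rewrite r4 lt_min => /andP[z1 z2].
  by rewrite -(subrKC z0 z); exact: H1.
have := H2 _ z2; rewrite subrKC => h.
by apply: le_trans (nrm_leD _ (f z0)) _; lra.
Qed.

End HolomorphicDerivative.

(** * Smooth functions on open subsets of C^n *)

Section RowNorm.
Context {R : realType} {n : nat}.
Local Notation C := R[i].
Implicit Types e : 'rV[R[i]]_n.

Lemma nrm_coord e j : nrm (e 0 j : C) <= nrm e.
Proof.
rewrite -lecR -!nrmE /Num.norm /= mx_normE.
exact: (le_bigmax _ (fun ij : 'I_1 * 'I_n => `|e ij.1 ij.2|%:nng) (0, j)).
Qed.

Lemma nrm_row_le e (K : R) : 0 <= K -> (forall j, nrm (e 0 j : C) <= K) -> nrm e <= K.
Proof.
move=> K0 h; have [->|e0] := eqVneq e 0; first by rewrite nrm0.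
have : mx_norm e != 0 by apply: contra_neq e0 => /mx_norm_eq0.
move=> /mx_norm_neq0[[i j] /= eij].
by rewrite -lecR -nrmE /Num.norm /= eij (ord1 i) nrmE lecR.
Qed.

End RowNorm.

Section RealDerivative.
Context {R : realType} {n : nat}.
Local Notation C := R[i].
Local Notation V := 'rV[R[i]]_n.
Implicit Types (W : set V) (f g h : V -> C) (u v z : V).

Definition is_rd f v z (l : C) : Prop := cderiv (fun t : R => f (z + t%:C *: v)) 0 l.

Lemma is_rdP f v z l : is_rd f v z l -> rderivable f v z /\ rderive f v z = l.
Proof.
move=> /cderivP[[d1 e1] [d2 e2]]; split; first by split; [exact: d1|exact: d2].
apply/eqP; rewrite eq_complex /rderive /=.
by rewrite !derive1E e1 e2 !eqxx.
Qed.

Lemma rderivableP f v z : rderivable f v z -> is_rd f v z (rderive f v z).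
Proof.
move=> [h1 h2]; apply/cderivP; rewrite /rderive /= !derive1E.
by split; exact: derivableP.
Qed.

Lemma is_rd_eq f v z l : is_rd f v z l -> rderive f v z = l.
Proof. by case/is_rdP. Qed.

Lemma is_rd_near f g v z l : (\forall w \near z, f w = g w) ->
  is_rd f v z l -> is_rd g v z l.
Proof.
move=> /near_nrmP[d d0 fg]; apply: cderiv_near.
have nv : 0 < nrm v + 1 by rewrite ltr_pwDr// nrm_ge0.
exists (d / (nrm v + 1)); first exact: divr_gt0.
move=> s; rewrite ltr_pdivlMr// add0r => sd; apply: fg.
rewrite nrmZ nrmR; have := normr_ge0 s; nra.
Qed.

Lemma is_rdD f g v z l m : is_rd f v z l -> is_rd g v z m ->
  is_rd (fun w => f w + g w) v z (l + m).
Proof. exact: cderivD. Qed.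

Lemma is_rdM f g v z l m : is_rd f v z l -> is_rd g v z m ->
  is_rd (fun w => f w * g w) v z (l * g z + f z * m).
Proof.
by move=> df dg; have := cderivM df dg; rewrite scale0r addr0.
Qed.

Lemma is_rd_cst c v z : is_rd (fun=> c) v z 0.
Proof. exact: cderiv_cst. Qed.

Lemma is_rdZ c f v z l : is_rd f v z l -> is_rd (fun w => c * f w) v z (c * l).
Proof. exact: cderivZ. Qed.

Lemma is_rdB f g v z l m : is_rd f v z l -> is_rd g v z m ->
  is_rd (fun w => f w - g w) v z (l - m).
Proof. exact: cderivB. Qed.

Lemma is_rd_conj f v z l : is_rd f v z l -> is_rd (fun w => conjc (f w)) v z (conjc l).
Proof. exact: cderiv_conj. Qed.

Lemma is_rd_sum (I : Type) (r : seq I) (f : I -> V -> C) (l : I -> C) v z :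
  (forall i, is_rd (f i) v z (l i)) ->
  is_rd (fun w => \sum_(i <- r) f i w) v z (\sum_(i <- r) l i).
Proof.
move=> h; elim: r => [|i r IH].
  rewrite big_nil (_ : (fun _ => _) = fun=> 0); first exact: is_rd_cst.
  by apply/funext => w; rewrite big_nil.
rewrite big_cons (_ : (fun _ => _) = fun w => f i w + \sum_(i <- r) f i w); first exact: is_rdD.
by apply/funext => w; rewrite big_cons.
Qed.

Lemma conjc_norm2 (a : C) : a * conjc a = (nrm a ^+ 2)%:C.
Proof. by rewrite -sqr_normc nrmE rmorphXn. Qed.

(** Writing 1 / f as conj f / |f|^2 leaves only the inverse of a real function to differentiate. *)
Lemma is_rdV f v z l : f z != 0 -> is_rd f v z l ->
  is_rd (fun w => (f w)^-1) v z (- l / f z ^+ 2).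
Proof.
move=> f0 df.
pose N : V -> R := fun w => nrm (f w) ^+ 2.
have NE w : (N w)%:C = f w * conjc (f w) by rewrite conjc_norm2.
have N0 : N z != 0.
  rewrite /N sqrf_eq0; apply: contraNneq f0 => /nrm_eq0 ->//.
have dN : is_rd (fun w => (N w)%:C) v z (l * conjc (f z) + f z * conjc l).
  rewrite (_ : (fun _ => _) = fun w => f w * conjc (f w)); last exact/funext.
  exact: is_rdM df (is_rd_conj df).
have [dr di] := (cderivP _ _ _).1 dN.
have imD : complex.Im (l * conjc (f z) + f z * conjc l) = 0.
  by case: (l) (f z) => [a b] [c d] /=; ring.
have N0' : N (z + 0%:C *: v) != 0 by rewrite scale0r addr0.
have dVr := is_deriveV (f := fun t : R => N (z + t%:C *: v)) N0' dr.
rewrite scale0r addr0 in dVr.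
have dV : is_rd (fun w => ((N w)^-1)%:C) v z
    ((- (N z) ^- 2 *: complex.Re (l * conjc (f z) + f z * conjc l))%:C).
  exact: cderiv_ofreal dVr.
have := is_rdM (is_rd_conj df) dV.
have Vc (x : R) : (x^-1)%:C = (x%:C)^-1 :> C by exact: (fmorphV (real_complex R)).
(* At zeros of [f] both sides are 0, so the functions are equal everywhere. *)
have fE w : conjc (f w) * ((N w)^-1)%:C = (f w)^-1.
  have [fw|fw] := eqVneq (f w) 0; first by rewrite fw conjc0 invr0 mul0r.
  have cf : conjc (f w) != 0 by rewrite conjc_eq0.
  by rewrite Vc NE invfM mulrCA mulfV// mulr1.
rewrite (_ : (fun _ => _) = (fun w => (f w)^-1)); last exact/funext.
rewrite (_ : _ + _ = - l / f z ^+ 2)//.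
have cf : conjc (f z) != 0 by rewrite conjc_eq0.
have -> : (- (N z) ^- 2 *: complex.Re (l * conjc (f z) + f z * conjc l))%:C =
   - (f z * conjc (f z)) ^- 2 * (l * conjc (f z) + f z * conjc l).
  rewrite /GRing.scale /= rmorphM rmorphN /= Vc rmorphXn /= NE.
  by congr (_ * _); rewrite [RHS]complexE imD rmorph0 mulr0 addr0.
by rewrite Vc NE; field; rewrite f0.
Qed.

End RealDerivative.

Section SmoothBasics.
Context {R : realType} {n : nat}.
Local Notation C := R[i].
Local Notation V := 'rV[R[i]]_n.
Implicit Types (W : set V) (f g h : V -> C) (u v z : V).

Lemma Ck_ext k W f g : open W -> (forall z, W z -> f z = g z) -> Ck k W f -> Ck k W g.
Proof.
move=> oW; elim: k f g => [|k IH] f g fg.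
  move=> h z Wz; have nfg : \forall w \near z, f w = g w.
    by apply: filterS fg _; exact: open_nbhs_nbhs.
  have /near_nrmP[d1 d10 H1] := nfg.
  apply/nrm_cvgP => e e0; have /nrm_cvgP/(_ e e0)[d2 d20 H2] := h z Wz.
  exists (Num.min d1 d2); first by rewrite lt_min d10.
  by move=> x; rewrite lt_min => /andP[/H1 <- /H2]; rewrite (fg _ Wz).
move=> h v; have [d1 d2] := h v.
have nfg z : W z -> \forall w \near z, f w = g w.
  by move=> Wz; apply: filterS fg _; exact: open_nbhs_nbhs.
split=> [z Wz|].
  have := is_rd_near (nfg _ Wz) (rderivableP (d1 z Wz)).
  by case/is_rdP.
apply: IH d2 => z Wz.
have := is_rd_near (nfg _ Wz) (rderivableP (d1 z Wz)).
by move=> /is_rd_eq.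
Qed.

Lemma smooth_ext W f g : open W -> (forall z, W z -> f z = g z) ->
  smooth W f -> smooth W g.
Proof. by move=> oW fg h k; exact: Ck_ext (h k). Qed.

Lemma smooth_sub W W' f : W' `<=` W -> smooth W f -> smooth W' f.
Proof.
move=> WW h k; have := h k; elim: k (f) => [|k IH] g.
  by move=> c z /WW; exact: c.
by move=> hg v; have [d1 d2] := hg v; split=> [z /WW|]; [exact: d1|exact: IH].
Qed.

Lemma smooth_local W f : (forall z, W z -> exists U, [/\ open U, U z & smooth U f]) ->
  smooth W f.
Proof.
move=> h; suff H k g : (forall z, W z -> exists2 U : set V, U z & Ck k U g) -> Ck k W g.
  by move=> k; apply: H => z /h[U [_ Uz sU]]; exists U.
elim: k g => [|k IH] g hg.
  by move=> z Wz; have [U Uz c] := hg z Wz; exact: c.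
move=> v; split=> [z Wz|]; first by have [U Uz /(_ v)[d _]] := hg z Wz; exact: d.
by apply: IH => z Wz; have [U Uz /(_ v)[_ d]] := hg z Wz; exists U.
Qed.

Lemma smooth_cont W f z : smooth W f -> W z -> {for z, continuous f}.
Proof. by move=> h; exact: (h 0%N). Qed.

Lemma smooth_is_rd W f v z : smooth W f -> W z -> is_rd f v z (rderive f v z).
Proof. by move=> h Wz; apply: rderivableP; have [d _] := h 1%N v; exact: d. Qed.

Lemma smooth_rderive W f v : smooth W f -> smooth W (rderive f v).
Proof. by move=> h k; have [_ d] := h k.+1 v. Qed.

(** A class closed under directional derivatives avoids higher Leibniz and chain rules: the
    induction on the order takes place once, here. *)
Lemma smooth_coind W (P : (V -> C) -> Prop) : open W ->
  (forall f, P f -> forall z, W z -> {for z, continuous f}) ->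
  (forall f, P f -> forall v, exists2 g, P g & forall z, W z -> is_rd f v z (g z)) ->
  forall f, P f -> smooth W f.
Proof.
move=> oW cP dP f Pf k; elim: k f Pf => [|k IH] f Pf; first exact: cP.
move=> v; have [g Pg fg] := dP f Pf v; split=> [z Wz|].
  by have [] := is_rdP (fg z Wz).
by apply: Ck_ext (IH g Pg) => // z Wz; rewrite (is_rd_eq (fg z Wz)).
Qed.

End SmoothBasics.

Section TotalDerivative.
Context {R : realType} {n : nat}.
Local Notation C := R[i].
Local Notation V := 'rV[R[i]]_n.
Implicit Types (W : set V) (f : V -> C) (u v z e : V).

Lemma cderiv_scale (g : R -> C) (s t : R) l : cderiv g (s * t) l ->
  cderiv (fun r => g (r * t)) s (t%:C * l).
Proof.
move=> h e e0; have t0 := normr_ge0 t; have t1 : 0 < `|t| + 1 by lra.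
have [d d0 H] := h _ (divr_gt0 e0 t1).
exists (d / (`|t| + 1)); first exact: divr_gt0.
move=> r; rewrite ltr_pdivlMr// => rd.
rewrite mulrDl mulrA -rmorphM; have r0 := normr_ge0 r.
apply: le_trans (H _ _) _; rewrite normrM; first by nra.
rewrite mulrAC ler_pdivrMr// -mulrA ler_pM2l//; nra.
Qed.

Lemma is_rd_line f z v a l : is_rd f v (z + a%:C *: v) l ->
  cderiv (fun r : R => f (z + r%:C *: v)) a l.
Proof.
move=> h e e0; have [d d0 H] := h e e0; exists d; first exact: d0.
move=> s sd; have := H s sd.
by rewrite add0r rmorphD scalerDl addrA scale0r addr0.
Qed.

(** The mean value inequality together with continuity of the derivative makes the estimate uniform
    in the base point [z']. This uniformity allows several directions to be followed one after
    another, and gives Schwarz's theorem. *)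
Lemma strict_derivative_line W f z v : open W -> smooth W f -> W z ->
  forall e : R, 0 < e -> exists2 d : R, 0 < d & forall z' (t : R),
    nrm (z' - z) < d -> `|t| < d ->
    nrm (f (z' + t%:C *: v) - f z' - t%:C * rderive f v z) <= e * `|t|.
Proof.
move=> oW sf Wz e e0; have e2 : 0 < e / 2 by lra.
have /nrm_cvgP/(_ _ e2)[d1 d10 H1] := smooth_cont (smooth_rderive v sf) Wz.
have /near_nrmP[d2 d20 H2] : \forall w \near z, W w by exact: open_nbhs_nbhs.
have nv := nrm_ge0 v; have nv2 : 0 < nrm v + 2 by lra.
have m0 : 0 < Num.min d1 d2 by rewrite lt_min d10.
exists (Num.min d1 d2 / (nrm v + 2)); first exact: divr_gt0.
move=> z' t; rewrite !ltr_pdivlMr// => zz td.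
have inm (s : R) : 0 <= s <= 1 -> nrm (z' + (s * t)%:C *: v - z) < Num.min d1 d2.
  move=> /andP[s0 s1]; rewrite addrAC; apply: le_lt_trans (nrmD _ _) _.
  rewrite nrmZ nrmR normrM ger0_norm//.
  have := normr_ge0 t; have := nrm_ge0 (z' - z) => z0 t0.
  have : s * `|t| * nrm v <= `|t| * nrm v.
    by rewrite -mulrA; apply: ler_piMl => //; exact: mulr_ge0.
  nra.
have := @mean_value_ineq _ (fun s : R => f (z' + (s * t)%:C *: v) - t%:C * rderive f v z * s%:C)
  (fun s => t%:C * rderive f v (z' + (s * t)%:C *: v) - t%:C * rderive f v z)
  0 1 (e / 2 * `|t|) ler01.
rewrite mul1r mul0r scale0r addr0 mulr0 mulr1 !subr0 addrAC mulr1.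
have -> : 2 * (e / 2 * `|t|) = e * `|t| by field.
apply=> s s01; have := inm s s01; rewrite lt_min => /andP[h1 h2].
  apply: cderivB; last first.
    by rewrite -[X in cderiv _ _ X]mulr1; apply: cderivZ; exact: cderiv_id.
  apply: (@cderiv_scale (fun r => f (z' + r%:C *: v))).
  have Ww : W (z' + (s * t)%:C *: v) by rewrite -(subrKC z (z' + _)); exact: H2.
  exact: is_rd_line (smooth_is_rd v sf Ww).
have := H1 _ h1; rewrite subrKC => h.
rewrite -mulrBr nrmM nrmR mulrC ler_wpM2r//; exact: ltW.
Qed.

Lemma strict_derivative_sum W f z (T : Type) (r : seq T) (u : T -> V) :
  open W -> smooth W f -> W z ->
  forall e : R, 0 < e -> exists2 d : R, 0 < d & forall z' (c : T -> R),
    nrm (z' - z) < d -> (forall i, `|c i| < d) ->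
    nrm (f (z' + \sum_(i <- r) (c i)%:C *: u i) - f z' -
         \sum_(i <- r) (c i)%:C * rderive f (u i) z) <= e * \sum_(i <- r) `|c i|.
Proof.
move=> oW sf Wz; elim: r => [|i r IH] e e0.
  by exists 1 => // z' c _ _; rewrite !big_nil addr0 subrr subr0 nrm0 mulr0.
have [d1 d10 H1] := strict_derivative_line (u i) oW sf Wz e0.
have [d2 d20 H2] := IH e e0.
have nv := nrm_ge0 (u i); have nv2 : 0 < nrm (u i) + 2 by lra.
exists (Num.min d1 (d2 / (nrm (u i) + 2))); first by rewrite lt_min d10 divr_gt0.
move=> z' c; rewrite lt_min ltr_pdivlMr// => /andP[z1 z2] hc.
have c1 j : `|c j| < d1 by have := hc j; rewrite lt_min => /andP[].
have c2 j : `|c j| * (nrm (u i) + 2) < d2.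
  by have := hc j; rewrite lt_min ltr_pdivlMr// => /andP[].
have c3 j : `|c j| < d2 by have := c2 j; have := normr_ge0 (c j); nra.
have := H1 z' (c i) z1 (c1 i); set z'' := z' + _ => h1.
have zz : nrm (z'' - z) < d2.
  rewrite /z'' addrAC; apply: le_lt_trans (nrmD _ _) _; rewrite nrmZ nrmR.
  have := c2 i; have := normr_ge0 (c i); have := nrm_ge0 (z' - z); nra.
have := H2 z'' c zz c3 => h2.
rewrite !big_cons addrA -/z'' mulrDr.
set S := \sum_(j <- r) _ in h2 *; set S' := \sum_(j <- r) _ in h2 *.
have -> : f (z'' + S) - f z' - ((c i)%:C * rderive f (u i) z + S') =
  (f z'' - f z' - (c i)%:C * rderive f (u i) z) + (f (z'' + S) - f z'' - S') by ring.
by apply: le_trans (nrmD _ _) _; apply: lerD.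
Qed.

Definition rbasis (p : 'I_n * bool) : V := (if p.2 then 'i else 1) *: delta_mx 0 p.1.

Definition rcoord e (p : 'I_n * bool) : R :=
  if p.2 then complex.Im (e 0 p.1) else complex.Re (e 0 p.1).

Lemma rcoord_sum e : e = \sum_p (rcoord e p)%:C *: rbasis p.
Proof.
rewrite -(pair_bigA _ (fun j b => (rcoord e (j, b))%:C *: rbasis (j, b))) /=.
rewrite [LHS]row_sum_delta; apply: eq_bigr => j _.
rewrite big_bool /rcoord /rbasis /= !scalerA -scalerDl mulr1; congr (_ *: _).
by rewrite {1}[e 0 j]complexE addrC mulrC.
Qed.

Lemma rcoord_le e p : `|rcoord e p| <= nrm e.
Proof.
apply: le_trans (nrm_coord e p.1); rewrite /rcoord.
by case: ifP => _; [exact: Im_nrm|exact: Re_nrm].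
Qed.

Lemma rcoordD e e' p : rcoord (e + e') p = rcoord e p + rcoord e' p.
Proof. by rewrite /rcoord mxE; case: ifP => _; rewrite ?cReD ?cImD. Qed.

Lemma rcoordZ (a : R) e p : rcoord (a%:C *: e) p = a * rcoord e p.
Proof.
rewrite /rcoord mxE; case: ifP => _; rewrite ?cReM ?cImM /= mul0r ?subr0 ?addr0//.
Qed.

(** The real differential, written in the real basis e_j, i e_j of C^n. *)
Definition total f z e : C := \sum_p (rcoord e p)%:C * rderive f (rbasis p) z.

Lemma total_linear f z (a : R) u v : total f z (a%:C *: u + v) = a%:C * total f z u + total f z v.
Proof.
rewrite /total mulr_sumr -big_split /=; apply: eq_bigr => p _.
by rewrite rcoordD rcoordZ rmorphD rmorphM /= mulrDl mulrA.
Qed.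

Lemma total0 f z : total f z 0 = 0.
Proof. by rewrite /total big1// => p _; rewrite /rcoord mxE /= if_same mul0r. Qed.

Lemma total_bound f z : exists2 B : R, 0 <= B & forall e, nrm (total f z e) <= B * nrm e.
Proof.
exists (\sum_p nrm (rderive f (rbasis p) z)).
  by apply: sumr_ge0 => p _; exact: nrm_ge0.
move=> e; rewrite /total mulr_suml.
elim/big_rec2: _ => [|p B S _ h]; first by rewrite nrm0.
apply: le_trans (nrmD _ _) _; apply: lerD => //.
rewrite nrmM nrmR mulrC ler_wpM2l ?nrm_ge0//; exact: rcoord_le.
Qed.

(** Moving along the real coordinates one at a time turns continuous directional derivatives into a
    total derivative. Linearity of [rderive] in the direction and the chain rule come from this. *)
Lemma frechet W f z : open W -> smooth W f -> W z ->
  forall e : R, 0 < e -> exists2 d : R, 0 < d & forall h : V,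
    nrm h < d -> nrm (f (z + h) - f z - total f z h) <= e * nrm h.
Proof.
move=> oW sf Wz e e0.
pose N : R := (#|{: 'I_n * bool}|)%:R + 1.
have N0 : 0 < N by rewrite ltr_pwDr.
have [d d0 H] := strict_derivative_sum (index_enum _) rbasis oW sf Wz (divr_gt0 e0 N0).
exists d => // h hd.
have := H z (rcoord h); rewrite subrr nrm0 => /(_ d0 (fun p => le_lt_trans (rcoord_le h p) hd)).
rewrite -rcoord_sum => /le_trans; apply.
rewrite mulrAC ler_pdivrMr// -mulrA ler_pM2l//.
apply: (@le_trans _ _ (\sum_(p : 'I_n * bool) nrm h)).
  by apply: ler_sum => p _; exact: rcoord_le.
rewrite sumr_const -[X in X <= _]mulr_natr ler_wpM2l ?nrm_ge0//.
by rewrite /N lerDl.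
Qed.

Lemma is_rd_curve W f (g : R -> V) w : open W -> smooth W f -> W (g 0) ->
  (forall e : R, 0 < e -> exists2 d : R, 0 < d & forall s,
     `|s| < d -> nrm (g s - g 0 - s%:C *: w) <= e * `|s|) ->
  cderiv (f \o g) 0 (total f (g 0) w).
Proof.
move=> oW sf Wz hg e e0.
have [B B0 hB] := total_bound f (g 0).
have B1 : 0 < 2 * (B + 1) by lra.
have k0 : 0 < Num.min 1 (e / (2 * (B + 1))) by rewrite lt_min ltr01 divr_gt0.
set k := Num.min _ _ in k0.
have k1 : k <= 1 by rewrite /k ge_min lexx.
have k2 : k * (2 * (B + 1)) <= e by rewrite -ler_pdivlMr// /k ge_min lexx orbT.
have [d1 d10 H1] := hg k k0.
have w0 := nrm_ge0 w; have w1 : 0 < 2 * (nrm w + 1) by lra.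
have [d2 d20 H2] := frechet oW sf Wz (divr_gt0 e0 w1).
exists (Num.min d1 (d2 / (nrm w + 1))); first by rewrite lt_min d10 divr_gt0//; lra.
move=> s; rewrite lt_min ltr_pdivlMr; last by lra.
move=> /andP[/H1 h1 sd]; rewrite add0r /=.
have s0 := normr_ge0 s.
set q := g s - g 0 in h1; have nq : nrm q <= (nrm w + 1) * `|s|.
  have := nrm_leD q (s%:C *: w); rewrite nrmZ nrmR => h.
  by clear -h h1 k1 s0; nra.
have qd : nrm q < d2 by apply: le_lt_trans nq _; rewrite mulrC.
have := H2 q qd; rewrite /q subrKC -/q => h2.
have tq : total f (g 0) q = s%:C * total f (g 0) w + total f (g 0) (q - s%:C *: w).
  by rewrite -total_linear subrKC.
have -> : f (g s) - f (g 0) - s%:C * total f (g 0) w =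
  (f (g s) - f (g 0) - total f (g 0) q) + total f (g 0) (q - s%:C *: w).
  by rewrite tq; ring.
apply: le_trans (nrmD _ _) _.
have h3 : nrm (total f (g 0) (q - s%:C *: w)) <= B * (k * `|s|).
  by apply: le_trans (hB _) _; apply: ler_wpM2l.
have h4 : e / (2 * (nrm w + 1)) * nrm q <= e / 2 * `|s|.
  rewrite (_ : e / 2 * `|s| = e / (2 * (nrm w + 1)) * ((nrm w + 1) * `|s|)); last first.
    by field; lra.
  by apply: ler_wpM2l => //; rewrite divr_ge0// ltW.
have h5 : B * (k * `|s|) <= e / 2 * `|s|.
  by rewrite mulrA; apply: ler_wpM2r => //; clear -k2 k0; lra.
by clear -h2 h3 h4 h5; lra.
Qed.

Lemma rderiveE W f v z : open W -> smooth W f -> W z -> rderive f v z = total f z v.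
Proof.
move=> oW sf Wz; apply: is_rd_eq; rewrite /is_rd.
have := @is_rd_curve W f (fun t : R => z + t%:C *: v) v oW sf.
rewrite scale0r addr0 => /(_ Wz); apply => e e0; exists 1 => // s _.
by rewrite [z + _]addrC addrK subrr nrm0 mulr_ge0// ltW.
Qed.

Lemma rderive_linear W f z (a : R) u v : open W -> smooth W f -> W z ->
  rderive f (a%:C *: u + v) z = a%:C * rderive f u z + rderive f v z.
Proof. by move=> oW sf Wz; rewrite !(rderiveE _ oW sf Wz) total_linear. Qed.

Lemma rderiveN W f z u : open W -> smooth W f -> W z ->
  rderive f (- u) z = - rderive f u z.
Proof.
move=> oW sf Wz; rewrite !(rderiveE _ oW sf Wz).
have := total_linear f z (-1) u 0; rewrite !addr0 total0 addr0.
by rewrite rmorphN rmorph1 scaleN1r mulN1r.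
Qed.

(** The second difference of [f] over the parallelogram spanned by t u and t v is symmetric in u and
    v, and it is t^2 times either mixed derivative up to o(t^2). *)
Lemma schwarz W f z u v : open W -> smooth W f -> W z ->
  rderive (rderive f u) v z = rderive (rderive f v) u z.
Proof.
move=> oW sf Wz.
suff H u' v' (e : R) : 0 < e -> exists2 d : R, 0 < d & forall t : R, 0 < t -> t < d ->
    nrm (f (z + t%:C *: u' + t%:C *: v') - f (z + t%:C *: u') - f (z + t%:C *: v') + f z
        - (t ^+ 2)%:C * rderive (rderive f u') v' z) <= e * t ^+ 2.
  apply/eqP; rewrite -subr_eq0; apply/eqP/nrm_eq0/le_anti; rewrite nrm_ge0 andbT.
  apply/ler_addgt0Pr => e e0; rewrite add0r; have e2 : 0 < e / 2 by lra.
  have [d1 d10 H1] := H u v _ e2; have [d2 d20 H2] := H v u _ e2.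
  pose t := Num.min d1 d2 / 2.
  have m0 : 0 < Num.min d1 d2 by rewrite lt_min d10.
  have t0 : 0 < t by rewrite divr_gt0.
  have : t < Num.min d1 d2 by rewrite /t; lra.
  rewrite lt_min => /andP[td1 td2].
  have := H1 t t0 td1; have := H2 t t0 td2; rewrite [z + _ + _]addrAC.
  set A := f _; set B := f _; set D := f _; clearbody A B D => h2 h1.
  have t2 : 0 < t ^+ 2 by rewrite exprn_gt0.
  rewrite -(ler_pM2l t2) -{1}[t ^+ 2]ger0_norm; last exact: ltW.
  rewrite -nrmR -nrmM.
  have aux (a b c d k x y : C) : k * (x - y) =
    (a - b - c + d - k * y) - (a - c - b + d - k * x) by ring.
  rewrite (aux A B D (f z)); apply: le_trans (nrmB _ _) _.
  by apply: le_trans (lerD h2 h1) _; rewrite -mulrDl -splitr mulrC.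
move=> e0; have e2 : 0 < e / 2 by lra.
have [d1 d10 H1] := strict_derivative_line v' oW (smooth_rderive u' sf) Wz e2.
have /near_nrmP[d2 d20 H2] : \forall w \near z, W w by exact: open_nbhs_nbhs.
have nu := nrm_ge0 u'; have nv := nrm_ge0 v'.
pose N := nrm u' + nrm v' + 1; have N0 : 0 < N by rewrite /N; lra.
have m0 : 0 < Num.min d1 d2 by rewrite lt_min d10.
exists (Num.min d1 d2 / N); first by rewrite divr_gt0.
move=> t t0; rewrite ltr_pdivlMr// lt_min => /andP[t1 t2].
have td1 : t < d1 by rewrite /N in t1; nra.
have near_line (s r : R) : 0 <= s <= 1 -> 0 <= r <= 1 ->
    nrm (z + (s * t)%:C *: u' + (r * t)%:C *: v' - z) <= t * N.
  move=> /andP[s0 s1] /andP[r0 r1].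
  rewrite addrAC [z + (s * t)%:C *: u']addrC addrK; apply: le_trans (nrmD _ _) _.
  rewrite !nrmZ !nrmR !normrM !ger0_norm ?(ltW t0)// /N.
  have : s * t * nrm u' <= t * nrm u'.
    by rewrite -mulrA; apply: ler_piMl => //; rewrite mulr_ge0// ltW.
  have : r * t * nrm v' <= t * nrm v'.
    by rewrite -mulrA; apply: ler_piMl => //; rewrite mulr_ge0// ltW.
  lra.
have inW (s r : R) : 0 <= s <= 1 -> 0 <= r <= 1 -> W (z + (s * t)%:C *: u' + (r * t)%:C *: v').
  move=> hs hr; rewrite -(subrKC z (_ + _ + _)); apply: H2.
  exact: le_lt_trans (near_line _ _ hs hr) t2.
have der (x : V) (s : R) : W (x + (s * t)%:C *: u') ->
   cderiv (fun s : R => f (x + (s * t)%:C *: u')) s (t%:C * rderive f u' (x + (s * t)%:C *: u')).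
  move=> Wx; apply: (@cderiv_scale (fun r => f (x + r%:C *: u'))).
  exact: is_rd_line (smooth_is_rd u' sf Wx).
have := @mean_value_ineq _ (fun s : R => f (z + t%:C *: v' + (s * t)%:C *: u') -
    f (z + (s * t)%:C *: u') - (t ^+ 2)%:C * rderive (rderive f u') v' z * s%:C)
  (fun s => t%:C * rderive f u' (z + t%:C *: v' + (s * t)%:C *: u') -
     t%:C * rderive f u' (z + (s * t)%:C *: u') - (t ^+ 2)%:C * rderive (rderive f u') v' z)
  0 1 (e / 2 * t ^+ 2) ler01.
rewrite mul1r mul0r scale0r !addr0 mulr0 mulr1 !subr0 mulr1.
have -> : 2 * (e / 2 * t ^+ 2) = e * t ^+ 2 by field.
rewrite [z + t%:C *: v' + _]addrAC.
set A := f _; set B := f _; set D := f _; set X := _ * rderive _ _ _.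
have aux (a b c d k : C) : a - b - k - (c - d) = a - b - c + d - k by ring.
rewrite aux; apply=> s s01.
  have s11 : 0 <= (1 : R) <= 1 by rewrite ler01 lexx.
  have s00 : 0 <= (0 : R) <= 1 by rewrite ler01 lexx.
  apply: cderivB; last first.
    by rewrite -[X in cderiv _ _ X]mulr1; apply: cderivZ; exact: cderiv_id.
  apply: cderivB; apply: der.
    by have := inW s 1 s01 s11; rewrite mul1r addrAC.
  by have := inW s 0 s01 s00; rewrite mul0r scale0r addr0.
have s00 : 0 <= (0 : R) <= 1 by rewrite ler01 lexx.
have := near_line s 0 s01 s00; rewrite mul0r scale0r addr0 => h.
have tt : `|t| < d1 by rewrite ger0_norm// ltW.
have := H1 (z + (s * t)%:C *: u') t (le_lt_trans h t1) tt.
rewrite ger0_norm ?(ltW t0)// => h1.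
have aux2 (a b c k : C) : k * a - k * b - (k * k) * c = k * (a - b - k * c) by ring.
rewrite /X expr2 [(t * t)%:C]rmorphM /= aux2 nrmM nrmR ger0_norm ?(ltW t0)//.
rewrite [z + t%:C *: v' + _]addrAC.
by rewrite (_ : e / 2 * (t * t) = t * (e / 2 * t)); [rewrite ler_pM2l|ring].
Qed.

End TotalDerivative.

Section HolomorphicCoordinates.
Context {R : realType} {n m : nat}.
Local Notation C := R[i].
Implicit Types (F : 'rV[R[i]]_n -> 'rV[R[i]]_m) (z v : 'rV[R[i]]_n).

Lemma diff_row_coord F z j : differentiable F z ->
  differentiable (fun w => F w 0 j : C) z /\
  forall v, 'd (fun w => F w 0 j : C) z v = ('d F z v) 0 j.
Proof.
move=> dF; have dc := differentiable_coord (F z) 0 j.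
have dcomp := differentiable_comp dF dc; split=> [|v]; first exact: dcomp.
have := @diff_comp _ _ _ _ F (fun N : 'rV[C]_m => N 0 j : C) z dF dc.
move=> /(congr1 (fun h : 'rV[C]_n -> C => h v)) /= ->.
have @f : {linear 'rV[C]_m -> C}.
  by exists (fun N : 'rV[C]_m => N 0 j); do 2![eexists]; do ?[constructor];
     rewrite ?mxE// => ? *; rewrite ?mxE//; move=> ?; rewrite !mxE.
rewrite (_ : (fun _ => _) = f)// diff_lin//; exact/coord_continuous.
Qed.

Lemma is_rd_comp (W : set 'rV[R[i]]_m) (f : 'rV[R[i]]_m -> C) F v z :
  open W -> smooth W f -> W (F z) -> differentiable F z ->
  is_rd (f \o F) v z (total f (F z) ('d F z v)).
Proof.
move=> oW sf WF dF.
have := @is_rd_curve _ _ W f (fun t : R => F (z + t%:C *: v)) ('d F z v) oW sf.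
rewrite scale0r addr0 => /(_ WF); apply => e e0.
have nv := nrm_ge0 v; have nv1 : 0 < nrm v + 1 by rewrite ltr_pwDr.
have [d d0 H] := diff_nrm dF (divr_gt0 e0 nv1).
exists (d / (nrm v + 1)); first exact: divr_gt0.
move=> s; rewrite ltr_pdivlMr// => sd; rewrite -linearZ.
have s0 := normr_ge0 s.
have nsv : nrm (s%:C *: v) = `|s| * nrm v by rewrite nrmZ nrmR.
apply: le_trans (H _ _) _; rewrite nsv; first by nra.
rewrite mulrAC ler_pdivrMr// -mulrA ler_pM2l//; nra.
Qed.

End HolomorphicCoordinates.

Section SmoothAlgebra.
Context {R : realType}.
Local Notation C := R[i].

(* All closure properties of smooth functions are proved at once, by
   coinduction on this class. *)
Inductive smooth_alg (n : nat) (W : set 'rV[R[i]]_n) : ('rV[R[i]]_n -> C) -> Prop :=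
| sa_smooth f : smooth W f -> smooth_alg W f
| sa_add f g : smooth_alg W f -> smooth_alg W g -> smooth_alg W (fun z => f z + g z)
| sa_mul f g : smooth_alg W f -> smooth_alg W g -> smooth_alg W (fun z => f z * g z)
| sa_conj f : smooth_alg W f -> smooth_alg W (fun z => conjc (f z))
| sa_inv f : (forall z, W z -> f z != 0) -> smooth_alg W f ->
    smooth_alg W (fun z => (f z)^-1)
| sa_hol f : holomorphic W f -> smooth_alg W f
| sa_comp m (W' : set 'rV[R[i]]_m) (F : 'rV[R[i]]_n -> 'rV[R[i]]_m) f :
    open W' -> holomorphic W F -> (forall z, W z -> W' (F z)) -> smooth W' f ->
    smooth_alg W (f \o F)
| sa_real (psi : nat -> R -> R) k f :
    (forall j t, is_derive t (1 : R) (psi j) (psi j.+1 t)) -> smooth_alg W f ->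
    smooth_alg W (fun z => (psi k (complex.Re (f z)))%:C).

Section FixedDim.
Context {n : nat}.
Local Notation V := 'rV[R[i]]_n.
Implicit Types (W : set V) (f g : V -> C) (u v z : V).

Lemma smooth_cst W (c : C) : open W -> smooth W (fun=> c).
Proof.
move=> oW; apply: (@smooth_coind _ _ _ (fun f => exists c, f = fun=> c)) => //; last by exists c.
  by move=> _ [d ->] z _; exact: cst_continuous.
move=> _ [d ->] v; exists (fun=> 0); first by exists 0.
by move=> z _; exact: is_rd_cst.
Qed.

Lemma conjc_continuous (f : V -> C) z : {for z, continuous f} ->
  {for z, continuous (fun w => conjc (f w))}.
Proof.
move=> /nrm_cvgP h; apply/nrm_cvgP => e /h[d d0 H]; exists d => // w /H.
have -> : conjc (f (z + w)) - conjc (f z) = conjc (f (z + w) - f z) by rewrite rmorphB.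
by rewrite /nrm normcJ.
Qed.

Lemma smooth_alg_cont W f : open W -> smooth_alg W f -> forall z, W z -> {for z, continuous f}.
Proof.
move=> oW; elim=> {f}.
- by move=> f sf z Wz; exact: smooth_cont Wz.
- by move=> f g _ hf _ hg z Wz; apply: continuousD; [exact: hf|exact: hg].
- by move=> f g _ hf _ hg z Wz; apply: continuousM; [exact: hf|exact: hg].
- by move=> f _ hf z Wz; apply: conjc_continuous; exact: hf.
- by move=> f f0 _ hf z Wz; apply: (@continuousV _ _ f); [exact: f0|exact: hf].
- by move=> f hf z Wz; apply: differentiable_continuous; exact: hf.
- move=> m W' F f oW' hF FW sf z Wz; apply: continuous_comp.
    by apply: differentiable_continuous; exact: hF.
  by apply: smooth_cont sf _; exact: FW.
- move=> psi k f dpsi _ hf z Wz; apply/nrm_cvgP => e e0.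
  have dc := dpsi k (complex.Re (f z)).
  have [d d0 H] := cderiv_cont (cderiv_ofreal dc) e0.
  have /nrm_cvgP/(_ d d0)[d' d'0 H'] := hf z Wz.
  exists d' => // h /H' hd.
  have := H (complex.Re (f (z + h) - f z)) (le_lt_trans (Re_nrm _) hd).
  by rewrite cReD cReN subrKC.
Qed.

Lemma smooth_alg_sum W (I : Type) (r : seq I) (f : I -> V -> C) : open W ->
  (forall i, smooth_alg W (f i)) -> smooth_alg W (fun z => \sum_(i <- r) f i z).
Proof.
move=> oW h; elim: r => [|i r IH].
  rewrite (_ : (fun _ => _) = fun=> 0); first by apply: sa_smooth; exact: smooth_cst.
  by apply/funext => z; rewrite big_nil.
rewrite (_ : (fun _ => _) = fun z => f i z + \sum_(i <- r) f i z); first exact: sa_add.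
by apply/funext => z; rewrite big_cons.
Qed.

Lemma smooth_alg_derive W f : open W -> smooth_alg W f -> forall v,
  exists2 g, smooth_alg W g & forall z, W z -> is_rd f v z (g z).
Proof.
move=> oW; have cst c : smooth_alg W (fun=> c) by apply: sa_smooth; exact: smooth_cst.
have Re_alg g : smooth_alg W g -> smooth_alg W (fun z => (complex.Re (g z))%:C).
  move=> hg; rewrite (_ : (fun _ => _) = fun z => (g z + conjc (g z)) * 2^-1).
    by apply: sa_mul => //; apply: sa_add => //; exact: sa_conj.
  by apply/funext => z; rewrite ReJ_add.
have Im_alg g : smooth_alg W g -> smooth_alg W (fun z => (complex.Im (g z))%:C).
  move=> hg; rewrite (_ : (fun _ => _) = fun z => (conjc (g z) + (-1) * g z) * (2^-1 * 'i)).
    apply: sa_mul => //; apply: sa_add; first exact: sa_conj.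
    exact: sa_mul.
  by apply/funext => z; rewrite ImJ_sub mulN1r mulrA.
elim=> {f}.
- move=> f sf v; exists (rderive f v); first by apply: sa_smooth; exact: smooth_rderive.
  by move=> z Wz; exact: smooth_is_rd.
- move=> f g _ hf _ hg v; have [f' Pf df] := hf v; have [g' Pg dg] := hg v.
  exists (fun z => f' z + g' z); first exact: sa_add.
  by move=> z Wz; apply: is_rdD; [exact: df|exact: dg].
- move=> f g Pf hf Pg hg v; have [f' Pf' df] := hf v; have [g' Pg' dg] := hg v.
  exists (fun z => f' z * g z + f z * g' z); first by apply: sa_add; exact: sa_mul.
  by move=> z Wz; apply: is_rdM; [exact: df|exact: dg].
- move=> f _ hf v; have [f' Pf df] := hf v.
  exists (fun z => conjc (f' z)); first exact: sa_conj.
  by move=> z Wz; apply: is_rd_conj; exact: df.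
- move=> f f0 Pf hf v; have [f' Pf' df] := hf v.
  exists (fun z => (-1 * f' z) * ((f z)^-1 * (f z)^-1)).
    by apply: sa_mul; apply: sa_mul => //; exact: sa_inv.
  move=> z Wz; have := is_rdV (f0 z Wz) (df z Wz).
  by rewrite mulN1r -expr2 -exprVn.
(* The case that rests on Cauchy's formula: the derivative is again holomorphic. *)
- move=> f hf v; exists (fun z => 'd f z v).
    apply: sa_hol => z Wz; apply: differentiable_derivative_near.
    by apply: filterS hf _; exact: open_nbhs_nbhs.
  move=> z Wz; have := @cderiv_line _ _ f z v 0.
  by rewrite /is_rd scale0r addr0; apply; exact: hf.
(* By the chain rule the derivative is a sum of real and imaginary parts of holomorphic functions
   times derivatives of [f] composed with [F], which stays in the class. *)
- move=> m W' F f oW' hF FW sf v.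
  exists (fun z => \sum_p ((if p.2 then complex.Im ('d (fun w => F w 0 p.1 : C) z v)
      else complex.Re ('d (fun w => F w 0 p.1 : C) z v))%:C *
      (rderive f (rbasis p) \o F) z)).
    apply: smooth_alg_sum => // p; apply: sa_mul; last first.
      by apply: sa_comp FW _ => //; exact: smooth_rderive.
    have hd : smooth_alg W (fun z => 'd (fun w => F w 0 p.1 : C) z v).
      apply: sa_hol => z Wz; apply: differentiable_derivative_near.
      have : \forall w \near z, W w by exact: open_nbhs_nbhs.
      by apply: filterS => w Ww; apply: (diff_row_coord _ (hF w Ww)).1.
    by case: (p.2); [exact: Im_alg|exact: Re_alg].
  move=> z Wz; have := is_rd_comp v oW' sf (FW z Wz) (hF z Wz).
  rewrite /total; under eq_bigr => p _.
    rewrite /rcoord -(diff_row_coord p.1 (hF z Wz)).2; over.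
  by [].
- move=> psi k f dpsi Pf hf v; have [f' Pf' df] := hf v.
  exists (fun z => (psi k.+1 (complex.Re (f z)))%:C * (complex.Re (f' z))%:C).
    by apply: sa_mul; [exact: sa_real|exact: Re_alg].
  move=> z Wz; have [dr _] := (cderivP _ _ _).1 (df z Wz).
  rewrite -rmorphM; apply: cderiv_ofreal.
  have := dpsi k (complex.Re (f (z + 0%:C *: v))).
  rewrite scale0r addr0 -{1}[z](addr0) -{1}[0](scale0r v) => dp.
  have := is_derive1_comp dp dr.
  by rewrite mulrC /GRing.scale /= mulrC.
Qed.

Lemma smooth_algP W f : open W -> smooth_alg W f -> smooth W f.
Proof.
move=> oW; apply: smooth_coind => //; first by move=> g; exact: smooth_alg_cont.
by move=> g; exact: smooth_alg_derive.
Qed.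

Lemma smoothD W f g : open W -> smooth W f -> smooth W g -> smooth W (fun z => f z + g z).
Proof. by move=> oW sf sg; apply: smooth_algP => //; apply: sa_add; exact: sa_smooth. Qed.

Lemma smoothM W f g : open W -> smooth W f -> smooth W g -> smooth W (fun z => f z * g z).
Proof. by move=> oW sf sg; apply: smooth_algP => //; apply: sa_mul; exact: sa_smooth. Qed.

Lemma smooth_conj W f : open W -> smooth W f -> smooth W (fun z => conjc (f z)).
Proof. by move=> oW sf; apply: smooth_algP => //; apply: sa_conj; exact: sa_smooth. Qed.

Lemma smoothV W f : open W -> (forall z, W z -> f z != 0) -> smooth W f ->
  smooth W (fun z => (f z)^-1).
Proof. by move=> oW f0 sf; apply: smooth_algP => //; apply: sa_inv => //; exact: sa_smooth. Qed.

Lemma smooth_hol W f : open W -> holomorphic W f -> smooth W f.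
Proof. by move=> oW hf; apply: smooth_algP => //; exact: sa_hol. Qed.

Lemma smooth_real W f (psi : nat -> R -> R) k : open W ->
  (forall j t, is_derive t (1 : R) (psi j) (psi j.+1 t)) -> smooth W f ->
  smooth W (fun z => (psi k (complex.Re (f z)))%:C).
Proof. by move=> oW dpsi sf; apply: smooth_algP => //; apply: sa_real => //; exact: sa_smooth. Qed.

Lemma smooth_sum W (I : Type) (r : seq I) (f : I -> V -> C) : open W ->
  (forall i, smooth W (f i)) -> smooth W (fun z => \sum_(i <- r) f i z).
Proof.
by move=> oW h; apply: smooth_algP => //; apply: smooth_alg_sum => // i; exact: sa_smooth.
Qed.

Lemma smoothX W f k : open W -> smooth W f -> smooth W (fun z => f z ^+ k).
Proof.
move=> oW sf; elim: k => [|k IH].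
  by rewrite (_ : (fun _ => _) = fun=> 1)//; exact: smooth_cst.
rewrite (_ : (fun _ => _) = fun z => f z * f z ^+ k); first exact: smoothM.
by apply/funext => z; rewrite exprS.
Qed.

End FixedDim.

Lemma smooth_comp n m (W : set 'rV[R[i]]_n) (W' : set 'rV[R[i]]_m) F f :
  open W -> open W' -> holomorphic W F -> (forall z, W z -> W' (F z)) ->
  smooth W' f -> smooth W (f \o F).
Proof. by move=> oW oW' hF FW sf; apply: smooth_algP => //; exact: sa_comp FW sf. Qed.

End SmoothAlgebra.

(** * Levi forms and curvature *)

Section LogHessian.
Context {R : realType} {n : nat}.
Local Notation C := R[i].
Local Notation V := 'rV[R[i]]_n.
Implicit Types (W : set V) (f g : V -> C) (u v w z : V).

Lemma rderive_near f g v z l : (\forall w \near z, f w = g w) -> is_rd f v z l ->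
  rderive g v z = l.
Proof. by move=> fg df; apply: is_rd_eq; exact: is_rd_near df. Qed.

(** The derivative of log f along [v], without choosing a logarithm. *)
Definition dlog f v : V -> C := fun w => rderive f v w / f w.

Definition log_hess f z u v : C := rderive (dlog f v) u z.

(* The complex Hessian (Levi form) of [log f], up to a factor 4. *)
Definition levi f z v : C := log_hess f z v v + log_hess f z ('i *: v) ('i *: v).

Section OnOpen.
Variable W : set V.
Hypothesis oW : open W.

Definition snz f : Prop := smooth W f /\ forall z, W z -> f z != 0.

Lemma snz_cst (c : C) : c != 0 -> snz (fun=> c).
Proof. by move=> c0; split=> //; exact: smooth_cst. Qed.

Lemma snzM f g : snz f -> snz g -> snz (fun z => f z * g z).
Proof.
move=> [sf f0] [sg g0]; split; first exact: smoothM.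
by move=> z Wz; rewrite mulf_neq0 ?f0 ?g0.
Qed.

Lemma snzV f : snz f -> snz (fun z => (f z)^-1).
Proof.
move=> [sf f0]; split; first exact: smoothV.
by move=> z Wz; rewrite invr_eq0 f0.
Qed.

Lemma smooth_dlog f v : snz f -> smooth W (dlog f v).
Proof.
by move=> [sf f0]; apply: smoothM => //; [exact: smooth_rderive|exact: smoothV].
Qed.

Lemma near_open z (P : V -> Prop) : W z -> (forall w, W w -> P w) -> \forall w \near z, P w.
Proof. by move=> Wz h; apply: filterS h _; exact: open_nbhs_nbhs. Qed.

Lemma log_hessE f z u v : snz f -> W z -> log_hess f z u v =
  rderive (rderive f v) u z / f z - rderive f v z * rderive f u z / f z ^+ 2.
Proof.
move=> [sf f0] Wz; apply: is_rd_eq.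
have := is_rdM (smooth_is_rd u (smooth_rderive v sf) Wz)
  (is_rdV (f0 z Wz) (smooth_is_rd u sf Wz)).
by rewrite !mulNr mulrN mulrA.
Qed.

Lemma log_hess_sym f z u v : snz f -> W z -> log_hess f z u v = log_hess f z v u.
Proof.
move=> sf Wz; rewrite (log_hessE u v sf Wz) (log_hessE v u sf Wz).
by rewrite (schwarz v u oW sf.1 Wz) [rderive f v z * _]mulrC.
Qed.

Lemma log_hess_linear f z (a : R) u u' v : snz f -> W z ->
  log_hess f z (a%:C *: u + u') v = a%:C * log_hess f z u v + log_hess f z u' v.
Proof.
by move=> sf Wz; exact: (rderive_linear _ _ _ oW (smooth_dlog v sf) Wz).
Qed.

Lemma log_hess_linearr f z (a : R) u u' v : snz f -> W z ->
  log_hess f z v (a%:C *: u + u') = a%:C * log_hess f z v u + log_hess f z v u'.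
Proof.
move=> sf Wz; rewrite (log_hess_sym v _ sf Wz) (log_hess_linear _ _ _ _ sf Wz).
by rewrite (log_hess_sym u v sf Wz) (log_hess_sym u' v sf Wz).
Qed.

Lemma log_hess0 f z v : snz f -> W z -> log_hess f z 0 v = 0.
Proof.
move=> sf Wz; have := log_hess_linear 1 0 0 v sf Wz.
rewrite rmorph1 scale1r addr0 mul1r => /eqP.
by rewrite -subr_eq0 opprD addrA subrr sub0r oppr_eq0 => /eqP.
Qed.

Lemma log_hessN f z u v : snz f -> W z -> log_hess f z (- u) v = - log_hess f z u v.
Proof.
move=> sf Wz; have := log_hess_linear (-1) u 0 v sf Wz.
by rewrite addr0 log_hess0// addr0 rmorphN rmorph1 scaleN1r mulN1r.
Qed.

Lemma log_hessNr f z u v : snz f -> W z -> log_hess f z v (- u) = - log_hess f z v u.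
Proof.
move=> sf Wz; rewrite (log_hess_sym v _ sf Wz) (log_hessN _ _ sf Wz).
by rewrite (log_hess_sym u v sf Wz).
Qed.

Lemma dlogM f g v z : snz f -> snz g -> W z ->
  dlog (fun w => f w * g w) v z = dlog f v z + dlog g v z.
Proof.
move=> [sf f0] [sg g0] Wz.
rewrite /dlog (is_rd_eq (is_rdM (smooth_is_rd v sf Wz) (smooth_is_rd v sg Wz))).
by field; rewrite f0// g0.
Qed.

Lemma log_hessM f g z u v : snz f -> snz g -> W z ->
  log_hess (fun w => f w * g w) z u v = log_hess f z u v + log_hess g z u v.
Proof.
move=> sf sg Wz.
apply: (@rderive_near (fun w => dlog f v w + dlog g v w)).
  by apply: near_open => // w Ww; rewrite dlogM.
by apply: is_rdD; apply: smooth_is_rd Wz; exact: smooth_dlog.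
Qed.

Lemma leviM f g z v : snz f -> snz g -> W z ->
  levi (fun w => f w * g w) z v = levi f z v + levi g z v.
Proof. by move=> sf sg Wz; rewrite /levi !log_hessM// addrACA. Qed.

Lemma levi_ext f g z v : snz f -> (forall w, W w -> f w = g w) -> W z ->
  levi g z v = levi f z v.
Proof.
move=> sf fg Wz.
have H u : log_hess g z u u = log_hess f z u u.
  apply: (@rderive_near (dlog f u)); last by apply: smooth_is_rd Wz; exact: smooth_dlog.
  apply: near_open => // w Ww; rewrite /dlog -(fg w Ww).
  congr (_ / _); apply/esym/(@rderive_near f _ _ _ _ _ (smooth_is_rd _ sf.1 Ww)).
  exact: near_open.
by rewrite /levi !H.
Qed.

Lemma levi_cst (c : C) z v : levi (fun=> c) z v = 0.
Proof.
have H u : log_hess (fun=> c) z u u = 0.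
  apply: (@rderive_near (fun=> 0)); last exact: is_rd_cst.
  by apply: filterE => w; rewrite /dlog (is_rd_eq (is_rd_cst _ _ _)) mul0r.
by rewrite /levi !H addr0.
Qed.

Lemma leviV f z v : snz f -> W z -> levi (fun w => (f w)^-1) z v = - levi f z v.
Proof.
move=> sf Wz; apply/eqP; rewrite -addr_eq0 -(leviM v (snzV sf) sf Wz).
rewrite (@levi_ext (fun=> 1)) ?levi_cst//.
  by apply: snz_cst; exact: oner_neq0.
by move=> w Ww; rewrite mulVf// sf.2.
Qed.

Lemma snzX f k : snz f -> snz (fun w => f w ^+ k).
Proof.
move=> [sf f0]; split; first exact: smoothX.
by move=> z Wz; rewrite expf_neq0// f0.
Qed.

Lemma leviX f k z v : snz f -> W z -> levi (fun w => f w ^+ k) z v = k%:R * levi f z v.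
Proof.
move=> sf Wz; elim: k => [|k IH]; first by rewrite mul0r -[RHS](levi_cst 1 z v).
rewrite (_ : (fun _ => _) = fun w => f w * f w ^+ k); last by apply/funext => w; rewrite exprS.
rewrite leviM//; last exact: snzX.
by rewrite IH -natr1 mulrDl mul1r addrC.
Qed.

End OnOpen.
End LogHessian.

(** * The Chern form and the positivity criterion *)

Section ChernForm.
Context {R : realType} {n : nat}.
Local Notation C := R[i].
Local Notation V := 'rV[R[i]]_n.
Implicit Types (W : set V) (f g : V -> C) (u v w z : V).

Lemma scaleii u : 'i *: ('i *: u) = - u :> V.
Proof. by rewrite scalerA -expr2 sqr_i scaleN1r. Qed.

Lemma conjcM (a b : C) : conjc (a * b) = conjc a * conjc b.
Proof. exact: rmorphM. Qed.

Lemma conjcD (a b : C) : conjc (a + b) = conjc a + conjc b.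
Proof. exact: rmorphD. Qed.

Lemma conjcB (a b : C) : conjc (a - b) = conjc a - conjc b.
Proof. exact: rmorphB. Qed.

Lemma scaleiC (a : C) u : 'i *: (a *: u) = a *: ('i *: u) :> V.
Proof. by rewrite !scalerA mulrC. Qed.

Lemma mulii (a : C) : 'i * ('i * a) = - a.
Proof. by rewrite mulrA -expr2 sqr_i mulN1r. Qed.

Lemma conjci : conjc 'i = - 'i :> C.
Proof. by apply/eqP; rewrite eq_complex /= oppr0 !eqxx. Qed.

Lemma rderive_real f v z : (forall w, conjc (f w) = f w) ->
  conjc (rderive f v z) = rderive f v z.
Proof.
move=> rf; rewrite /rderive /=.
suff -> : (fun t : R => complex.Im (f (z + t%:C *: v))) = fun=> 0.
  by rewrite derive1_cst oppr0.
apply/funext => t; have := rf (z + t%:C *: v).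
by case: (f _) => a b /= [] /eqP; rewrite eq_sym -subr_eq0 opprK -mulr2n mulrn_eq0 => /eqP.
Qed.

Lemma dlog_real f v z : (forall w, conjc (f w) = f w) -> conjc (dlog f v z) = dlog f v z.
Proof. by move=> rf; rewrite /dlog rmorphM [X in X * _](rderive_real v z rf) [X in _ * X]conjc_inv rf. Qed.

Lemma log_hess_real f z u v : (forall w, conjc (f w) = f w) ->
  conjc (log_hess f z u v) = log_hess f z u v.
Proof. by move=> rf; apply: rderive_real => w; exact: dlog_real. Qed.

Section OnOpen.
Variables (W : set V) (h : V -> R).
Hypothesis oW : open W.
Local Notation H := (fun w => (h w)%:C).
Hypothesis sH : smooth W H.
Hypothesis h0 : forall z, W z -> 0 < h z.

Let H0 z : W z -> H z != 0.
Proof. by move=> Wz; rewrite eq_complex /= eqxx andbT gt_eqF// h0. Qed.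

Let nH : snz W H.
Proof. by split. Qed.

Let rH w : conjc (H w) = H w.
Proof. exact: conjc_real. Qed.

(** The (1,0)-part of d log h, that is h^-1 times the form dh restricted to type (1,0). *)
Definition chern1 : V -> V -> C :=
  fun z v => 2^-1 * (dlog H v z - 'i * dlog H ('i *: v) z).

Lemma chern1_J z v : W z -> chern1 z v + 'i * chern1 z ('i *: v) = 0.
Proof.
move=> Wz; rewrite /chern1 scaleii.
have -> : dlog H (- v) z = - dlog H v z.
  by rewrite /dlog (rderiveN _ oW sH Wz) mulNr.
have aux (a b i : C) : i * i = -1 -> 2^-1 * (a - i * b) + i * (2^-1 * (b - i * - a)) = 0.
  move=> ii; transitivity (2^-1 * (a + i * i * a)); first by ring.
  by rewrite ii mulN1r subrr mulr0.
by apply: aux; rewrite -expr2 sqr_i.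
Qed.

(** Compatibility with the complex structure is [chern1_J]; compatibility with the metric is the
    identity theta + conj theta = d log h. *)
Lemma chern1_form : chern_form W H chern1.
Proof.
have part01_1 z v : W z -> part01 chern1 z v = 0.
  by move=> Wz; rewrite /part01 chern1_J// mulr0.
split.
- split=> [z Wz a u v|v].
    rewrite /chern1 /dlog scalerDr scaleiC.
    rewrite !(rderive_linear _ _ _ oW sH Wz).
    have aux (b x y x' y' k i : C) : 2^-1 * ((b * x + y) * k - i * ((b * x' + y') * k)) =
      b * (2^-1 * (x * k - i * (x' * k))) + 2^-1 * (y * k - i * (y' * k)) by ring.
    exact: aux.
  apply: smoothM => //; first exact: smooth_cst.
  apply: smoothD => //; first exact: smooth_dlog.
  rewrite (_ : (fun _ => _) = fun z => (- 'i) * dlog H ('i *: v) z); last first.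
    by apply/funext => z; rewrite mulNr.
  by apply: smoothM => //; [exact: smooth_cst|exact: smooth_dlog].
- move=> f sf z v Wz; rewrite /dbar /part01 /covariant.
  have aux (a b c d k i e : C) : a * ((b + k * c) + i * (d + k * e)) =
    a * (b + i * d) + k * a * (c + i * e) by ring.
  by rewrite aux chern1_J// mulr0 addr0.
- move=> f g sf sg z v Wz.
  have := is_rdM (is_rdM (smooth_is_rd v sf Wz) (is_rd_conj (smooth_is_rd v sg Wz)))
    (smooth_is_rd v sH Wz).
  rewrite /differential => /is_rd_eq ->; rewrite /covariant /differential.
  have -> : rderive H v z = (chern1 z v + conjc (chern1 z v)) * H z.
    have -> : chern1 z v + conjc (chern1 z v) = dlog H v z.
      have r1 := dlog_real v z rH; have r2 := dlog_real ('i *: v) z rH.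
      rewrite /chern1 conjcM conjcB r1 (conjcM 'i) r2 conjci conjc_inv conjc_nat.
      by set x := dlog H v z; set y := dlog H _ z; clearbody x y; field.
    by rewrite /dlog divfK// H0.
  rewrite (conjcD (rderive g v z)) (conjcM (g z)).
  have aux (a b c d k l x : C) : (a * b + c * d) * x + c * b * ((k + l) * x) =
    (a + c * k) * b * x + c * (d + b * l) * x by ring.
  exact: aux.
Qed.

(** Tested on the constant sections 1, the two compatibilities give the (0,1)-part and the real part
    of theta, which together determine it. *)
Lemma chern_unique theta : chern_form W H theta ->
  forall z v, W z -> theta z v = chern1 z v.
Proof.
move=> [_ c2 c3] z v Wz.
have d1 u : rderive (fun=> (1 : C)) u z = 0 by apply: is_rd_eq; exact: is_rd_cst.
have s1 : smooth W (fun=> (1 : C)) by exact: smooth_cst.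
have J u : theta z u + 'i * theta z ('i *: u) = 0.
  have := c2 _ s1 z u Wz; rewrite /dbar /part01 /covariant /differential !d1.
  rewrite !mul1r !add0r mulr0 mulr0.
  by move=> /eqP; rewrite mulf_eq0 invr_eq0 pnatr_eq0 /= => /eqP.
have D u : rderive H u z = (theta z u + conjc (theta z u)) * H z.
  have := c3 _ _ s1 s1 z u Wz; rewrite /covariant /differential d1.
  have -> : (fun w => 1 * conjc 1 * H w) = H by apply/funext => w; rewrite conjc1 !mul1r.
  by move=> ->; rewrite !add0r !mul1r conjc1 mulr1 mulrDl.
have Ji : theta z ('i *: v) = 'i * theta z v.
  by have := congr1 ( *%R 'i) (J v); rewrite mulrDr mulii mulr0 => /eqP; rewrite subr_eq0 => /eqP <-.
rewrite /chern1 /dlog !D !mulfK ?H0// Ji conjcM conjci.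
have aux (a b i : C) : i * i = -1 -> 2^-1 * (a + b - i * (i * a + - i * b)) = a.
  by move=> ii; transitivity (2^-1 * (a + b - i * i * (a - b))); [ring|rewrite ii; field].
by rewrite aux// -expr2 sqr_i.
Qed.

(** In the exterior derivative of [chern1] the Hessian terms without ['i] cancel by symmetry. *)
Lemma curvature_log_hess theta z u v : chern_form W H theta -> W z ->
  curvature theta z u v =
    - ('i / 2) * (log_hess H z u ('i *: v) - log_hess H z v ('i *: u)).
Proof.
move=> ct Wz.
have E x y : rderive (theta^~ y) x z = 2^-1 * (log_hess H z x y - 'i * log_hess H z x ('i *: y)).
  apply: (@rderive_near _ _ (chern1^~ y)).
    by apply: (near_open oW Wz) => w Ww; rewrite (chern_unique ct).
  apply: is_rdZ; apply: is_rdB; first by apply: smooth_is_rd Wz; exact: smooth_dlog.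
  by apply: is_rdZ; apply: smooth_is_rd Wz; exact: smooth_dlog.
rewrite /curvature /ext_d !E (log_hess_sym oW u v nH Wz).
have aux (a b c i : C) : 2^-1 * (a - i * b) - 2^-1 * (a - i * c) = - (i / 2) * (b - c) by field.
exact: aux.
Qed.

Local Notation om theta := (fun z u v => 'i / (2 * pi)%:C * curvature theta z u v).

Let k : C := (4 * pi)%:C^-1.

Lemma chern_class_log_hess theta z u v : chern_form W H theta -> W z ->
  om theta z u v = k * (log_hess H z u ('i *: v) - log_hess H z v ('i *: u)).
Proof.
move=> ct Wz; rewrite /= (curvature_log_hess _ _ ct Wz) mulrA; congr (_ * _).
have p0 : pi%:C != 0 :> C by rewrite eq_complex /= eqxx andbT gt_eqF// pi_gt0.
have E m : (m%:R * pi)%:C = m%:R * pi%:C :> C by rewrite rmorphM rmorph_nat.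
rewrite /k !E.
have aux (i q : C) : q != 0 -> i * i = -1 -> i / (2 * q) * - (i / 2) = (4 * q)^-1.
  by move=> q0 ii; transitivity (- (i * i) / (4 * q)); [field|rewrite ii opprK mul1r].
by apply: aux => //; rewrite -expr2 sqr_i.
Qed.

Lemma k_gt0 : 0 < k.
Proof. by rewrite /k invr_gt0 ltcR mulr_gt0// pi_gt0. Qed.

Section Pairing.
Variables (theta : V -> V -> C) (z : V).
Hypothesis ct : chern_form W H theta.
Hypothesis Wz : W z.
Let o (u v : V) : C := 'i / (2 * pi)%:C * curvature theta z u v.

Let omE u v : o u v = k * (log_hess H z u ('i *: v) - log_hess H z v ('i *: u)).
Proof. exact: chern_class_log_hess. Qed.

Let oC u v : o u v = - o v u.
Proof. by rewrite !omE -mulrN opprB. Qed.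

Let oL (a : R) u u' v : o (a%:C *: u + u') v = a%:C * o u v + o u' v.
Proof.
rewrite !omE scalerDr scaleiC (log_hess_linear oW _ _ _ _ nH Wz).
rewrite (log_hess_linearr oW _ _ _ _ nH Wz).
have aux (q b x y x' y' : C) : q * ((b * x + x') - (b * y + y')) =
  b * (q * (x - y)) + q * (x' - y') by ring.
exact: aux.
Qed.

Let o0 v : o 0 v = 0.
Proof.
have := oL 1 0 0 v; rewrite rmorph1 scale1r addr0 mul1r => /eqP.
by rewrite -subr_eq0 opprD addrA subrr sub0r oppr_eq0 => /eqP.
Qed.

Let oN u v : o (- u) v = - o u v.
Proof.
by have := oL (-1) u 0 v; rewrite addr0 o0 addr0 rmorphN rmorph1 scaleN1r mulN1r.
Qed.

Let oJ u v : o ('i *: u) ('i *: v) = o u v.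
Proof.
rewrite !omE !scaleii !(log_hessNr oW _ _ nH Wz).
rewrite (log_hess_sym oW ('i *: u) v nH Wz) (log_hess_sym oW ('i *: v) u nH Wz).
by rewrite opprK addrC.
Qed.

Let oreal u v : conjc (o u v) = o u v.
Proof.
rewrite omE conjcM conjcB !(log_hess_real _ _ _ rH); congr (_ * _).
by rewrite /k conjc_inv conjc_real.
Qed.

Let half u : 2^-1 *: u = (2^-1 : R)%:C *: u + 0 :> V.
Proof. by rewrite addr0 fmorphV /= rmorphMn /= rmorph1. Qed.

(** Complex bilinear expansion on [hol v] and the conjugate of [hol w]; invariance under J ([oJ])
    merges the four terms in pairs. *)
Lemma pairingE v w : form_pairing (om theta) z v w = o v ('i *: w) - 'i * o v w.
Proof.
rewrite /form_pairing /cextend /hol /cconj /=.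
have o00 u : o u 0 = 0 by rewrite oC o0 oppr0.
have hl a b : o (2^-1 *: a) b = 2^-1 * o a b.
  by rewrite half oL o0 addr0 fmorphV /= rmorphMn /= rmorph1.
have hr a b : o b (2^-1 *: a) = 2^-1 * o b a.
  by rewrite oC hl (oC a b) mulrN opprK.
change (- (2 * 'i) * (o (2^-1 *: v) (2^-1 *: w) - o (- (2^-1 *: ('i *: v))) (- - (2^-1 *: ('i *: w))) +
  'i * (o (2^-1 *: v) (- - (2^-1 *: ('i *: w))) + o (- (2^-1 *: ('i *: v))) (2^-1 *: w))) =
  o v ('i *: w) - 'i * o v w).
rewrite !opprK !oN !hl !hr oJ.
have -> : o ('i *: v) w = - o v ('i *: w).
  by rewrite -(oJ ('i *: v) w) scaleii oN.
have aux (a b i : C) : i * i = -1 ->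
    - (2 * i) * (2^-1 * (2^-1 * a) - - (2^-1 * (2^-1 * a)) +
      i * (2^-1 * (2^-1 * b) + - (2^-1 * (2^-1 * - b)))) = b - i * a.
  by move=> ii; transitivity (- i * a - (i * i) * b); [field|rewrite ii; ring].
by apply: aux; rewrite -expr2 sqr_i.
Qed.

Lemma pairing_diag v : form_pairing (om theta) z v v = - (k * levi H z v).
Proof.
rewrite pairingE.
have -> : o v v = 0.
  by rewrite omE subrr mulr0.
rewrite mulr0 subr0 omE scaleii (log_hessNr oW _ _ nH Wz) /levi.
by rewrite -opprD mulrN.
Qed.

Lemma pairing_sesquilinear a u v w : form_pairing (om theta) z (a *: u + v) w =
  a * form_pairing (om theta) z u w + form_pairing (om theta) z v w.
Proof.
rewrite !pairingE.
have -> : a *: u + v = (complex.Re a)%:C *: u + ((complex.Im a)%:C *: ('i *: u) + v).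
  by rewrite addrA scalerA -scalerDl [_%:C * 'i]mulrC -complexE.
rewrite !oL oJ.
have -> : o ('i *: u) w = - o u ('i *: w).
  by rewrite -(oJ ('i *: u) w) scaleii oN.
set x := o u _; set y := o u _; set x' := o v _; set y' := o v _.
rewrite [X in _ = X * _ + _]complexE.
have aux (p q i : C) : i * i = -1 ->
  p * x + (q * y + x') - i * (p * y + (q * - x + y')) =
  (p + i * q) * (x - i * y) + (x' - i * y').
  by move=> ii; transitivity ((p + i * q) * (x - i * y) + (x' - i * y') + (1 + i * i) * q * y);
    [ring|rewrite ii subrr !mul0r addr0].
by apply: aux; rewrite -expr2 sqr_i.
Qed.

Lemma pairing_hermitian v w :
  form_pairing (om theta) z w v = conjc (form_pairing (om theta) z v w).
Proof.
rewrite !pairingE (conjcB (o v _)) (conjcM 'i) conjci !oreal.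
have -> : o w ('i *: v) = o v ('i *: w).
  by rewrite oC -oJ scaleii oN opprK.
by rewrite (oC w v) mulrN mulNr.
Qed.

Lemma chern_class_real_form u v : conjc (o u v) = o u v.
Proof. exact: oreal. Qed.

Lemma chern_class_form11 u v : o ('i *: u) ('i *: v) = o u v.
Proof. exact: oJ. Qed.

End Pairing.

(** Reality, type (1,1), sesquilinearity and Hermitian symmetry hold for every metric. On the
    diagonal the pairing is - 1 / (4 pi) times the Levi form, so only its sign is at stake. *)
Theorem positive_formP theta : chern_form W H theta ->
  positive_form W (om theta) <-> forall z v, W z -> v != 0 -> levi H z v < 0.
Proof.
move=> ct; split=> [[_ _ pos] z v Wz v0|neg].
  have [_ _ /(_ v v0)] := pos z Wz.
  by rewrite pairing_diag// oppr_gt0 pmulr_rlt0// k_gt0.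
split=> [z u v Wz|z u v Wz|z Wz].
- exact: chern_class_real_form.
- exact: chern_class_form11.
- split=> [a u v w|v w|v v0].
  + exact: pairing_sesquilinear.
  + exact: pairing_hermitian.
  + by rewrite pairing_diag// oppr_gt0 pmulr_rlt0 ?k_gt0// neg.
Qed.

End OnOpen.
End ChernForm.

Section LeviPullback.
Context {R : realType} {n m : nat}.
Local Notation C := R[i].
Local Notation V := 'rV[R[i]]_n.
Local Notation V' := 'rV[R[i]]_m.
Variables (W : set V) (W' : set V') (F : V -> V') (f : V' -> C).
Hypotheses (oW : open W) (oW' : open W').
Hypothesis hF : holomorphic W F.
Hypothesis FW : forall z, W z -> W' (F z).
Hypothesis sf : snz W' f.

Lemma snz_comp : snz W (f \o F).
Proof.
split; first exact: (smooth_comp oW oW' hF FW sf.1).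
by move=> z Wz; apply: sf.2; exact: FW.
Qed.

Let co (p : 'I_m * bool) (x : V') : R := rcoord x p.

Lemma dlog_comp v z : W z ->
  dlog (f \o F) v z = \sum_p (co p ('d F z v))%:C * dlog f (rbasis p) (F z).
Proof.
move=> Wz; rewrite /dlog (is_rd_eq (is_rd_comp v oW' sf.1 (FW Wz) (hF Wz))) /total mulr_suml.
by apply: eq_bigr => p _; rewrite mulrA.
Qed.

Lemma is_rd_Re (g : V -> C) v z l : is_rd g v z l ->
  is_rd (fun w => (complex.Re (g w))%:C) v z (complex.Re l)%:C.
Proof. by move=> /cderivP[h _]; exact: cderiv_ofreal. Qed.

Lemma is_rd_Im (g : V -> C) v z l : is_rd g v z l ->
  is_rd (fun w => (complex.Im (g w))%:C) v z (complex.Im l)%:C.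
Proof. by move=> /cderivP[_ h]; exact: cderiv_ofreal. Qed.

Lemma is_rd_hol (g : V -> C) v z : differentiable g z -> is_rd g v z ('d g z v).
Proof.
by move=> dg; have := @cderiv_line _ _ g z v 0; rewrite /is_rd scale0r addr0; apply.
Qed.

Let G (j : 'I_m) v : V -> C := fun z => 'd (fun w => F w 0 j : C) z v.

Let GE j v z : W z -> G j v z = ('d F z v) 0 j.
Proof. by move=> Wz; rewrite /G (diff_row_coord j (hF Wz)).2. Qed.

Let dG j v z : W z -> differentiable (G j v) z.
Proof.
move=> Wz; apply: differentiable_derivative_near.
by apply: (near_open oW Wz) => w Ww; exact: (diff_row_coord j (hF Ww)).1.
Qed.

(* the derivative of [w |-> rcoord ('d F w (c *: v)) p] in the direction [c *: v] *)
Let gam (c : C) v z (p : 'I_m * bool) : C :=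
  (rcoord (\row_j (c * c * 'd (G j v) z v)) p)%:C.

Let co_der (c : C) v z p : W z ->
  is_rd (fun w => (co p ('d F w (c *: v)))%:C) (c *: v) z (gam c v z p).
Proof.
move=> Wz; rewrite /co /gam /rcoord mxE.
have dg : is_rd (fun w => c * G p.1 v w) (c *: v) z (c * c * 'd (G p.1 v) z v).
  rewrite -mulrA; apply: is_rdZ; have := is_rd_hol (c *: v) (dG p.1 v Wz).
  by rewrite linearZ.
have E w : W w -> ('d F w (c *: v)) 0 p.1 = c * G p.1 v w.
  by move=> Ww; rewrite linearZ mxE GE.
case: p.2.
  apply: (is_rd_near _ (is_rd_Im dg)).
  by apply: (near_open oW Wz) => w Ww; rewrite E.
apply: (is_rd_near _ (is_rd_Re dg)).
by apply: (near_open oW Wz) => w Ww; rewrite E.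
Qed.

Let log_hess_comp (c : C) v z : W z ->
  log_hess (f \o F) z (c *: v) (c *: v) =
  \sum_p gam c v z p * dlog f (rbasis p) (F z) +
  log_hess f (F z) ('d F z (c *: v)) ('d F z (c *: v)).
Proof.
move=> Wz.
have E x y : log_hess f (F z) x y =
    \sum_p (co p y)%:C * total (dlog f (rbasis p)) (F z) x.
  rewrite (log_hess_sym oW' x y sf (FW Wz)).
  rewrite [LHS](rderiveE _ oW' (smooth_dlog oW' _ sf) (FW Wz)) /total.
  apply: eq_bigr => p _; congr (_ * _).
  rewrite -/(total (dlog f (rbasis p)) (F z) x).
  rewrite -(rderiveE _ oW' (smooth_dlog oW' _ sf) (FW Wz)).
  exact: (log_hess_sym oW' _ _ sf (FW Wz)).
rewrite E -big_split /=.
apply: (@rderive_near _ _ (fun w => \sum_p (co p ('d F w (c *: v)))%:C * dlog f (rbasis p) (F w))).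
  by apply: (near_open oW Wz) => w Ww; rewrite dlog_comp.
apply: is_rd_sum => p; apply: is_rdM; first exact: co_der.
exact: (is_rd_comp (c *: v) oW' (smooth_dlog oW' (rbasis p) sf) (FW Wz) (hF Wz)).
Qed.

(** The chain rule adds to each Hessian a term linear in D^2 F (c v, c v) = c^2 D^2 F (v, v). For
    holomorphic [F] those with c = 1 and c = i cancel, which makes the Levi form independent of
    charts. *)
Theorem levi_comp v z : W z -> levi (f \o F) z v = levi f (F z) ('d F z v).
Proof.
move=> Wz; have h1 := log_hess_comp 1 v Wz; rewrite !scale1r in h1.
have h2 := log_hess_comp 'i v Wz; have lz : 'd F z ('i *: v) = 'i *: 'd F z v by rewrite linearZ.
rewrite /levi h1 h2 lz addrACA -[RHS]add0r; congr (_ + _).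
rewrite -big_split /= big1// => p _.
rewrite -mulrDl (_ : gam 1 v z p + gam 'i v z p = 0) ?mul0r//.
rewrite /gam -rmorphD -rcoordD (_ : _ + _ = 0).
  by rewrite /rcoord mxE /= if_same.
by apply/rowP => j; rewrite !mxE !mul1r -['i * 'i]expr2 sqr_i mulN1r subrr.
Qed.

End LeviPullback.

Section RowValued.
Context {R : realType} {n m : nat}.
Local Notation C := R[i].

Lemma differentiable_row (F : 'rV[R[i]]_n -> 'rV[R[i]]_m) z :
  (forall j, differentiable (fun w => F w 0 j : C) z) ->
  differentiable F z /\ forall v, 'd F z v = \row_j 'd (fun w => F w 0 j : C) z v.
Proof.
move=> dF.
pose L (v : 'rV[R[i]]_n) : 'rV[R[i]]_m := \row_j 'd (fun w => F w 0 j : C) z v.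
have Llin : linear L.
  by move=> a u w; apply/rowP => j; rewrite !mxE linearP.
pose LL : {linear _ -> _} := HB.pack L (GRing.isLinear.Build _ _ _ _ L Llin).
pose Bj j := xget 0 [set B : R | forall h, nrm ('d (fun w => F w 0 j : C) z h) <= B * nrm h].
have hB j h : nrm ('d (fun w => F w 0 j : C) z h) <= Bj j * nrm h.
  exact: (@xgetPex _ 0 [set B : R | forall h, nrm ('d (fun w => F w 0 j : C) z h) <= B * nrm h]
    (nrm_diff_le (dF j))).
have bL h : nrm (LL h) <= (\sum_j `|Bj j|) * nrm h.
  apply: nrm_row_le => [|j].
    by rewrite mulr_ge0 ?nrm_ge0// sumr_ge0.
  rewrite mxE; apply: le_trans (hB j h) _; rewrite ler_wpM2r ?nrm_ge0//.
  rewrite (bigD1 j)//= (le_trans (ler_norm _))// lerDl sumr_ge0//.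
have [] := @nrm_diff _ _ _ F z LL _ bL; last first.
  by move=> d1 d2; split=> // v; rewrite d2.
move=> e e0.
have /choice[d hd] : forall j, exists d : R, 0 < d /\ forall h, nrm h < d ->
   nrm (F (z + h) 0 j - F z 0 j - 'd (fun w => F w 0 j : C) z h) <= e * nrm h.
  by move=> j; have [d d0 H] := diff_nrm (dF j) e0; exists d.
exists (\big[Num.min/1]_j d j).
  by elim/big_ind: _ => // [x y x0 y0|j _]; [rewrite lt_min x0|have [] := hd j].
move=> h hlt; apply: nrm_row_le => [|j].
  by rewrite mulr_ge0 ?nrm_ge0// ltW.
rewrite !mxE; apply: (hd j).2; apply: lt_le_trans hlt _.
by rewrite (bigD1 j)//= ge_min lexx.
Qed.

End RowValued.

(** * The Levi form of the logarithm of the squared norm *)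

Section SquaredNorm.
Context {R : realType} {n : nat}.
Local Notation C := R[i].
Local Notation V := 'rV[R[i]]_n.
Implicit Types u v z w : V.

Definition sqn : V -> C := fun z => \sum_j z 0 j * conjc (z 0 j).

Definition herm z v : C := \sum_j z 0 j * conjc (v 0 j).

Lemma sqn_ge0 z : 0 <= sqn z.
Proof. by apply: sumr_ge0 => j _; exact: mulcJ_ge0. Qed.

Lemma sqn_eq0 z : (sqn z == 0) = (z == 0).
Proof.
apply/idP/eqP => [|->]; last first.
  by rewrite /sqn big1// => j _; rewrite mxE mul0r.
rewrite psumr_eq0; last by move=> j _; exact: mulcJ_ge0.
move=> /allP h; apply/rowP => j; rewrite mxE.
have := h j (mem_index_enum j); rewrite /= mulf_eq0 conjc_eq0 orbb => /eqP//.
Qed.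

Lemma is_rd_coord j v z : is_rd (fun w : V => w 0 j : C) v z (v 0 j).
Proof.
have dc := differentiable_coord z 0 j.
have := is_rd_hol v dc.
have @f : {linear V -> C}.
  by exists (fun N : V => N 0 j); do 2![eexists]; do ?[constructor];
     rewrite ?mxE// => ? *; rewrite ?mxE//; move=> ?; rewrite !mxE.
rewrite (_ : (fun w : V => w 0 j : C) = f)//.
rewrite diff_lin//; exact/coord_continuous.
Qed.

Lemma smooth_sqn : smooth [set: V] sqn.
Proof.
apply: smooth_sum => [|j]; first exact: openT.
apply: smoothM; first exact: openT.
  by apply: smooth_hol => [|z _]; [exact: openT|exact: differentiable_coord].
apply: smooth_conj; first exact: openT.
by apply: smooth_hol => [|z _]; [exact: openT|exact: differentiable_coord].
Qed.

Lemma is_rd_sqn v z : is_rd sqn v z (herm v z + herm z v).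
Proof.
rewrite /herm -big_split /=; apply: is_rd_sum => j.
by apply: is_rdM; [exact: is_rd_coord|apply: is_rd_conj; exact: is_rd_coord].
Qed.

Lemma is_rd_herm v z : is_rd (fun w => herm v w + herm w v) v z (sqn v + sqn v).
Proof.
apply: is_rdD.
  apply: is_rd_sum => j; rewrite -[v 0 j * _]add0r -[X in X + _](mul0r (conjc (z 0 j))).
  by apply: is_rdM; [exact: is_rd_cst|apply: is_rd_conj; exact: is_rd_coord].
apply: is_rd_sum => j; rewrite -[v 0 j * _]addr0 -[X in _ + X](mulr0 (z 0 j)).
by apply: is_rdM; [exact: is_rd_coord|exact: is_rd_cst].
Qed.

Lemma open_neq0 : open [set z : V | z != 0].
Proof.
have -> : [set z : V | z != 0] = ~` [set 0].
  by apply/seteqP; split=> z /= /eqP.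
by apply: closed_openC; apply: accessible_closed_set1; exact: hausdorff_accessible (@norm_hausdorff _ _).
Qed.

Lemma snz_sqn : snz [set z : V | z != 0] sqn.
Proof.
split; first by apply: smooth_sub smooth_sqn.
by move=> z /=; rewrite sqn_eq0.
Qed.

(** The defect in the Cauchy-Schwarz inequality as a sum of squared 2 x 2 minors, each counted
    twice. It shows both that the Levi form of log |z|^2 is semidefinite and that it is positive off
    the line of z. *)
Lemma lagrange z v : sqn z * sqn v - herm z v * herm v z =
  2^-1 * \sum_i \sum_j (z 0 i * v 0 j - z 0 j * v 0 i) * conjc (z 0 i * v 0 j - z 0 j * v 0 i).
Proof.
have E1 : \sum_i \sum_j (z 0 i * conjc (z 0 i)) * (v 0 j * conjc (v 0 j)) = sqn z * sqn v.
  by rewrite /sqn mulr_suml; apply: eq_bigr => i _; rewrite mulr_sumr.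
have E2 : \sum_i \sum_j (z 0 j * conjc (z 0 j)) * (v 0 i * conjc (v 0 i)) = sqn z * sqn v.
  by rewrite exchange_big.
have E3 : \sum_i \sum_j (z 0 i * conjc (v 0 i)) * (v 0 j * conjc (z 0 j)) = herm z v * herm v z.
  by rewrite /herm mulr_suml; apply: eq_bigr => i _; rewrite mulr_sumr.
have E4 : \sum_i \sum_j (z 0 j * conjc (v 0 j)) * (v 0 i * conjc (z 0 i)) = herm z v * herm v z.
  by rewrite exchange_big.
have -> : \sum_i \sum_j (z 0 i * v 0 j - z 0 j * v 0 i) * conjc (z 0 i * v 0 j - z 0 j * v 0 i) =
  (sqn z * sqn v + sqn z * sqn v) - (herm z v * herm v z + herm z v * herm v z).
  rewrite -{1}E1 -{1}E2 -{1}E3 -{1}E4 -!big_split /= -sumrB; apply: eq_bigr => i _.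
  rewrite -!big_split /= -sumrB; apply: eq_bigr => j _.
  by rewrite conjcB !conjcM; ring.
by field.
Qed.

Lemma levi_sqn z v : z != 0 ->
  levi sqn z v = 4 / sqn z ^+ 2 * (sqn z * sqn v - herm z v * herm v z).
Proof.
move=> z0; have N0 : sqn z != 0 by rewrite sqn_eq0.
have H u : log_hess sqn z u u = (sqn u + sqn u) / sqn z - (herm u z + herm z u) ^+ 2 / sqn z ^+ 2.
  rewrite (log_hessE _ _ snz_sqn z0).
  rewrite (_ : rderive sqn u = fun w => herm u w + herm w u).
    by rewrite (is_rd_eq (is_rd_herm u z)) expr2.
  by apply/funext => w; exact: is_rd_eq (is_rd_sqn u w).
have hi : herm ('i *: v) z = 'i * herm v z.
  by rewrite /herm mulr_sumr; apply: eq_bigr => j _; rewrite mxE mulrA.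
have hi' : herm z ('i *: v) = - 'i * herm z v.
  rewrite /herm mulr_sumr; apply: eq_bigr => j _.
  by rewrite mxE conjcM conjci mulrCA.
have si : sqn ('i *: v) = sqn v.
  apply: eq_bigr => j _; rewrite mxE conjcM conjci mulrACA mulrN -expr2 sqr_i.
  by rewrite opprK mul1r.
rewrite /levi !H hi hi' si.
have aux (a b x y i : C) : i * i = -1 -> x != 0 ->
  (y + y) / x - (a + b) ^+ 2 / x ^+ 2 + ((y + y) / x - (i * a + - i * b) ^+ 2 / x ^+ 2) =
  4 / x ^+ 2 * (x * y - b * a).
  move=> ii x0; transitivity (4 / x ^+ 2 * (x * y - b * a) - (1 + i * i) * (a - b) ^+ 2 / x ^+ 2).
    by field.
  by rewrite ii subrr !mul0r subr0.
by apply: aux => //; rewrite -expr2 sqr_i.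
Qed.

Lemma levi_sqn_ge0 z v : z != 0 -> 0 <= levi sqn z v.
Proof.
move=> z0; rewrite levi_sqn// lagrange mulr_ge0//.
  by rewrite divr_ge0// exprn_ge0// sqn_ge0.
rewrite mulr_ge0// sumr_ge0// => i _; rewrite sumr_ge0// => j _; exact: mulcJ_ge0.
Qed.

Lemma levi_sqn_gt0 z v i j : z 0 i * v 0 j != z 0 j * v 0 i -> 0 < levi sqn z v.
Proof.
move=> ij; have z0 : z != 0.
  by apply: contra_neq ij => ->; rewrite !mxE !mul0r.
rewrite lt_def levi_sqn_ge0// andbT levi_sqn// lagrange !mulf_neq0 ?invr_eq0 ?pnatr_eq0//.
  by rewrite expf_neq0// sqn_eq0.
rewrite psumr_neq0; last by move=> k _; rewrite sumr_ge0// => l _; exact: mulcJ_ge0.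
apply/hasP; exists i; first exact: mem_index_enum.
rewrite /= lt_def sumr_ge0 ?andbT; last by move=> l _; exact: mulcJ_ge0.
rewrite psumr_neq0; last by move=> l _; exact: mulcJ_ge0.
apply/hasP; exists j; first exact: mem_index_enum.
by rewrite /= lt_def mulcJ_ge0 andbT mulf_neq0 ?conjc_eq0 ?subr_eq0.
Qed.

End SquaredNorm.

Section AbsoluteSquare.
Context {R : realType} {n : nat}.
Local Notation C := R[i].
Local Notation V := 'rV[R[i]]_n.
Variables (W : set V) (g : V -> C).
Hypotheses (oW : open W) (hg : holomorphic W g) (g0 : forall z, W z -> g z != 0).

Let F : V -> 'rV[R[i]]_1 := fun z => const_mx (g z).

Let hF : holomorphic W F.
Proof.
move=> z Wz; apply: (differentiable_row _).1 => j.
rewrite (_ : (fun _ => _) = g); first exact: hg.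
by apply/funext => w; rewrite mxE.
Qed.

Let FW z : W z -> F z != 0.
Proof.
by move=> /g0; apply: contra_neq => /rowP/(_ 0); rewrite !mxE.
Qed.

Let E z : g z * conjc (g z) = (sqn \o F) z.
Proof. by rewrite /sqn /= big_ord1 !mxE. Qed.

Lemma snz_abs2 : snz W (fun z => g z * conjc (g z)).
Proof.
rewrite (_ : (fun _ => _) = sqn \o F); last exact/funext.
exact: (snz_comp oW open_neq0 hF FW snz_sqn).
Qed.

(** That is, log |g|^2 is pluriharmonic: it is pulled back by [g] from dimension one, where the sum
    in Lagrange's identity is zero. *)
Lemma levi_abs2 z v : W z -> levi (fun z => g z * conjc (g z)) z v = 0.
Proof.
move=> Wz; rewrite (_ : (fun _ => _) = sqn \o F); last exact/funext.
rewrite (levi_comp oW open_neq0 hF FW snz_sqn)// levi_sqn; last exact: FW.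
rewrite lagrange big_ord1 big_ord1.
by rewrite subrr mul0r !mulr0.
Qed.

End AbsoluteSquare.

Lemma nrm_cvg_real {R : realType} {V : normedModType R[i]} (f : V -> R) z :
  (forall e : R, 0 < e -> exists2 d : R, 0 < d &
    forall h, nrm h < d -> `|f (z + h) - f z| < e) -> {for z, continuous f}.
Proof.
move=> h; apply/cvgrPdist_lt => e /h[d d0 H].
by apply/near_nrmP; exists d => // x /H; rewrite distrC.
Qed.

Lemma continuous_big_sum {R : realType} {T : topologicalType} (I : Type) (r : seq I)
    (h : I -> T -> R) (x : T) : (forall i, {for x, continuous (h i)}) ->
  {for x, continuous (fun y => \sum_(i <- r) h i y)}.
Proof.
move=> hc; elim: r => [|p r IH].
  rewrite (_ : (fun _ => _) = fun=> 0); first exact: cst_continuous.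
  by apply/funext => y; rewrite big_nil.
rewrite (_ : (fun _ => _) = fun y => h p y + \sum_(i <- r) h i y).
  exact: (@continuousD _ _ _ (h p) _ _ (hc p) IH).
by apply/funext => y; rewrite big_cons.
Qed.

Lemma large_multiple_neg {R : realFieldType} (x y b k c : R) :
  x <= k * - (c / 2) -> y < b -> 2 * b < k * c -> x + y < 0.
Proof. lra. Qed.

(** * Domination by large powers *)

Section UniformNegativity.
Context {R : realType} {n : nat}.
Local Notation C := R[i].
Local Notation V := 'rV[R[i]]_n.
Local Notation N := #|{: 'I_n * bool}|.
Implicit Types (W : set V) (f g : V -> C) (u v w z : V) (t : 'rV[R]_N).

Lemma complex_lt0 (c : C) : conjc c = c -> complex.Re c < 0 -> c < 0.
Proof.
case: c => a b [] /eqP; rewrite eq_sym -subr_eq0 opprK -mulr2n mulrn_eq0 /= => /eqP ->.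
by rewrite ltcE /= eqxx.
Qed.

Lemma Re_sum (I : Type) (r : seq I) (F : I -> C) :
  complex.Re (\sum_(i <- r) F i) = \sum_(i <- r) complex.Re (F i).
Proof. exact: (big_morph _ cReD). Qed.

Lemma Re_realM (a : R) (c : C) : complex.Re (a%:C * c) = a * complex.Re c.
Proof. by rewrite cReM /= mul0r subr0. Qed.

Lemma levi_real f z v : (forall w, conjc (f w) = f w) -> conjc (levi f z v) = levi f z v.
Proof.
move=> rf; apply: etrans (conjcD _ _) _; congr (_ + _); exact: log_hess_real.
Qed.

Let rk (p : 'I_n * bool) : 'I_N := enum_rank p.

(** C^n is identified with real rows of length 2n, whose unit sphere is compact by
    [bounded_closed_compact]. *)
Let vof t : V := \row_j (t 0 (rk (j, false)) +i* t 0 (rk (j, true))).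

Let tof v : 'rV[R]_N := \row_i rcoord v (enum_val i).

Let vofK v : vof (tof v) = v.
Proof.
apply/rowP => j; rewrite !mxE /rk !enum_rankK /rcoord /=.
by case: (v 0 j).
Qed.

Let rcoord_vof t p : rcoord (vof t) p = t 0 (rk p).
Proof. by case: p => j [] ; rewrite /rcoord mxE. Qed.

Let rcoord_ivof t p : rcoord ('i *: vof t) p =
  if p.2 then t 0 (rk (p.1, false)) else - t 0 (rk (p.1, true)).
Proof.
case: p => j [] /=; rewrite /rcoord !mxE /=; ring.
Qed.

Let entry f p q z : R := complex.Re (log_hess f z (rbasis p) (rbasis q)).

Let log_hess_entry W f z x y : open W -> snz W f -> W z ->
  complex.Re (log_hess f z x y) = \sum_p \sum_q rcoord x p * rcoord y q * entry f p q z.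
Proof.
move=> oW sf Wz.
rewrite [log_hess f z x y](rderiveE _ oW (smooth_dlog oW y sf) Wz) /total.
rewrite Re_sum; apply: eq_bigr => p _; rewrite (Re_realM (rcoord x p)).
rewrite -/(log_hess f z (rbasis p) y) (log_hess_sym oW (rbasis p) y sf Wz).
rewrite [log_hess f z y _](rderiveE _ oW (smooth_dlog oW _ sf) Wz) /total Re_sum mulr_sumr.
apply: eq_bigr => q _; rewrite (Re_realM (rcoord y q)) mulrA /entry.
by rewrite -/(log_hess f z (rbasis q) (rbasis p)) (log_hess_sym oW (rbasis q) (rbasis p) sf Wz).
Qed.

Let quad f (zt : V * 'rV[R]_N) : R := complex.Re (levi f zt.1 (vof zt.2)).

Let quad_cont W f z t : open W -> snz W f -> W z ->
  forall e, 0 < e -> \forall zt \near (z, t), `|quad f zt - quad f (z, t)| < e.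
Proof.
move=> oW sf Wz e e0.
pose Q (zt : V * 'rV[R]_N) : R :=
  \sum_p \sum_q rcoord (vof zt.2) p * rcoord (vof zt.2) q * entry f p q zt.1 +
  \sum_p \sum_q rcoord ('i *: vof zt.2) p * rcoord ('i *: vof zt.2) q * entry f p q zt.1.
have QE z' t' : W z' -> quad f (z', t') = Q (z', t').
  move=> Wz'; rewrite /quad /Q; apply: etrans (cReD _ _) _; congr (_ + _).
    exact: (log_hess_entry (vof t') (vof t') oW sf Wz').
  exact: (log_hess_entry ('i *: vof t') ('i *: vof t') oW sf Wz').
have cc i : {for (z, t), continuous (fun zt : V * 'rV[R]_N => zt.2 0 i)}.
  apply: (@continuous_comp _ _ _ snd (fun x : 'rV[R]_N => x 0 i)); first exact: cvg_snd.
  exact: coord_continuous.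
have ce p q : {for (z, t), continuous (fun zt : V * 'rV[R]_N => entry f p q zt.1)}.
  apply: (@continuous_comp _ _ _ fst (entry f p q)); first exact: cvg_fst.
  have := smooth_cont (smooth_rderive (rbasis p) (smooth_dlog oW (rbasis q) sf)) Wz.
  move=> /nrm_cvgP h; apply: nrm_cvg_real => d d0; have [r r0 H] := h d d0.
  exists r => // x xr; apply: le_lt_trans (H x xr).
  by rewrite /entry -cReN -cReD; exact: Re_nrm.
have cv p : {for (z, t), continuous (fun zt : V * 'rV[R]_N => rcoord (vof zt.2) p)}.
  rewrite (_ : (fun _ => _) = fun zt : V * 'rV[R]_N => zt.2 0 (rk p)); first exact: cc.
  by apply/funext => zt; exact: rcoord_vof.
have ci p : {for (z, t), continuous (fun zt : V * 'rV[R]_N => rcoord ('i *: vof zt.2) p)}.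
  have E := rcoord_ivof _ p; case: p E => j [] /= E.
    rewrite (_ : (fun _ => _) = fun zt : V * 'rV[R]_N => zt.2 0 (rk (j, false))); first exact: cc.
    by apply/funext => zt; exact: E.
  rewrite (_ : (fun _ => _) = fun zt : V * 'rV[R]_N => - zt.2 0 (rk (j, true))).
    exact: (@continuousN _ _ _ (fun zt : V * 'rV[R]_N => zt.2 0 (rk (j, true)))).
  by apply/funext => zt; exact: E.
have Qc : {for (z, t), continuous Q}.
  apply: (@continuousD _ _ _ (fun zt => \sum_p \sum_q rcoord (vof zt.2) p * rcoord (vof zt.2) q * entry f p q zt.1)).
    apply: continuous_big_sum => p; apply: continuous_big_sum => q.
    apply: (@continuousM _ _ (fun zt => rcoord (vof zt.2) p * rcoord (vof zt.2) q)); last exact: ce.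
    by apply: (@continuousM _ _ (fun zt => rcoord (vof zt.2) p)); exact: cv.
  apply: continuous_big_sum => p; apply: continuous_big_sum => q.
  apply: (@continuousM _ _ (fun zt => rcoord ('i *: vof zt.2) p * rcoord ('i *: vof zt.2) q)); last exact: ce.
  by apply: (@continuousM _ _ (fun zt => rcoord ('i *: vof zt.2) p)); exact: ci.
have /cvgrPdist_lt/(_ e e0) := Qc => H.
have Wn : \forall zt \near (z, t), W zt.1.
  by apply: (@cvg_fst _ _ (nbhs z) (nbhs t) _ W); exact: open_nbhs_nbhs.
apply: filterS2 Wn H => -[z' t'] /= Wz'; rewrite distrC.
by rewrite !QE.
Qed.

Let sphere : set 'rV[R]_N := [set t | `|t| = 1].

Let sphere_compact : compact sphere.
Proof.
apply: bounded_closed_compact.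
  by exists 1; split=> // x x1 t /= ->; exact: ltW.
rewrite (_ : sphere = Num.norm @^-1` [set 1]); last by [].
apply: closed_comp => [t _|]; first exact: norm_continuous.
by apply: accessible_closed_set1; exact: hausdorff_accessible (@norm_hausdorff _ _).
Qed.

Let levi_scale W f z v (a : R) : open W -> snz W f -> W z ->
  levi f z (a%:C *: v) = (a ^+ 2)%:C * levi f z v.
Proof.
move=> oW sf Wz.
have H u : log_hess f z (a%:C *: u) (a%:C *: u) = (a ^+ 2)%:C * log_hess f z u u.
  have S x y : log_hess f z (a%:C *: x) y = a%:C * log_hess f z x y.
    by have := log_hess_linear oW a x 0 y sf Wz; rewrite addr0 (log_hess0 oW y sf Wz) addr0.
  rewrite S (log_hess_sym oW _ _ sf Wz) S.
  by rewrite mulrA -rmorphM expr2.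
by rewrite /levi scaleiC !H mulrDr.
Qed.

(** Near a unit direction t at [z0] the first form stays below - a / 2 and the second below B, so
    every k > 2 B / a works. Compactness of the sphere makes neighbourhood and threshold independent
    of t, and quadratic homogeneity covers all nonzero vectors. *)
Theorem levi_uniform W f g z0 : open W -> W z0 -> snz W f -> snz W g ->
  (forall w, conjc (f w) = f w) -> (forall w, conjc (g w) = g w) ->
  (forall v, v != 0 -> levi f z0 v < 0) ->
  \forall z \near z0 & k \near \oo, forall v, v != 0 ->
    k%:R * levi f z v + levi g z v < 0.
Proof.
move=> oW Wz0 sf sg rf rg neg.
have cov := (compact_near_coveringP sphere).1 sphere_compact.
have main := cov (V * nat)%type (filter_prod (nbhs z0) \oo)
  (fun zk t => zk.2%:R * quad f (zk.1, t) + quad g (zk.1, t) < 0) _.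
have {}main : \forall zk \near filter_prod (nbhs z0) \oo,
    sphere `<=` (fun t => zk.2%:R * quad f (zk.1, t) + quad g (zk.1, t) < 0).
  apply: main => t t1.
  have v0 : vof t != 0.
    apply/eqP => h; have t0 : t = 0.
      apply/rowP => i; rewrite mxE -(enum_valK i) -[enum_rank _]/(rk _) -rcoord_vof h.
      by rewrite /rcoord mxE if_same.
    by move: t1; rewrite /sphere /= t0 normr0 => /esym/eqP; rewrite oner_eq0.
  pose a := - quad f (z0, t).
  have a0 : 0 < a.
    have := neg _ v0; rewrite ltcE /= => /andP[_ h].
    by rewrite /a oppr_gt0.
  pose B := `|quad g (z0, t)| + 1.
  have B0 : 0 < B by rewrite /B ltr_pwDr.
  have a2 : 0 < a / 2 by rewrite divr_gt0.
  have n1 := quad_cont t oW sf Wz0 a2.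
  have n2 := quad_cont t oW sg Wz0 ltr01.
  have [[A A'] /= [nA nA'] AA] := filterI n1 n2.
  exists (A', [set zk | A zk.1 /\ 2 * B / a < zk.2%:R]) => /=.
    split=> //; exists (A, [set k : nat | 2 * B / a < k%:R]) => /=.
      split=> //; exists (Num.bound (2 * B / a)) => // k /= hk.
      apply: lt_le_trans (archi_boundP _) _; last by rewrite ler_nat.
      by rewrite divr_ge0 ?mulr_ge0 ?(ltW a0) ?(ltW B0).
    by move=> [z k] /= [].
  move=> [t' [z k]] /= [At [Az hk]].
  have [/= h1 h2] := AA (z, t') (conj Az At).
  have aux1 (b c : R) : `|b - c| < - c / 2 -> b < - (- c / 2).
    by rewrite ltr_norml => /andP[_]; lra.
  have aux2 (b c : R) : `|b - c| < 1 -> b < `|c| + 1.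
    by rewrite ltr_norml => /andP[_]; have := ler_norm c; lra.
  have q1 := aux1 _ _ h1; have q2 := aux2 _ _ h2.
  rewrite ltr_pdivrMr// in hk.
  have k0 : 0 <= k%:R :> R by exact: ler0n.
  have q3 : k%:R * quad f (z, t') <= k%:R * - (a / 2).
    by apply: ler_wpM2l => //; exact: ltW q1.
  exact: large_multiple_neg q3 q2 hk.
(* It remains to scale an arbitrary [v] to the unit sphere of the real coordinates. *)
apply: filterS2 main (_ : \forall zk \near filter_prod (nbhs z0) \oo, W zk.1).
  move=> [z k] /= H Wz v v0.
  set c := _ + _; have rc : conjc c = c.
    by rewrite /c conjcD conjcM conjc_nat !levi_real.
  apply: complex_lt0 => //.
  have tv0 : tof v != 0.
    apply: contra_neq v0 => h; rewrite -(vofK v) h.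
    by apply/rowP => j; rewrite !mxE.
  have r0 : 0 < `|tof v| by rewrite normr_gt0.
  pose t := `|tof v|^-1 *: tof v.
  have t1 : sphere t.
    by rewrite /sphere /= normrZ normfV normr_id mulVf// gt_eqF.
  have vt : v = `|tof v|%:C *: vof t.
    apply/rowP => j; rewrite -{1}(vofK v) !mxE.
    apply/eqP; rewrite eq_complex /= !mul0r subr0 addr0.
    by rewrite !mulrA mulfV ?mul1r ?eqxx// gt_eqF.
  have := H t t1; rewrite /= /quad /= /c [in levi f z v]vt [in levi g z v]vt.
  rewrite !(levi_scale _ _ oW _ Wz)// mulrCA -mulrDr.
  rewrite cReM /= mul0r subr0 pmulr_rlt0 ?exprn_gt0//.
  rewrite cReD cReM (_ : complex.Im k%:R = 0) ?mul0r ?subr0; last first.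
    by rewrite -[k%:R]/(k%:R : C) -(rmorph_nat (real_complex R)).
  by rewrite -(rmorph_nat (real_complex R)).
by apply: (@cvg_fst _ _ (nbhs z0) \oo _ W); exact: open_nbhs_nbhs.
Qed.

End UniformNegativity.

(** * Germs of smooth and holomorphic functions *)

Section Germs.
Context {R : realType}.
Local Notation C := R[i].

Definition hol_at {n : nat} {Y : normedModType C} (F : 'rV[R[i]]_n -> Y) (z : 'rV[R[i]]_n) : Prop :=
  \forall w \near z, differentiable F w.

Definition snz_at {n : nat} (f : 'rV[R[i]]_n -> C) (z : 'rV[R[i]]_n) : Prop :=
  exists W, [/\ open W, W z & snz W f].

Section OneSpace.
Context {n : nat}.
Local Notation V := 'rV[R[i]]_n.
Implicit Types (f g : V -> C) (z v : V).

Lemma near_openP z (P : V -> Prop) : (\forall w \near z, P w) ->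
  exists W, [/\ open W, W z & forall w, W w -> P w].
Proof.
move=> h; have : nbhs z [set w | P w] by exact: h.
by rewrite nbhsE => -[W [oW Wz] WP]; exists W.
Qed.

Lemma hol_at_diff {Y : normedModType C} (F : V -> Y) z : hol_at F z -> differentiable F z.
Proof. exact: nbhs_singleton. Qed.

Lemma snz_sub (W W' : set V) f : W' `<=` W -> snz W f -> snz W' f.
Proof. by move=> WW [s h]; split=> [|z /WW]; [exact: smooth_sub WW s|exact: h]. Qed.

Lemma snz_near f z : snz_at f z -> \forall w \near z, snz_at f w.
Proof. by move=> [W [oW Wz sf]]; apply: (near_open oW Wz) => w Ww; exists W. Qed.

Lemma snz_at2 f g z : snz_at f z -> snz_at g z ->
  exists W, [/\ open W, W z, snz W f & snz W g].
Proof.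
move=> [W [oW Wz sf]] [W' [oW' W'z sg]]; exists (W `&` W'); split=> //; first exact: openI.
  exact: snz_sub sf.
exact: snz_sub sg.
Qed.

Lemma snz_atM f g z : snz_at f z -> snz_at g z -> snz_at (fun w => f w * g w) z.
Proof.
by move=> sf sg; have [W [oW Wz s s']] := snz_at2 sf sg; exists W; split=> //; exact: snzM.
Qed.

Lemma snz_atV f z : snz_at f z -> snz_at (fun w => (f w)^-1) z.
Proof. by move=> [W [oW Wz sf]]; exists W; split=> //; exact: snzV. Qed.

Lemma snz_atX f k z : snz_at f z -> snz_at (fun w => f w ^+ k) z.
Proof. by move=> [W [oW Wz sf]]; exists W; split=> //; exact: snzX. Qed.

Lemma snz_at_cst (c : C) z : c != 0 -> snz_at (fun=> c) z.
Proof.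
by move=> c0; exists setT; split=> //; [exact: openT|apply: snz_cst => //; exact: openT].
Qed.

Lemma levi_atM f g z v : snz_at f z -> snz_at g z ->
  levi (fun w => f w * g w) z v = levi f z v + levi g z v.
Proof.
by move=> sf sg; have [W [oW Wz s s']] := snz_at2 sf sg; exact: (leviM oW).
Qed.

Lemma levi_atV f z v : snz_at f z -> levi (fun w => (f w)^-1) z v = - levi f z v.
Proof. by move=> [W [oW Wz sf]]; exact: (leviV oW). Qed.

Lemma levi_atX f k z v : snz_at f z -> levi (fun w => f w ^+ k) z v = k%:R * levi f z v.
Proof. by move=> [W [oW Wz sf]]; exact: (leviX oW). Qed.

Lemma snz_at_near f g z : (\forall w \near z, f w = g w) -> snz_at f z -> snz_at g z.
Proof.
move=> /near_openP[U [oU Uz fg]] [W [oW Wz sf]].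
exists (U `&` W); split=> //; first exact: openI.
have [s h] := snz_sub (@subIsetr _ U W) sf; split=> [|w [Uw Ww]]; last first.
  by rewrite -fg//; exact: h.
by apply: smooth_ext s => [|w [Uw _]]; [exact: openI|exact: fg].
Qed.

Lemma levi_at_near f g z v : (\forall w \near z, f w = g w) -> snz_at f z ->
  levi g z v = levi f z v.
Proof.
move=> /near_openP[U [oU Uz fg]] [W [oW Wz sf]].
apply: (@levi_ext _ _ (U `&` W)) => //; first exact: openI.
  exact: snz_sub sf.
by move=> w [Uw _]; exact: fg.
Qed.

Lemma smooth_of_snz_at (W : set V) f : (forall z, W z -> snz_at f z) -> smooth W f.
Proof.
by move=> h; apply: smooth_local => z /h[U [oU Uz [s _]]]; exists U.
Qed.

Lemma snz_at_abs2 g z : hol_at g z -> g z != 0 -> snz_at (fun w => g w * conjc (g w)) z.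
Proof.
move=> hg g0; have cg := differentiable_continuous (hol_at_diff hg).
have ng : \forall w \near z, g w != 0 by exact: cvgr_neq0 cg g0.
have [W [oW Wz HW]] := near_openP (filterI hg ng).
have h1 : holomorphic W g by move=> w Ww; exact: (HW w Ww).1.
have h2 w : W w -> g w != 0 by move=> Ww; exact: (HW w Ww).2.
by exists W; split; [exact: oW|exact: Wz|exact: snz_abs2 oW h1 h2].
Qed.

Lemma levi_at_abs2 g z v : hol_at g z -> g z != 0 ->
  levi (fun w => g w * conjc (g w)) z v = 0.
Proof.
move=> hg g0; have cg := differentiable_continuous (hol_at_diff hg).
have ng : \forall w \near z, g w != 0 by exact: cvgr_neq0 cg g0.
have [W [oW Wz HW]] := near_openP (filterI hg ng).
have h1 : holomorphic W g by move=> w Ww; exact: (HW w Ww).1.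
have h2 w : W w -> g w != 0 by move=> Ww; exact: (HW w Ww).2.
exact: (levi_abs2 oW h1 h2 v Wz).
Qed.

Lemma snz_at_sqn z : z != 0 -> snz_at sqn z.
Proof. by move=> z0; exists [set z | z != 0]; split=> //; [exact: open_neq0|exact: snz_sqn]. Qed.

End OneSpace.

Section TwoSpaces.
Context {n m : nat}.
Variables (F : 'rV[R[i]]_n -> 'rV[R[i]]_m) (f : 'rV[R[i]]_m -> C) (z : 'rV[R[i]]_n).
Hypotheses (hF : hol_at F z) (sf : snz_at f (F z)).

Let common : exists W W', [/\ open W, open W', W z & [/\ holomorphic W F,
  forall w, W w -> W' (F w) & snz W' f]].
Proof.
have [W' [oW' W'z s]] := sf.
have cF := differentiable_continuous (hol_at_diff hF).
have nF : \forall w \near z, W' (F w) by apply: cF; exact: open_nbhs_nbhs.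
have [W [oW Wz HW]] := near_openP (filterI hF nF).
have h1 : holomorphic W F by move=> w Ww; exact: (HW w Ww).1.
have h2 w : W w -> W' (F w) by move=> Ww; exact: (HW w Ww).2.
by exists W, W'; split; [exact: oW|exact: oW'|exact: Wz|split].
Qed.

Lemma snz_at_comp : snz_at (f \o F) z.
Proof.
have [W [W' [oW oW' Wz [h FW s]]]] := common.
by exists W; split; [exact: oW|exact: Wz|exact: (snz_comp oW oW' h FW s)].
Qed.

Lemma levi_at_comp v : levi (f \o F) z v = levi f (F z) ('d F z v).
Proof. by have [W [W' [oW oW' Wz [h FW s]]]] := common; exact: (levi_comp oW oW' h FW s v Wz). Qed.

End TwoSpaces.

Lemma hol_at_comp {n m : nat} {Y : normedModType C} (F : 'rV[R[i]]_n -> 'rV[R[i]]_m)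
    (G : 'rV[R[i]]_m -> Y) (z : 'rV[R[i]]_n) :
  hol_at F z -> hol_at G (F z) -> hol_at (G \o F) z.
Proof.
move=> hF hG; have cF := differentiable_continuous (hol_at_diff hF).
have nF : \forall w \near z, differentiable G (F w) by exact: (cF _ hG).
by apply: filterS2 hF nF => w d1 d2; exact: differentiable_comp.
Qed.

End Germs.

Lemma near_shift_real {R : realType} (t d : R) (P : R -> Prop) : 0 < d ->
  (forall s, `|s| < d -> P (t + s)) -> \forall x \near t, P x.
Proof.
move=> d0 h; apply/nbhs_normP; exists d => // x /= xd.
by rewrite -(subrKC t x); apply: h; rewrite distrC.
Qed.

(** * Cutoff functions *)

Section FlatFunction.
Context {R : realType}.
Implicit Types (p : {poly R}) (s t : R).

(** Polynomial factors in 1 / t make the family stable under differentiation. *)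
Definition flat p t : R := if 0 < t then p.[t^-1] * expR (- t^-1) else 0.

Lemma poly_growth p : exists C d, 0 <= C /\ forall s, 1 <= s -> `|p.[s]| <= C * s ^+ d.
Proof.
elim/poly_ind: p => [|p c [C [d [C0 H]]]].
  by exists 0, 0%N; split=> // s _; rewrite horner0 normr0 mul0r.
exists (C + `|c|), d.+1; split=> [|s s1]; first exact: addr_ge0.
have s0 : 0 <= s by lra.
rewrite !hornerE (le_trans (ler_normD _ _))// mulrDl lerD//.
  rewrite normrM [`|s|]ger0_norm// exprSr mulrA.
  by apply: ler_wpM2r => //; exact: H.
by apply: ler_peMr => //; exact: exprn_ege1.
Qed.

Lemma expR_ge_power n s : 0 <= s -> (s / n.+1%:R) ^+ n.+1 <= expR s.
Proof.
move=> s0; have -> : s = n.+1%:R * (s / n.+1%:R) by rewrite mulrCA mulfV ?mulr1// pnatr_eq0.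
rewrite expRM_natl mulrAC mulfV ?pnatr_eq0// mul1r.
have x0 : 0 <= s / n.+1%:R by rewrite divr_ge0.
apply: lerXn2r; rewrite ?nnegrE ?expR_ge0//.
by apply: le_trans (expR_ge1Dx _); rewrite lerDr.
Qed.

Lemma flat_quadratic p : exists2 K, 0 <= K & forall t, `|t| <= 1 -> `|flat p t| <= K * t ^+ 2.
Proof.
have [C [d [C0 H]]] := poly_growth p.
(* Of the powers of s = 1 / t gained from the exponential, [d] absorb the growth of [p] and two
   leave the factor t^2. *)
pose n := d.+2; pose K := C * n%:R ^+ n; have K0 : 0 <= K by rewrite mulr_ge0// exprn_ge0.
exists K => // t t1; rewrite /flat; case: ifP => [t0|_]; last first.
  by rewrite normr0 mulr_ge0// sqr_ge0.
rewrite ger0_norm ?(ltW t0)// in t1.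
have s1 : 1 <= t^-1 by rewrite -invr1 lef_pV2 ?posrE.
set s := t^-1 in s1 *; have s0 : 0 < s by rewrite invr_gt0.
rewrite normrM [`|expR _|]ger0_norm ?expR_ge0// expRN.
have e0 : 0 < (s / n%:R) ^+ n by rewrite exprn_gt0// divr_gt0.
have e1 : (expR s)^-1 <= ((s / n%:R) ^+ n)^-1.
  by rewrite lef_pV2 ?posrE ?expR_gt0//; apply: expR_ge_power; exact: ltW.
apply: le_trans (ler_pM _ _ (H s s1) e1) _; rewrite ?invr_ge0 ?expR_ge0//.
rewrite le_eqVlt; apply/orP; left; apply/eqP.
have -> : t = s^-1 by rewrite invrK.
rewrite /K expr_div_n /n; set N := d.+2%:R ^+ d.+2.
have N0 : N != 0 by rewrite expf_neq0// pnatr_eq0.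
have sn0 : s != 0 by rewrite gt_eqF.
have -> : s ^+ d.+2 = s ^+ d * s ^+ 2 by rewrite -exprD addn2.
have x0 : s ^+ d != 0 by rewrite expf_neq0.
set x := s ^+ d in x0 *; clearbody N x.
by field; rewrite ?N0 ?x0 ?sn0.
Qed.

(** For t > 0 the derivatives of p(1 / t) and of the exponential both produce 1 / t^2, whence (p -
    p') X^2. At 0 the quadratic bound gives derivative 0. *)
Lemma is_derive_flat p t :
  is_derive t (1 : R) (flat p) (flat ((p - p^`()) * 'X^2) t).
Proof.
have [t0|t0|->] := ltgtP t 0; last first.
- rewrite {2}/flat ltxx; apply/is_derive_epsP => e e0.
  have [K K0 H] := flat_quadratic p.
  have K1 : 0 < K + 1 by lra.
  exists (Num.min 1 (e / (K + 1))); first by rewrite lt_min ltr01 divr_gt0.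
  move=> s; rewrite lt_min ltr_pdivlMr// => /andP[/ltW s1 se].
  rewrite add0r {2}/flat ltxx mulr0 !subr0; apply: le_trans (H s s1) _.
  rewrite -real_normK ?num_real// expr2 mulrA; apply: ler_wpM2r => //.
  by have := normr_ge0 s; nra.
- rewrite {2}/flat t0.
  have tn0 : t != 0 by rewrite gt_eqF.
  have dV : is_derive t (1 : R) (fun x : R => x^-1) (- t ^- 2).
    have := is_deriveV (f := id) tn0 (is_derive_id t (1:R)).
    by rewrite /GRing.scale /= mulr1.
  have dp := is_derive1_comp (is_derive_poly p t^-1) dV.
  have dN : is_derive t (1 : R) (fun x : R => - x^-1) (- - t ^- 2) by exact: is_deriveN dV.
  have de := is_derive1_comp (f := expR) (g := fun x : R => - x^-1) (is_derive_expR (- t^-1)) dN.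
  have dd := is_deriveM dp de.
  apply: (@near_eq_is_derive _ _ _ (fun x : R => p.[x^-1] * expR (- x^-1))).
    apply: (near_shift_real t0) => s; rewrite ltr_norml => /andP[st _].
    by rewrite /flat ifT//; lra.
  apply: (is_derive_eq dd).
  rewrite /GRing.scale /= !hornerE -?exprVn /=; ring.
- have tn : (0 < t) = false by apply/negbTE; rewrite -leNgt ltW.
  rewrite {2}/flat tn; apply: (@near_eq_is_derive _ _ _ (cst 0)).
    apply: (near_shift_real (d := - t)); first by rewrite oppr_gt0.
    move=> s; rewrite ltr_norml => /andP[_ st]; rewrite /flat ifF//.
    by apply/negbTE; rewrite -leNgt; lra.
Qed.

Definition psi_poly k : {poly R} := iter k (fun p => (p - p^`()) * 'X^2) 1.

(* [psi 0] is [exp (- 1 / t)] for [t > 0], extended by 0, and [psi k.+1] is the derivative of [psi k]. *)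
Definition psi k : R -> R := flat (psi_poly k).

Lemma is_derive_psi k t : is_derive t (1 : R) (psi k) (psi k.+1 t).
Proof. exact: is_derive_flat. Qed.

Lemma psi0_gt0 t : 0 < t -> 0 < psi 0 t.
Proof. by move=> t0; rewrite /psi /flat t0 hornerC mul1r expR_gt0. Qed.

Lemma psi0_eq0 t : t <= 0 -> psi 0 t = 0.
Proof. by move=> t0; rewrite /psi /flat ltNge t0. Qed.

Lemma psi0_ge0 t : 0 <= psi 0 t.
Proof. by have [/psi0_eq0->|/psi0_gt0/ltW] := leP t 0. Qed.

End FlatFunction.

Section Cutoff.
Context {R : realType} {n : nat}.
Local Notation C := R[i].
Local Notation V := 'rV[R[i]]_n.
Implicit Types (z : V) (r : R).

Definition sqnR z : R := complex.Re (sqn z).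

Lemma sqnRE z : sqn z = (sqnR z)%:C.
Proof.
rewrite /sqnR; have := ger0_Im (sqn_ge0 z); by case: (sqn z) => a b /= ->.
Qed.

Lemma sqnR_ge0 z : 0 <= sqnR z.
Proof. by rewrite -lecR -sqnRE sqn_ge0. Qed.

Lemma sqnR_gt0 z : z != 0 -> 0 < sqnR z.
Proof.
move=> z0; rewrite lt_def sqnR_ge0 andbT; apply: contra_neq z0 => h.
by apply/eqP; rewrite -sqn_eq0 sqnRE h.
Qed.

Lemma sqnR0 : sqnR 0 = 0.
Proof.
by have := sqn_eq0 (0 : V); rewrite eqxx /sqnR => /eqP ->.
Qed.

Lemma nrm_le_sqnR z r : 0 <= r -> sqnR z <= r ^+ 2 -> nrm z <= r.
Proof.
move=> r0 zr; apply: nrm_row_le => // j.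
rewrite -(ler_pXn2r (n := 2)) ?nnegrE ?nrm_ge0//; apply: le_trans zr.
rewrite -lecR -sqnRE -conjc_norm2 /sqn (bigD1 j)//= lerDl sumr_ge0// => k _.
exact: mulcJ_ge0.
Qed.

Lemma continuous_sqnR z : {for z, continuous sqnR}.
Proof.
apply: nrm_cvg_real => e e0.
have /nrm_cvgP/(_ e e0)[d d0 H] := smooth_cont smooth_sqn (I : [set: V] z).
exists d => // h /H; apply: le_lt_trans.
by rewrite /sqnR -cReN -cReD; exact: Re_nrm.
Qed.

Definition bump r z : R := psi 0 (r ^+ 2 - sqnR z).

(** Equal to 1 on the ball of radius r / 2 and to 0 off the ball of radius r. The two terms of the
    denominator never vanish together because r^2 / 4 < r^2. *)
Definition cutoff r z : R := bump r z / (bump r z + psi 0 (sqnR z - r ^+ 2 / 4)).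

(* |z|^2 near 0, and 1 outside the ball of radius r *)
Definition trunc_sqn r z : R := cutoff r z * sqnR z + (1 - cutoff r z).

Lemma smooth_psi k (f : V -> R) : smooth setT (fun z => (f z)%:C) ->
  smooth setT (fun z => (psi k (f z))%:C).
Proof. by move=> sf; exact: (smooth_real k openT (@is_derive_psi R) sf). Qed.

Lemma smooth_sqnR : smooth [set: V] (fun z => (sqnR z)%:C).
Proof. by rewrite (_ : (fun _ => _) = sqn); [exact: smooth_sqn|apply/funext => z; rewrite sqnRE]. Qed.

Lemma smooth_bump r : smooth [set: V] (fun z => (bump r z)%:C).
Proof.
apply: (@smooth_psi 0 (fun z => r ^+ 2 - sqnR z)).
rewrite (_ : (fun _ => _) = fun z => (r ^+ 2)%:C + (-1) * (sqnR z)%:C).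
  apply: smoothD; [exact: openT|exact: (smooth_cst _ openT)|].
  by apply: smoothM; [exact: openT|exact: (smooth_cst _ openT)|exact: smooth_sqnR].
by apply/funext => z; rewrite rmorphB mulN1r.
Qed.

Lemma cutoff_den_gt0 r z : 0 < r -> 0 < bump r z + psi 0 (sqnR z - r ^+ 2 / 4).
Proof.
move=> r0; have r2 : 0 < r ^+ 2 by rewrite exprn_gt0.
have [h|h] := ltP (sqnR z) (r ^+ 2).
  by rewrite ltr_pwDl ?psi0_ge0// psi0_gt0// subr_gt0.
by rewrite ltr_wpDl ?psi0_ge0// psi0_gt0//; lra.
Qed.

Lemma smooth_cutoff r : 0 < r -> smooth [set: V] (fun z => (cutoff r z)%:C).
Proof.
move=> r0.
rewrite (_ : (fun _ => _) = fun z => (bump r z)%:C *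
    ((bump r z)%:C + (psi 0 (sqnR z - r ^+ 2 / 4))%:C)^-1); last first.
  by apply/funext => z; rewrite rmorphM -rmorphD /=; congr (_ * _); exact: (fmorphV (real_complex R)).
apply: smoothM; [exact: openT|exact: smooth_bump|].
apply: smoothV; first exact: openT.
  by move=> z _; rewrite -rmorphD eq_complex /= eqxx andbT gt_eqF// cutoff_den_gt0.
apply: smoothD; [exact: openT|exact: smooth_bump|].
apply: (@smooth_psi 0 (fun z => sqnR z - r ^+ 2 / 4)).
rewrite (_ : (fun _ => _) = fun z => (sqnR z)%:C + (- (r ^+ 2 / 4))%:C).
  by apply: smoothD; [exact: openT|exact: smooth_sqnR|exact: (smooth_cst _ openT)].
by apply/funext => z; rewrite rmorphD.
Qed.

Lemma smooth_trunc_sqn r : 0 < r -> smooth [set: V] (fun z => (trunc_sqn r z)%:C).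
Proof.
move=> r0; rewrite (_ : (fun _ => _) = fun z => (cutoff r z)%:C * (sqnR z)%:C +
    (1 + (-1) * (cutoff r z)%:C)); last first.
  by apply/funext => z; rewrite rmorphD rmorphM rmorphB rmorph1 mulN1r.
apply: smoothD; first exact: openT.
  by apply: smoothM; [exact: openT|exact: smooth_cutoff|exact: smooth_sqnR].
apply: smoothD; [exact: openT|exact: (smooth_cst _ openT)|].
by apply: smoothM; [exact: openT|exact: (smooth_cst _ openT)|exact: smooth_cutoff].
Qed.

Lemma trunc_sqn_near r z : 0 < r -> sqnR z <= r ^+ 2 / 4 -> trunc_sqn r z = sqnR z.
Proof.
move=> r0 zr; have := cutoff_den_gt0 z r0.
rewrite /trunc_sqn /cutoff [psi 0 (_ - _ / 4)]psi0_eq0 ?subr_le0// addr0 => b0.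
by rewrite mulfV ?gt_eqF// mul1r subrr addr0.
Qed.

Lemma trunc_sqn_far r z : r ^+ 2 <= sqnR z -> trunc_sqn r z = 1.
Proof.
move=> zr; rewrite /trunc_sqn /cutoff /bump psi0_eq0 ?subr_le0//.
by rewrite !mul0r add0r subr0.
Qed.

Lemma trunc_sqn_gt0 r z : 0 < r -> z != 0 -> 0 < trunc_sqn r z.
Proof.
move=> r0 z0; have d0 := cutoff_den_gt0 z r0; have N0 := sqnR_gt0 z0.
have c0 : 0 <= cutoff r z by rewrite divr_ge0 ?psi0_ge0// ltW.
have c1 : cutoff r z <= 1 by rewrite ler_pdivrMr// mul1r lerDl psi0_ge0.
rewrite /trunc_sqn; set c := cutoff r z in c0 c1 *; set N := sqnR z in N0 *.
clearbody c N; have cN := mulr_ge0 c0 (ltW N0).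
have [cc|cc] := ltP c 1; first by lra.
have -> : c = 1 by lra.
by lra.
Qed.

End Cutoff.

Section SmoothGerms.
Context {R : realType} {n : nat}.
Local Notation C := R[i].
Local Notation V := 'rV[R[i]]_n.
Implicit Types (f g : V -> C) (z v : V).

Definition smooth_at f z : Prop := exists W, [/\ open W, W z & smooth W f].

Lemma smooth_at_cont f z : smooth_at f z -> {for z, continuous f}.
Proof. by move=> [W [oW Wz sf]]; exact: smooth_cont sf Wz. Qed.

Lemma snz_at_smooth f z : snz_at f z -> smooth_at f z.
Proof. by move=> [W [oW Wz [sf _]]]; exists W. Qed.

Lemma snz_atP f z : smooth_at f z -> f z != 0 -> snz_at f z.
Proof.
move=> sf f0; have ng : \forall w \near z, f w != 0 by exact: cvgr_neq0 (smooth_at_cont sf) f0.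
have [W [oW Wz s]] := sf; have [U [oU Uz HU]] := near_openP ng.
exists (W `&` U); split; [exact: openI|by []|split=> [|w [_ Uw]]; last exact: HU].
by apply: smooth_sub s; exact: subIsetl.
Qed.

Lemma smooth_at2 f g z : smooth_at f z -> smooth_at g z ->
  exists W, [/\ open W, W z, smooth W f & smooth W g].
Proof.
move=> [W [oW Wz sf]] [W' [oW' W'z sg]]; exists (W `&` W'); split; [exact: openI|by []| |].
  by apply: smooth_sub sf; exact: subIsetl.
by apply: smooth_sub sg; exact: subIsetr.
Qed.

Lemma smooth_atD f g z : smooth_at f z -> smooth_at g z -> smooth_at (fun w => f w + g w) z.
Proof.
by move=> sf sg; have [W [oW Wz s s']] := smooth_at2 sf sg; exists W; split=> //; exact: smoothD.
Qed.

Lemma smooth_atM f g z : smooth_at f z -> smooth_at g z -> smooth_at (fun w => f w * g w) z.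
Proof.
by move=> sf sg; have [W [oW Wz s s']] := smooth_at2 sf sg; exists W; split=> //; exact: smoothM.
Qed.

Lemma smooth_at_cst (k : C) z : smooth_at (fun=> k) z.
Proof. by exists setT; split=> //; [exact: openT|exact: (smooth_cst _ openT)]. Qed.

Lemma smooth_at_sum (I : Type) (r : seq I) (f : I -> V -> C) z :
  (forall i, smooth_at (f i) z) -> smooth_at (fun w => \sum_(i <- r) f i w) z.
Proof.
move=> h; elim: r => [|i r IH].
  rewrite (_ : (fun _ => _) = fun=> 0); first exact: smooth_at_cst.
  by apply/funext => w; rewrite big_nil.
rewrite (_ : (fun _ => _) = fun w => f i w + \sum_(i <- r) f i w); first exact: smooth_atD.
by apply/funext => w; rewrite big_cons.
Qed.

Lemma smooth_at_near f g z : (\forall w \near z, f w = g w) -> smooth_at f z -> smooth_at g z.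
Proof.
move=> /near_openP[U [oU Uz fg]] [W [oW Wz sf]].
exists (U `&` W); split; [exact: openI|by []|].
apply: smooth_ext (smooth_sub (@subIsetr _ U W) sf); first exact: openI.
by move=> w [Uw _]; exact: fg.
Qed.

Lemma smooth_at_hol f z : hol_at f z -> smooth_at f z.
Proof.
move=> /near_openP[U [oU Uz h]]; exists U; split=> //.
by apply: smooth_hol oU _ => w; exact: h.
Qed.

Lemma smooth_at_conj f z : smooth_at f z -> smooth_at (fun w => conjc (f w)) z.
Proof. by move=> [W [oW Wz sf]]; exists W; split=> //; exact: smooth_conj. Qed.

Lemma smooth_of_at (W : set V) f : (forall z, W z -> smooth_at f z) -> smooth W f.
Proof. by move=> h; apply: smooth_local => z /h[U [oU Uz s]]; exists U. Qed.

Lemma hol_at_cont {Y : normedModType C} (F : V -> Y) z : hol_at F z -> {for z, continuous F}.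
Proof. by move=> h; apply: differentiable_continuous; exact: hol_at_diff. Qed.

Lemma hol_atM f g z : hol_at f z -> hol_at g z -> hol_at (fun w => f w * g w) z.
Proof. by move=> hf hg; apply: filterS2 hf hg => w; exact: differentiable_mulf. Qed.

Lemma hol_at_cst (k : C) z : hol_at (fun=> k : C) z.
Proof. by apply: filterE => w; exact: differentiable_cst. Qed.

Lemma hol_atV f z : hol_at f z -> f z != 0 -> hol_at (fun w => (f w)^-1) z.
Proof.
move=> hf f0; have ng : \forall w \near z, f w != 0 by exact: cvgr_neq0 (hol_at_cont hf) f0.
by apply: filterS2 hf ng => w; exact: differentiable_invf.
Qed.

Lemma hol_atX f k z : hol_at f z -> hol_at (fun w => f w ^+ k) z.
Proof.
move=> hf; elim: k => [|k IH]; first exact: (hol_at_cst 1).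
rewrite (_ : (fun _ => _) = fun w => f w * f w ^+ k); first exact: hol_atM.
by apply/funext => w; rewrite exprS.
Qed.

Lemma hol_at_prod (I : Type) (r : seq I) (P : pred I) (f : I -> V -> C) z :
  (forall i, P i -> hol_at (f i) z) -> hol_at (fun w => \prod_(i <- r | P i) f i w) z.
Proof.
move=> h; elim: r => [|i r IH].
  rewrite (_ : (fun _ => _) = fun=> 1); first exact: hol_at_cst.
  by apply/funext => w; rewrite big_nil.
have [Pi|Pi] := boolP (P i).
  rewrite (_ : (fun _ => _) = fun w => f i w * \prod_(i <- r | P i) f i w).
    by apply: hol_atM => //; exact: h.
  by apply/funext => w; rewrite big_cons Pi.
rewrite (_ : (fun _ => _) = fun w => \prod_(i <- r | P i) f i w)//.
by apply/funext => w; rewrite big_cons (negbTE Pi).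
Qed.

Lemma hol_at_near {Y : normedModType C} (F G : V -> Y) z :
  (\forall w \near z, F w = G w) -> hol_at F z -> hol_at G z.
Proof.
move=> /near_openP[U [oU Uz FG]] hF.
have nU : \forall w \near z, U w by exact: open_nbhs_nbhs.
apply: filterS2 nU hF => w Uw dF.
by apply: near_eq_differentiable dF; apply: (near_open oU Uw).
Qed.

Lemma levi_at0 f z : snz_at f z -> levi f z 0 = 0.
Proof.
move=> [W [oW Wz sf]].
by rewrite /levi scaler0 (log_hess0 oW 0 sf Wz) addr0.
Qed.

End SmoothGerms.

Lemma smooth_at_comp {R : realType} {n m : nat} (F : 'rV[R[i]]_n -> 'rV[R[i]]_m)
    (f : 'rV[R[i]]_m -> R[i]) (z : 'rV[R[i]]_n) :
  hol_at F z -> smooth_at f (F z) -> smooth_at (f \o F) z.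
Proof.
move=> hF [W' [oW' W'z s]].
have nF : \forall w \near z, W' (F w).
  by have cF := hol_at_cont hF; apply: (cF W'); exact: open_nbhs_nbhs.
have [W [oW Wz HW]] := near_openP (filterI hF nF).
have h1 : holomorphic W F by move=> w Ww; exact: (HW w Ww).1.
have h2 w : W w -> W' (F w) by move=> Ww; exact: (HW w Ww).2.
by exists W; split; [exact: oW|exact: Wz|exact: (smooth_comp oW oW' h1 h2 s)].
Qed.

(** Since [G \o F] is the identity near [z], a vector [v] killed by the differential would make t v
    an o(t). *)
Lemma diff_injective {R : realType} {n m : nat} (F : 'rV[R[i]]_n -> 'rV[R[i]]_m)
    (G : 'rV[R[i]]_m -> 'rV[R[i]]_n) (z v : 'rV[R[i]]_n) :
  differentiable F z -> differentiable G (F z) -> (\forall w \near z, G (F w) = w) ->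
  'd F z v = 0 -> v = 0.
Proof.
move=> dF dG GF Fv0.
have dC := differentiable_comp dF dG.
apply: nrm_eq0; apply/le_anti; rewrite nrm_ge0 andbT.
apply/ler_addgt0Pr => e e0; rewrite add0r.
have [d d0 H] := diff_nrm dC (divr_gt0 e0 (ltr_pwDr ltr01 (nrm_ge0 v))).
have /near_nrmP[d' d'0 H'] := GF.
have GFz : G (F z) = z by exact: nbhs_singleton GF.
pose t := Num.min d d' / (2 * (nrm v + 1)).
have v0 := nrm_ge0 v; have v1 : 0 < nrm v + 1 by lra.
have m0 : 0 < Num.min d d' by rewrite lt_min d0.
have t0 : 0 < t by rewrite divr_gt0// mulr_gt0.
have tv : nrm (t%:C *: v) < Num.min d d'.
  rewrite nrmZ nrmR ger0_norm ?(ltW t0)// /t mulrAC ltr_pdivrMr ?mulr_gt0//.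
  rewrite ltr_pM2l//; lra.
move: tv; rewrite lt_min => /andP[tv1 tv2].
have := H _ tv1; rewrite /= (H' _ tv2) GFz.
have -> : 'd (G \o F) z (t%:C *: v) = 0.
  by rewrite linearZ /= diff_comp//= Fv0 linear0 scaler0.
rewrite subr0 [z + _]addrC addrK nrmZ nrmR ger0_norm ?(ltW t0)// mulrCA ler_pM2l//.
move=> h; apply: le_trans h _; rewrite mulrAC ler_pdivrMr// ler_pM2l//; lra.
Qed.

(** * Germs in charts *)

Section Charts.
Context {R : realType}.
Local Notation C := R[i].

Lemma near_param {n} {T : topologicalType} (c : chart R n T) x (P : T -> Prop) :
  dom c x -> (\forall y \near x, P y) ->
  \forall z \near coord c x, [/\ dom c (param c z), coord c (param c z) = z & P (param c z)].
Proof.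
move=> cx Px; have icx : (coord c @` dom c) (coord c x) by exists x.
have n1 : \forall z \near coord c x, P (param c z).
  have cp := continuous_param icx.
  by apply: (cp P); rewrite coordK.
have n2 : \forall z \near coord c x, (coord c @` dom c) z.
  by apply: open_nbhs_nbhs; split=> //; exact: open_coord_dom.
by apply: filterS2 n1 n2 => z Pz [y cy yz]; rewrite -yz coordK in Pz *.
Qed.

Lemma near_coord {n} {T : topologicalType} (c : chart R n T) x (P : 'rV[R[i]]_n -> Prop) :
  dom c x -> (\forall z \near coord c x, P z) -> \forall y \near x, dom c y /\ P (coord c y).
Proof.
move=> cx Px; apply: filterI; first by apply: open_nbhs_nbhs; split=> //; exact: open_dom.
exact: (continuous_coord cx Px).
Qed.

(** Read in any chart, in the atlas or not, so that the charts of the blow up model can be used as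
    well. *)
Definition smooth_in {n} {T : topologicalType} (c : chart R n T) (f : T -> C) x : Prop :=
  smooth_at (f \o param c) (coord c x).

Definition snz_in {n} {T : topologicalType} (c : chart R n T) (f : T -> C) x : Prop :=
  snz_at (f \o param c) (coord c x).

Definition levi_in {n} {T : topologicalType} (c : chart R n T) (f : T -> C) x v : C :=
  levi (f \o param c) (coord c x) v.

Lemma snz_in_near {n} {T : topologicalType} (c : chart R n T) (f g : T -> C) x :
  dom c x -> (\forall y \near x, f y = g y) -> snz_in c f x -> snz_in c g x.
Proof.
move=> cx fg; apply: snz_at_near.
by apply: filterS (near_param cx fg) => z [].
Qed.

Lemma smooth_in_near {n} {T : topologicalType} (c : chart R n T) (f g : T -> C) x :
  dom c x -> (\forall y \near x, f y = g y) -> smooth_in c f x -> smooth_in c g x.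
Proof.
move=> cx fg; apply: smooth_at_near.
by apply: filterS (near_param cx fg) => z [].
Qed.

Lemma levi_in_near {n} {T : topologicalType} (c : chart R n T) (f g : T -> C) x v :
  dom c x -> (\forall y \near x, f y = g y) -> snz_in c f x -> levi_in c g x v = levi_in c f x v.
Proof.
move=> cx fg sf; apply: levi_at_near sf.
by apply: filterS (near_param cx fg) => z [].
Qed.

Section Pull.
Context {n m : nat} {T1 T2 : topologicalType}.
Variables (c : chart R n T1) (d : chart R m T2) (q : T1 -> T2) (y : T1).
Hypotheses (cy : dom c y) (dq : dom d (q y)) (cq : {for y, continuous q}).
Let F := coord d \o q \o param c.
Hypothesis hF : hol_at F (coord c y).

Let FE : F (coord c y) = coord d (q y).
Proof. by rewrite /F /= coordK. Qed.

Let pull_near (f : T2 -> C) : \forall z \near coord c y,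
  ((f \o param d) \o F) z = ((f \o q) \o param c) z.
Proof.
have nd : \forall y' \near y, dom d (q y').
  have h : q @ y --> q y := cq.
  apply: (h (dom d)); apply: open_nbhs_nbhs; split=> //; exact: open_dom.
by apply: filterS (near_param cy nd) => z [cz _ dz]; rewrite /F /= coordK.
Qed.

Lemma smooth_in_pull (f : T2 -> C) : smooth_in d f (q y) -> smooth_in c (f \o q) y.
Proof.
move=> sf; apply: smooth_at_near (pull_near f) _.
by apply: smooth_at_comp => //; rewrite FE.
Qed.

Lemma snz_in_pull (f : T2 -> C) : snz_in d f (q y) -> snz_in c (f \o q) y.
Proof.
move=> sf; apply: snz_at_near (pull_near f) _.
by apply: snz_at_comp => //; rewrite FE.
Qed.

Lemma levi_in_pull (f : T2 -> C) v : snz_in d f (q y) ->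
  levi_in c (f \o q) y v = levi_in d f (q y) ('d F (coord c y) v).
Proof.
move=> sf; have sf' : snz_at (f \o param d) (F (coord c y)) by rewrite FE.
have E1 : levi_in c (f \o q) y v = levi ((f \o param d) \o F) (coord c y) v.
  exact: (levi_at_near v (pull_near f) (snz_at_comp hF sf')).
by apply: etrans E1 _; apply: etrans (levi_at_comp hF sf' v) _; rewrite FE.
Qed.

End Pull.

Section Transition.
Context {n : nat} {T : topologicalType}.
Variables (c d : chart R n T) (x : T).
Hypotheses (cx : dom c x) (dx : dom d x).

Lemma hol_at_transition : holomorphic_transition c d ->
  hol_at (coord d \o param c) (coord c x).
Proof.
move=> h; have o := open_coord_image (c := c) (open_dom d); rewrite setIC in o.
have i : (coord c @` (dom c `&` dom d)) (coord c x) by exists x.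
by apply: (near_open o i) => w; exact: h.
Qed.

Lemma transition_diff_neq0 v : holomorphic_transition c d -> holomorphic_transition d c ->
  v != 0 -> 'd (coord d \o param c) (coord c x) v != 0.
Proof.
move=> h1 h2; apply: contra_neq.
have E : (coord d \o param c) (coord c x) = coord d x by rewrite /= coordK.
have nd : \forall y \near x, dom d y by apply: open_nbhs_nbhs; split=> //; exact: open_dom.
apply: (@diff_injective _ _ _ _ (coord c \o param d)).
- by apply: hol_at_diff; exact: hol_at_transition.
- rewrite E; have o := open_coord_image (c := d) (open_dom c); rewrite setIC in o.
  by apply: h2; exists x.
- apply: filterS (near_param cx nd) => z [cz cE dz].
  by rewrite /= coordK.
Qed.

Lemma smooth_in_transition f : holomorphic_transition c d -> smooth_in d f x -> smooth_in c f x.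
Proof. by move=> h; apply: (@smooth_in_pull _ _ _ _ c d id) => //; exact: hol_at_transition. Qed.

End Transition.
End Charts.

(** * Extension of functions from a chart, and finite covers *)

Section ClosedBall.
Context {R : realType} {n : nat}.
Local Notation C := R[i].
Local Notation V := 'rV[R[i]]_n.

Let square (r : R) : set C := [set a | `|complex.Re a| <= r /\ `|complex.Im a| <= r].

Let square_compact r : compact (square r).
Proof.
pose f (ab : R * R) : C := ab.1 +i* ab.2.
rewrite (_ : square r = f @` (`[- r, r] `*` `[- r, r])).
  apply: continuous_compact; last by apply: compact_setX; exact: segment_compact.
  apply: continuous_subspaceT => -[a b].
  apply/cvgrPdist_lt => e e0; have re : 0 < complex.Re e.
    by move: e0; rewrite ltcE => /andP[].
  have ee : e = (complex.Re e)%:C.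
    by have := ger0_Im (ltW e0); case: (e) => x y /= ->.
  have h : 0 < complex.Re e / 2 by rewrite divr_gt0.
  have n1 : \forall x \near a & y \near b, `|a - x| < complex.Re e / 2 /\ `|b - y| < complex.Re e / 2.
    exists (ball a (complex.Re e / 2), ball b (complex.Re e / 2)) => /=.
      by split; exact: nbhsx_ballx.
    by move=> [x y] [].
  apply: filterS n1 => -[x y] [hx hy].
  rewrite nrmE ee ltcR; apply: le_lt_trans (nrm_ReIm _) _.
  rewrite cReD cImD cReN cImN /= [ltRHS]splitr; exact: ltrD.
apply/seteqP; split=> [[a b] /= [ha hb]|_ [[a b] [/= ha hb] <-]].
  by exists (a, b) => //=; rewrite !in_itv /= -!ler_norml.
by move: ha hb; rewrite !in_itv /= -!ler_norml.
Qed.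

Lemma sqnR_ball_compact z0 (r : R) : 0 <= r -> compact [set z : V | sqnR (z - z0) <= r ^+ 2].
Proof.
move=> r0; pose M := r + nrm z0.
have cB : compact [set z : V | forall j, square M (z ord0 j)].
  exact: (@rV_compact C n (fun=> square M) (fun=> @square_compact M)).
have cl : closed [set z : V | sqnR (z - z0) <= r ^+ 2].
  rewrite (_ : [set z | _] = (fun z : V => sqnR (z - z0)) @^-1` [set x | x <= r ^+ 2]); last by [].
  apply: closed_comp; last exact: closed_le.
  move=> z _; apply: (@continuous_comp _ _ _ (fun z : V => z - z0)); last exact: continuous_sqnR.
  by apply: continuousB; [exact: cvg_id|exact: cst_continuous].
apply: (@subclosed_compact _ _ _ cl cB) => z /= hz j.
have hz' : nrm (z - z0) <= r by exact: nrm_le_sqnR.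
have hj : nrm (z 0 j : C) <= M.
  by apply: le_trans (nrm_coord z j) _; apply: le_trans (nrm_leD z z0) _; rewrite addrC lerD2r.
by split; [apply: le_trans (Re_nrm _) hj|apply: le_trans (Im_nrm _) hj].
Qed.

End ClosedBall.

Section ChartExtension.
Context {R : realType} {n : nat} {T : topologicalType}.
Local Notation C := R[i].
Local Notation V := 'rV[R[i]]_n.
Hypothesis hT : hausdorff_space T.
Variables (c : chart R n T) (x : T).
Hypothesis cx : dom c x.

Definition chart_ball (r : R) : set T := [set y | dom c y /\ sqnR (coord c y - coord c x) <= r ^+ 2].

Definition chart_ext (theta : V -> R) (k : R) y : R :=
  if `[< dom c y >] then theta (coord c y - coord c x) else k.

Lemma chart_extE theta k y : dom c y -> chart_ext theta k y = theta (coord c y - coord c x).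
Proof. by move=> cy; rewrite /chart_ext asboolT. Qed.

(** A set closed in the domain of a chart need not be closed in [T]. For small radii the ball is the
    image of a compact set under [param], hence compact, hence closed as [T] is Hausdorff. *)
Lemma closed_chart_ball (U : set T) : open U -> U x ->
  exists2 r0 : R, 0 < r0 & forall r, 0 <= r -> r <= r0 -> closed (chart_ball r) /\ chart_ball r `<=` U.
Proof.
move=> oU Ux; have nU : \forall y \near x, U y by exact: open_nbhs_nbhs.
have /near_nrmP[d d0 H] := near_param cx nU.
exists (d / 2); first by rewrite divr_gt0.
move=> r r0 rd; have rd' : r < d by apply: le_lt_trans rd _; rewrite ltr_pdivrMr// ltr_pMr// ltr1n.
have ball z : sqnR (z - coord c x) <= r ^+ 2 ->
    [/\ dom c (param c z), coord c (param c z) = z & U (param c z)].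
  move=> hz; have E : coord c x + (z - coord c x) = z by rewrite addrC subrK.
  have := H (z - coord c x); rewrite E; apply.
  by apply: le_lt_trans rd'; exact: nrm_le_sqnR.
split; last first.
  by move=> y [cy /ball[_ _]]; rewrite coordK.
rewrite (_ : chart_ball r = param c @` [set z | sqnR (z - coord c x) <= r ^+ 2]).
  apply: (compact_closed hT); apply: continuous_compact; last exact: sqnR_ball_compact.
  apply: continuous_in_subspaceT => z; rewrite inE /= => /ball[cz zE _].
  by apply: continuous_param; exists (param c z).
apply/seteqP; split=> [y [cy hy]|_ [z /= hz <-]].
  by exists (coord c y) => //; rewrite coordK.
by have [cz zE _] := ball _ hz; split=> //; rewrite zE.
Qed.

Section Ext.
Variables (r : R) (theta : V -> R) (k : R).
Hypothesis far : forall z, r ^+ 2 <= sqnR z -> theta z = k.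

Lemma chart_ext_far y : ~ chart_ball r y -> chart_ext theta k y = k.
Proof.
rewrite /chart_ext; case: asboolP => // cy h; apply: far.
by rewrite leNgt; apply/negP => /ltW h'; exact: h.
Qed.

(** The domain of [c], where the function is [theta] in coordinates, and the complement of the
    closed ball, where it is constant, form an open cover. *)
Lemma smooth_chart_ext (d : chart R n T) y : closed (chart_ball r) ->
  smooth [set: V] (fun z => (theta z)%:C) ->
  (dom c y -> holomorphic_transition d c) -> dom d y ->
  smooth_in d (fun y => (chart_ext theta k y)%:C) y.
Proof.
move=> clB st hdc dy.
have [cy|cy] := pselect (dom c y); last first.
  apply: (smooth_in_near dy) (smooth_at_cst k%:C _).
  have : \forall y' \near y, (~` chart_ball r) y'.
    by apply: open_nbhs_nbhs; split; [exact: closed_openC|case].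
  by apply: filterS => y' h /=; rewrite chart_ext_far.
apply: (smooth_in_transition dy cy (hdc cy)).
have sc : smooth_in c (fun y' => (theta (coord c y' - coord c x))%:C) y.
  apply: (@smooth_at_near _ _ (fun z => (theta (z - coord c x))%:C)).
    apply: filterS (near_param cy (filterT : \forall y' \near y, True)) => z [_ zE _].
    by rewrite /= zE.
  have h : hol_at (fun z => z - coord c x) (coord c y).
    by apply: filterE => z; apply: differentiableB.
  apply: (smooth_at_comp (f := fun z => (theta z)%:C) h).
  by exists setT; split=> //; exact: openT.
apply: smooth_in_near sc => //.
have : \forall y' \near y, dom c y' by apply: open_nbhs_nbhs; split=> //; exact: open_dom.
by apply: filterS => y' cy'; rewrite chart_extE.
Qed.

End Ext.
End ChartExtension.

(** The near-covering form of compactness is applied to the filter generated, for each finite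
    sequence, by all sequences containing its points. *)
Lemma finite_subcover {T : topologicalType} (P : T -> T -> Prop) : compact [set: T] ->
  (forall x, \forall y \near x, P x y) -> exists D : seq T, forall y, exists2 x, x \in D & P x y.
Proof.
move=> /compact_near_coveringP cT nP.
pose F : set_system (seq T) := [set S : set (seq T) | exists s0 : seq T, forall s : seq T, {subset s0 <= s} -> S s].
have FF : Filter F.
  split=> [|A B [s hs] [t ht]|A B AB [s hs]]; first by exists [::].
    exists (s ++ t) => u su; split; [apply: hs|apply: ht] => x xs; apply: su.
      by rewrite mem_cat xs.
    by rewrite mem_cat xs orbT.
  by exists s => t /hs; exact: AB.
have [x _|s0 hs0] := cT _ F (fun s y => exists2 x, x \in s & P x y) FF.
  exists ([set y | P x y], [set s : seq T | x \in s]) => /=; last by move=> [y s] [/= Py xs]; exists x.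
  by split; [exact: nP|exists [:: x] => s; apply; rewrite inE].
by exists s0 => y; exact: (hs0 s0).
Qed.

Section HolomorphicGerms.
Context {R : realType}.
Local Notation C := R[i].

Definition hol_in {n} {T : topologicalType} (c : chart R n T) (f : T -> C) x : Prop :=
  hol_at (f \o param c) (coord c x).

Lemma near_dom {n} {T : topologicalType} (c : chart R n T) x : dom c x -> \forall y \near x, dom c y.
Proof. by move=> cx; apply: open_nbhs_nbhs; split=> //; exact: open_dom. Qed.

Section OneChart.
Context {n : nat} {T : topologicalType} (c : chart R n T) (x : T).
Hypothesis cx : dom c x.
Implicit Types f g : T -> C.

Lemma at_coord f : (f \o param c) (coord c x) = f x.
Proof. by rewrite /= coordK. Qed.

Lemma smooth_in_abs2 f : hol_in c f x -> smooth_in c (fun y => (nrm (f y) ^+ 2)%:C) x.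
Proof.
move=> hf.
rewrite /smooth_in (_ : _ \o _ = fun z => (f \o param c) z * conjc ((f \o param c) z)).
  by apply: smooth_atM; [|apply: smooth_at_conj]; exact: smooth_at_hol.
by apply/funext => z; rewrite conjc_norm2.
Qed.

Lemma snz_in_abs2 f : hol_in c f x -> f x != 0 -> snz_in c (fun y => (nrm (f y) ^+ 2)%:C) x.
Proof.
move=> hf f0.
rewrite /snz_in (_ : _ \o _ = fun z => (f \o param c) z * conjc ((f \o param c) z)).
  by apply: snz_at_abs2 => //; rewrite at_coord.
by apply/funext => z; rewrite conjc_norm2.
Qed.

Lemma levi_in_abs2 f v : hol_in c f x -> f x != 0 -> levi_in c (fun y => (nrm (f y) ^+ 2)%:C) x v = 0.
Proof.
move=> hf f0.
rewrite /levi_in (_ : _ \o _ = fun z => (f \o param c) z * conjc ((f \o param c) z)).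
  by apply: levi_at_abs2 => //; rewrite at_coord.
by apply/funext => z; rewrite conjc_norm2.
Qed.

Lemma snz_inM f g : snz_in c f x -> snz_in c g x -> snz_in c (fun y => f y * g y) x.
Proof. exact: snz_atM. Qed.

Lemma levi_inM f g v : snz_in c f x -> snz_in c g x ->
  levi_in c (fun y => f y * g y) x v = levi_in c f x v + levi_in c g x v.
Proof. exact: levi_atM. Qed.

Lemma snz_inX f k : snz_in c f x -> snz_in c (fun y => f y ^+ k) x.
Proof. exact: snz_atX. Qed.

Lemma levi_inX f k v : snz_in c f x -> levi_in c (fun y => f y ^+ k) x v = k%:R * levi_in c f x v.
Proof. exact: levi_atX. Qed.

Lemma snz_inV f : snz_in c f x -> snz_in c (fun y => (f y)^-1) x.
Proof. exact: snz_atV. Qed.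

Lemma levi_inV f v : snz_in c f x -> levi_in c (fun y => (f y)^-1) x v = - levi_in c f x v.
Proof. exact: levi_atV. Qed.

Lemma smooth_in_cont f : smooth_in c f x -> {for x, continuous f}.
Proof.
move=> /smooth_at_cont cf P; rewrite -(at_coord f) => Pf.
have nP : \forall y \near x, dom c y /\ P ((f \o param c) (coord c y)).
  exact: (near_coord cx (cf P Pf)).
by move: nP; apply: filterS => y [cy]; rewrite /= coordK.
Qed.

End OneChart.

Lemma hol_in_pull {n m} {T1 T2 : topologicalType} (c : chart R n T1) (d : chart R m T2)
    (q : T1 -> T2) y (f : T2 -> C) : dom c y -> dom d (q y) -> {for y, continuous q} ->
  hol_at (coord d \o q \o param c) (coord c y) -> hol_in d f (q y) -> hol_in c (f \o q) y.
Proof.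
move=> cy dq cq hF hf.
have h : q @ y --> q y := cq.
have nd : \forall y' \near y, dom d (q y') by apply: (h (dom d)); exact: near_dom.
apply: (@hol_at_near _ _ _ ((f \o param d) \o (coord d \o q \o param c))).
  by apply: filterS (near_param cy nd) => z [cz _ dz]; rewrite /= coordK.
have hf' : hol_at (f \o param d) ((coord d \o q \o param c) (coord c y)) by rewrite /= coordK.
exact: (hol_at_comp hF hf').
Qed.

Lemma hol_in_transition {n} {T : topologicalType} (c d : chart R n T) x f :
  dom c x -> dom d x -> holomorphic_transition c d -> hol_in d f x -> hol_in c f x.
Proof.
by move=> cx dx h; apply: (@hol_in_pull _ _ _ _ c d id) => //; exact: hol_at_transition.
Qed.

Lemma hol_in_fun {n} (M : cmanifold R n) (A : set M) (f : M -> C) (c : chart R n M) x :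
  open A -> A x -> atlas M c -> dom c x -> holomorphic_fun A f -> hol_in c f x.
Proof.
move=> oA Ax Mc cx hf; have i : (coord c @` (A `&` dom c)) (coord c x) by exists x.
by apply: (near_open (open_coord_image (c := c) oA) i) => z; exact: hf.
Qed.

End HolomorphicGerms.

(** * Hermitian metrics *)

Section Metrics.
Context {R : realType} {n : nat} {M : cmanifold R n}.
Local Notation C := R[i].
Local Notation V := 'rV[R[i]]_n.

Lemma trans_hol_in (L : line_bundle M) a b x c : atlas M c -> dom c x ->
  lb_open a x -> lb_open b x -> hol_in c (@lb_trans _ _ _ L a b) x.
Proof.
move=> Mc cx ax bx.
have oab : open (lb_open a `&` lb_open b) by apply: openI; exact: open_lb_open.
exact: (hol_in_fun oab (conj ax bx) Mc cx (@lb_trans_holomorphic _ _ _ L a b)).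
Qed.

Section OneMetric.
Variables (L : line_bundle M) (h : lb_index L -> M -> R).
Hypothesis hh : hermitian_metric h.

Lemma metric_transE a b x : lb_open a x -> lb_open b x ->
  h b x = nrm (lb_trans a b x) ^+ 2 * h a x.
Proof.
move=> ax bx; have [_ _ /(_ a b x ax bx)] := hh.
by rewrite nrmE -rmorphXn -rmorphM => /complexI.
Qed.

Lemma metric_snz a c x : atlas M c -> dom c x -> lb_open a x ->
  snz_in c (fun y => (h a y)%:C) x.
Proof.
move=> Mc cx ax; have [sh ph _] := hh.
exists (coord c @` (lb_open a `&` dom c)); split; [|by exists x|split].
- by apply: open_coord_image; exact: open_lb_open.
- exact: sh.
- move=> _ [y [ay cy] <-]; rewrite /= coordK// eq_complex /= eqxx andbT gt_eqF//; exact: ph.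
Qed.

(** Changing the frame multiplies the metric by |g|^2, whose logarithm is pluriharmonic. *)
Lemma metric_levi_trans a b c x v : atlas M c -> dom c x -> lb_open a x -> lb_open b x ->
  levi_in c (fun y => (h b y)%:C) x v = levi_in c (fun y => (h a y)%:C) x v.
Proof.
move=> Mc cx ax bx.
have g0 : lb_trans a b x != 0 by exact: lb_trans_neq0.
have hg := trans_hol_in Mc cx ax bx.
have s1 := snz_in_abs2 cx hg g0; have s2 := metric_snz Mc cx ax.
have E : \forall y \near x, (nrm (lb_trans a b y) ^+ 2)%:C * (h a y)%:C = (h b y)%:C.
  have : \forall y \near x, (lb_open a `&` lb_open b) y.
    by apply: open_nbhs_nbhs; split=> //; apply: openI; exact: open_lb_open.
  by apply: filterS => y [ay bY]; rewrite -rmorphM -metric_transE.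
rewrite (levi_in_near v cx E (snz_inM s1 s2)) (levi_inM v s1 s2).
by rewrite (levi_in_abs2 cx v hg g0) add0r.
Qed.

Lemma metric_positive :
  (forall a c x v, atlas M c -> dom c x -> lb_open a x -> v != 0 ->
     levi_in c (fun y => (h a y)%:C) x v < 0) -> positive L.
Proof.
move=> neg; exists h => // a c Mc W; have [sh ph _] := hh.
have oW : open W by apply: open_coord_image; exact: open_lb_open.
have sH : smooth W (fun z => ((h a \o param c) z)%:C) := sh a c Mc.
have pH z : W z -> 0 < (h a \o param c) z.
  by move=> [y [ay cy] <-]; rewrite /= coordK//; exact: ph.
exists (chern1 (h a \o param c)); first exact: chern1_form.
apply/(positive_formP oW sH pH (chern1_form oW sH pH)) => _ v [y [ay cy] <-] v0.
exact: (neg a c y v).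
Qed.

End OneMetric.

Lemma positive_metric (L : line_bundle M) : positive L ->
  exists h : lb_index L -> M -> R, hermitian_metric h /\
    forall a c x v, atlas M c -> dom c x -> lb_open a x -> v != 0 ->
     levi_in c (fun y => (h a y)%:C) x v < 0.
Proof.
move=> [h hh H]; exists h; split=> // a c x v Mc cx ax v0.
have [theta ct pt] := H a c Mc.
pose W := coord c @` (lb_open a `&` dom c); have [sh ph _] := hh.
have oW : open W by apply: open_coord_image; exact: open_lb_open.
have sH : smooth W (fun z => ((h a \o param c) z)%:C) := sh a c Mc.
have pH z : W z -> 0 < (h a \o param c) z.
  by move=> [y [ay cy] <-]; rewrite /= coordK//; exact: ph.
have Wx : W (coord c x) by exists x.
exact: ((positive_formP oW sH pH ct).1 pt (coord c x) v Wx v0).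
Qed.

Lemma local_bump (x : M) (U : set M) : open U -> U x -> exists rho : M -> R,
  [/\ forall c y, atlas M c -> dom c y -> smooth_in c (fun y => (rho y)%:C) y,
      forall y, 0 <= rho y, \forall y \near x, 0 < rho y &
      exists K, [/\ closed K, K `<=` U & forall y, ~ K y -> rho y = 0]].
Proof.
move=> oU Ux; have [c Mc cx] := atlas_cover x.
have [r r0 /(_ r (ltW r0) (lexx r))[cl KU]] := closed_chart_ball (@hausdorff_points _ _ M) cx oU Ux.
have far (z : V) : r ^+ 2 <= sqnR z -> bump r z = 0 :> R by move=> h; apply: psi0_eq0; rewrite subr_le0.
exists (chart_ext c x (bump r) 0); split.
- move=> d y Md dy; have tr : dom c y -> holomorphic_transition d c by move=> _; exact: atlas_holomorphic.
  exact: (smooth_chart_ext (x := x) far cl (smooth_bump r) tr dy).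
- by move=> y; rewrite /chart_ext; case: asboolP => // _; exact: psi0_ge0.
- have n1 : \forall z \near coord c x, sqnR (z - coord c x) < r ^+ 2.
    have cs : {for coord c x, continuous (fun z : V => sqnR (z - coord c x))}.
      apply: (@continuous_comp _ _ _ (fun z : V => z - coord c x)); last exact: continuous_sqnR.
      by apply: continuousB; [exact: cvg_id|exact: cst_continuous].
    have /cvgr_lt := cs; apply; by rewrite subrr sqnR0 exprn_gt0.
  apply: filterS (near_coord cx n1) => y [cy h].
  by rewrite chart_extE// psi0_gt0// subr_gt0.
- by exists (chart_ball c x r); split=> // y; exact: chart_ext_far.
Qed.

Lemma smooth_in_bumpM (c : chart R n M) x (rho : M -> R) (f : M -> C) (U K : set M) :
  dom c x -> smooth_in c (fun y => (rho y)%:C) x -> closed K -> K `<=` U ->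
  (forall y, ~ K y -> rho y = 0) -> (U x -> smooth_in c f x) ->
  smooth_in c (fun y => (rho y)%:C * f y) x.
Proof.
move=> cx sr cK KU r0 sf; have [Kx|Kx] := pselect (K x).
  by apply: smooth_atM => //; exact: sf (KU _ Kx).
have s0 : smooth_in c (fun=> 0) x by exact: smooth_at_cst.
apply: (smooth_in_near cx) s0.
have : \forall y' \near x, (~` K) y' by apply: open_nbhs_nbhs; split=> //; exact: closed_openC.
by apply: filterS => y' h /=; rewrite r0// mul0r.
Qed.

(** In the frame a the metric is the sum of [rho x] |g_{b(x) a}|^2 over finitely many points x: the
    trivial metrics of the frames b(x), cut off by bumps supported where these frames live. The
    cocycle rule gives the transformation law; positivity holds because some bump is positive at
    each point. *)
Lemma hermitian_metric_exists (K : line_bundle M) : compact [set: M] ->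
  exists h : lb_index K -> M -> R, hermitian_metric h.
Proof.
move=> cM.
have [b Hb] := choice (@lb_cover _ _ _ K).
have [rho Hrho] := choice (fun x => local_bump (@open_lb_open _ _ _ K (b x)) (Hb x)).
have [D HD] := finite_subcover cM (fun x => let: And4 _ _ h _ := Hrho x in h).
pose g a y := fun x => rho x y * nrm (lb_trans (b x) a y) ^+ 2 : R.
exists (fun a y => \sum_(x <- D) g a y x); split.
- move=> a c Mc; apply: smooth_of_at => _ [y [ay cy] <-].
  rewrite -[smooth_at _ _]/(smooth_in c (fun y => (\sum_(x <- D) g a y x)%:C) y).
  rewrite (_ : (fun y => _) = fun y => \sum_(x <- D) (rho x y)%:C * (nrm (lb_trans (b x) a y) ^+ 2)%:C).
    apply: (@smooth_at_sum _ _ _ _ (fun x => (fun y => (rho x y)%:C * (nrm (lb_trans (b x) a y) ^+ 2)%:C) \o param c)).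
    move=> x; have [sr _ _ [Kx [cK KU K0]]] := Hrho x.
    apply: (smooth_in_bumpM cy (sr c y Mc cy) cK KU K0) => bxy.
    by apply: smooth_in_abs2; exact: trans_hol_in.
  by apply/funext => y'; rewrite rmorph_sum; apply: eq_bigr => x _; rewrite /g rmorphM.
- move=> a y ay; have [x Dx rx] := HD y.
  have [_ rge _ [Kx [_ KU K0]]] := Hrho x.
  have bxy : lb_open (b x) y.
    by apply: contrapT => h; move: rx; rewrite K0 ?ltxx// => /KU.
  have gge x' : 0 <= g a y x'.
    by have [_ r _ _] := Hrho x'; rewrite mulr_ge0 ?exprn_ge0 ?nrm_ge0.
  rewrite (big_rem x) //=; apply: ltr_pwDl; last exact: sumr_ge0.
  rewrite mulr_gt0// exprn_gt0// lt_def nrm_ge0 andbT.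
  apply: contra_neq (lb_trans_neq0 bxy ay); exact: nrm_eq0.
- move=> a a' y ay a'y; rewrite nrmE -rmorphXn -rmorphM mulr_sumr; congr (_%:C).
  apply: eq_bigr => x _; have [_ _ _ [Kx [_ KU K0]]] := Hrho x.
  rewrite /g; have [bxy|bxy] := pselect (lb_open (b x) y).
    by rewrite -(lb_cocycle bxy ay a'y) nrmM exprMn mulrA mulrC.
  by rewrite K0 ?mul0r ?mulr0// => /KU.
Qed.

End Metrics.

Lemma snz_in_prod {R : realType} {n : nat} {T : topologicalType} (c : chart R n T) (I : Type)
    (s : seq I) (P : pred I) (f : I -> T -> R[i]) y :
  (forall i, P i -> snz_in c (f i) y) -> snz_in c (fun y' => \prod_(i <- s | P i) f i y') y.
Proof.
move=> hf; elim: s => [|i s IH].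
  rewrite (_ : (fun _ => _) = fun=> 1); first exact: (snz_at_cst _ (oner_neq0 _)).
  by apply/funext => w; rewrite big_nil.
have [Pi|Pi] := boolP (P i).
  rewrite (_ : (fun _ => _) = fun w => f i w * \prod_(i <- s | P i) f i w).
    by apply: snz_inM => //; exact: hf.
  by apply/funext => w; rewrite big_cons Pi.
rewrite (_ : (fun _ => _) = fun w => \prod_(i <- s | P i) f i w)//.
by apply/funext => w; rewrite big_cons (negbTE Pi).
Qed.

(** * Curvature on the base *)

Section Base.
Context {R : realType} {n : nat} {M : cmanifold R n}.
Local Notation C := R[i].
Local Notation V := 'rV[R[i]]_n.
Context {l : nat}.
Variables (x : 'I_l -> M) (c : 'I_l -> chart R n M) (rad : 'I_l -> R) (m : 'I_l -> nat).
Hypotheses (hc : forall i, holomorphic_chart (c i)) (cx : forall i, dom (c i) (x i))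
  (c0 : forall i, coord (c i) (x i) = 0) (cxj : forall i j, j != i -> ~ dom (c i) (x j))
  (rad0 : forall i, 0 < rad i) (clB : forall i, closed (chart_ball (c i) (x i) (rad i))).

(** The function S_i, defined on all of M and zero exactly at [x i]. *)
Definition dist2 i : M -> R := chart_ext (c i) (x i) (trunc_sqn (rad i)) 1.

(* With [o = Some i] the factor singular at [x i] is left out; [admissible o y] says that the
   product is then smooth and positive at [y]. *)
Definition rest o y : R := \prod_(i | Some i != o) (dist2 i y)^-1 ^+ m i.

Definition admissible o y : Prop :=
  if o is Some i then dom (c i) y /\ sqnR (coord (c i) y) < rad i ^+ 2 / 4 else ~ range x y.

Lemma dist2_near i y : dom (c i) y -> sqnR (coord (c i) y) < rad i ^+ 2 / 4 ->
  dist2 i y = sqnR (coord (c i) y).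
Proof. by move=> cy h; rewrite /dist2 chart_extE// c0 subr0 trunc_sqn_near// ltW. Qed.

Lemma dist2_gt0 i y : y <> x i -> 0 < dist2 i y.
Proof.
move=> yx; rewrite /dist2; have [cy|cy] := pselect (dom (c i) y); last first.
  by rewrite /chart_ext asboolF.
rewrite chart_extE// c0 subr0 trunc_sqn_gt0//; apply/eqP => y0; apply: yx.
by rewrite -(coordK cy) -(coordK (cx i)) y0 c0.
Qed.

Lemma smooth_dist2 i d y : atlas M d -> dom d y -> smooth_in d (fun y => (dist2 i y)%:C) y.
Proof.
move=> Md dy.
have tr : dom (c i) y -> holomorphic_transition d (c i) by move=> _; exact: (hc i Md).2.
have far (z : V) : rad i ^+ 2 <= sqnR z -> trunc_sqn (rad i) z = 1 by exact: trunc_sqn_far.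
exact: (smooth_chart_ext (x := x i) far (@clB i) (smooth_trunc_sqn (rad0 i)) tr dy).
Qed.

Lemma snz_dist2 i d y : atlas M d -> dom d y -> y <> x i -> snz_in d (fun y => (dist2 i y)%:C) y.
Proof.
move=> Md dy yx; apply: snz_atP; first exact: smooth_dist2.
by rewrite /= coordK// eq_complex /= eqxx andbT gt_eqF// dist2_gt0.
Qed.

Lemma admissible_neq o y i : admissible o y -> Some i != o -> y <> x i.
Proof.
case: o => [j|] /= h; last by move=> _ yx; apply: h; exists i.
move=> ij yx; have ji : i != j by apply: contra_neq ij => ->.
by apply: (cxj ji); rewrite -yx; exact: h.1.
Qed.

Lemma admissible_near o y : admissible o y -> \forall y' \near y, admissible o y'.
Proof.
case: o => [i [cy h]|h] /=.
  have n1 : \forall z \near coord (c i) y, sqnR z < rad i ^+ 2 / 4.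
    by have /cvgr_lt := @continuous_sqnR R n (coord (c i) y); apply.
  exact: (near_coord cy n1).
apply: open_nbhs_nbhs; split=> //; apply: closed_openC.
rewrite (_ : range x = \bigcup_(i in [set: 'I_l]) [set x i]).
  apply: closed_bigcup; first exact: finite_finset.
  by move=> i _; apply: accessible_closed_set1; exact: hausdorff_accessible (@hausdorff_points _ _ M).
by apply/seteqP; split=> [_ [i _ <-]|y' [i _ ->]]; exists i.
Qed.

Lemma restE o y : (rest o y)%:C = \prod_(i | Some i != o) ((dist2 i y)%:C)^-1 ^+ m i.
Proof.
rewrite /rest rmorph_prod; apply: eq_bigr => i _; rewrite rmorphXn; congr (_ ^+ _).
exact: (fmorphV (real_complex R)).
Qed.

Lemma rest_gt0 o y : admissible o y -> 0 < rest o y.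
Proof.
move=> ao; rewrite /rest prodr_gt0// => i io.
by rewrite exprn_gt0// invr_gt0 dist2_gt0//; exact: admissible_neq ao io.
Qed.

Lemma snz_rest o d y : atlas M d -> dom d y -> admissible o y ->
  snz_in d (fun y => (rest o y)%:C) y.
Proof.
move=> Md dy ao.
rewrite (_ : (fun _ => _) = fun y => \prod_(i | Some i != o) ((dist2 i y)%:C)^-1 ^+ m i); last first.
  by apply/funext => y'; rewrite restE.
apply: snz_in_prod => i io; apply: snz_inX; apply: snz_inV.
by apply: snz_dist2 => //; exact: admissible_neq ao io.
Qed.

Lemma rest_split i y : rest None y = (dist2 i y)^-1 ^+ m i * rest (Some i) y.
Proof.
rewrite /rest (bigD1 i)//=; congr (_ * _); exact: eq_bigl.
Qed.

Section Curvature.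
Variables (L K : line_bundle M) (hL : lb_index L -> M -> R) (hK : lb_index K -> M -> R).
Hypotheses (hhL : hermitian_metric hL) (hhK : hermitian_metric hK).
Hypothesis negL : forall a d y v, atlas M d -> dom d y -> lb_open a y -> v != 0 ->
  levi_in d (fun y => (hL a y)%:C) y v < 0.

(** The Levi form of the logarithm of h_L^k h_K [rest o], with the part linear in k set apart as
    [levi_uniform] expects it. *)
Definition twist o a b (d : chart R n M) (k : nat) y v : C :=
  k%:R * levi_in d (fun y => (hL a y)%:C) y v + levi_in d (fun y => (hK b y)%:C * (rest o y)%:C) y v.

(** Negativity carries over: frames do not affect the Levi forms, and a change of charts pulls them
    back along an injective differential. *)
Lemma twist_trans o a b a' b' d d' k y : atlas M d -> atlas M d' -> dom d y -> dom d' y ->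
  lb_open a y -> lb_open a' y -> lb_open b y -> lb_open b' y -> admissible o y ->
  (forall v, v != 0 -> twist o a b d k y v < 0) ->
  forall v, v != 0 -> twist o a' b' d' k y v < 0.
Proof.
move=> Md Md' dy d'y ay a'y bY b'y ao H v v0; rewrite /twist.
have s1 := metric_snz hhL Md' d'y ay; have s1' := metric_snz hhL Md dy ay.
have s2 := metric_snz hhK Md' d'y bY; have s2' := metric_snz hhK Md' d'y b'y.
have s3 := metric_snz hhK Md dy bY.
have r1 := snz_rest Md' d'y ao; have r2 := snz_rest Md dy ao.
rewrite (metric_levi_trans hhL v Md' d'y ay a'y) (levi_inM v s2' r1).
rewrite (metric_levi_trans hhK v Md' d'y bY b'y) -(levi_inM v s2 r1).
have t1 := atlas_holomorphic Md' Md; have t2 := atlas_holomorphic Md Md'.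
have hF : hol_at (coord d \o id \o param d') (coord d' y) by exact: (hol_at_transition d'y dy t1).
have F0 := transition_diff_neq0 d'y dy t1 t2 v0.
have cid : {for y, continuous (id : M -> M)} by [].
have := H _ F0; rewrite /twist.
rewrite -(levi_in_pull d'y dy cid hF v s1').
by rewrite -(levi_in_pull d'y dy cid hF v (snz_inM s3 r2)).
Qed.

(** One admissible [o] per point is enough: upstairs the local model is taken for that same [o]. *)
Definition curvature_ok k y : Prop := exists2 o, admissible o y &
  forall a b d, atlas M d -> dom d y -> lb_open a y -> lb_open b y ->
    forall v, v != 0 -> twist o a b d k y v < 0.

Lemma admissible_exists y : exists o, admissible o y.
Proof.
have [[i _ <-]|h] := pselect (range x y); last by exists None.
by exists (Some i); split=> //; rewrite c0 sqnR0 divr_gt0// exprn_gt0.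
Qed.

Lemma curvature_ok_near (y : M) : \forall y' \near y & k \near \oo, curvature_ok k y'.
Proof.
have [ o ao] := admissible_exists y; have [d Md dy] := atlas_cover y.
have [a ay] := lb_cover L y; have [b bY] := lb_cover K y.
pose f z : C := ((fun y => (hL a y)%:C) \o param d) z.
pose g z : C := ((fun y => (hK b y)%:C * (rest o y)%:C) \o param d) z.
have sf : snz_at f (coord d y) by exact: (metric_snz hhL Md dy ay).
have sg : snz_at g (coord d y).
  exact: (snz_inM (metric_snz hhK Md dy bY) (snz_rest Md dy ao)).
have [W [oW Wy sfW sgW]] := snz_at2 sf sg.
have rf w : conjc (f w) = f w by exact: conjc_real.
have rg w : conjc (g w) = g w by apply: etrans (conjcM _ _) _; congr (_ * _); exact: conjc_real.
have neg v : v != 0 -> levi f (coord d y) v < 0 by exact: (negL Md dy ay).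
have [[A B] [nA nB] AB] := levi_uniform oW Wy sfW sgW rf rg neg.
exists ([set y' | [/\ dom d y', A (coord d y'), admissible o y', lb_open a y' & lb_open b y']], B).
  split=> //=; have nd := near_coord dy nA; have no := admissible_near ao.
  have na : \forall y' \near y, lb_open a y' by apply: open_nbhs_nbhs; split=> //; exact: open_lb_open.
  have nb : \forall y' \near y, lb_open b y' by apply: open_nbhs_nbhs; split=> //; exact: open_lb_open.
  apply: filterS2 (filterI nd no) (filterI na nb) => y' [[] ? ?] ? [] ? ?.
  by split.
move=> [y' k] /= [[dy' Ay' ao' ay' by'] Bk]; exists o => // a' b' d' Md' d'y' a'y' b'y'.
apply: (twist_trans Md Md' dy' d'y' ay' a'y' by' b'y' ao').
exact: (AB (coord d y', k) (conj Ay' Bk)).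
Qed.

(** Near each point all large exponents work; the near-covering form of compactness, with the filter
    [\oo] on exponents, gives one bound for all points. *)
Lemma curvature_ok_large : compact [set: M] ->
  forall k0 : nat, exists2 k, (k0 <= k)%N & forall y, curvature_ok k y.
Proof.
move=> /compact_near_coveringP cM k0.
have [y _|N _ HN] := cM nat \oo curvature_ok _; first exact: curvature_ok_near.
by exists (maxn k0 N); [exact: leq_maxl|move=> y; apply: HN => //=; exact: leq_maxr].
Qed.

End Curvature.
End Base.

(** * The blow up *)

Section Normalization.
Context {R : realType} {n : nat}.
Local Notation C := R[i].
Local Notation V := 'rV[R[i]]_n.
Implicit Types z u : V.
Variable j : 'I_n.

Definition norm_at z : V := \row_i (if i == j then 1 else z 0 i).

Lemma norm_at_neq0 z : norm_at z != 0.
Proof. by apply/rV0Pn; exists j; rewrite mxE eqxx oner_neq0. Qed.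

Lemma diff_norm_at z : differentiable norm_at z /\
  forall u, 'd norm_at z u = \row_i (if i == j then 0 else u 0 i).
Proof.
have dE i : differentiable (fun w => norm_at w 0 i : C) z /\
    forall u, 'd (fun w => norm_at w 0 i : C) z u = if i == j then 0 else u 0 i.
  rewrite (_ : (fun w => _) = fun w : V => if i == j then 1 else w 0 i : C); last first.
    by apply/funext => w; rewrite mxE.
  case: (i == j).
    have dc : differentiable ((fun=> 1) : V -> C) z by exact: differentiable_cst.
    by split=> // u; rewrite -(is_rd_eq (is_rd_hol u dc)) (is_rd_eq (is_rd_cst _ _ _)).
  have dc : differentiable (fun w : V => w 0 i : C) z by exact: differentiable_coord.
  by split=> // u; rewrite -(is_rd_eq (is_rd_hol u dc)) (is_rd_eq (is_rd_coord _ _ _)).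
have [d1 d2] := differentiable_row (fun i => (dE i).1).
by split=> // u; rewrite d2; apply/rowP => i; rewrite !mxE (dE i).2.
Qed.

Lemma hol_norm_at z : hol_at norm_at z.
Proof. by apply: filterE => w; exact: (diff_norm_at w).1. Qed.

Lemma snz_sqn_norm_at z : snz_at (sqn \o norm_at) z.
Proof. by apply: snz_at_comp; [exact: hol_norm_at|exact: snz_at_sqn (norm_at_neq0 z)]. Qed.

Lemma levi_sqn_norm_at z u : levi (sqn \o norm_at) z u = levi sqn (norm_at z) ('d norm_at z u).
Proof. exact: (levi_at_comp (hol_norm_at z) (snz_at_sqn (norm_at_neq0 z))). Qed.

Lemma levi_sqn_norm_at_ge0 z u : 0 <= levi (sqn \o norm_at) z u.
Proof. by rewrite levi_sqn_norm_at levi_sqn_ge0// norm_at_neq0. Qed.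

(** The j-th entry of [norm_at] is 1 and that of its differential is 0, so the minor with columns j
    and k is u_k, nonzero for some k. *)
Lemma levi_sqn_norm_at_gt0 z u : u != 0 -> u 0 j = 0 -> 0 < levi (sqn \o norm_at) z u.
Proof.
move=> /rV0Pn[k uk] uj; rewrite levi_sqn_norm_at.
have kj : k != j by apply: contra_neq uk => ->.
apply: (levi_sqn_gt0 (i := j) (j := k)).
by rewrite (diff_norm_at z).2 !mxE eqxx (negbTE kj) mul1r mulr0.
Qed.

End Normalization.

Section BlowUpCharts.
Context {R : realType} {n : nat}.
Local Notation C := R[i].
Implicit Types M N : cmanifold R n.

(** In these charts the blow up is w |-> w_j t with t = [norm_at j w]. Over the points x_i nothing
    else about the model is used. *)
Definition adapted M N (p : N -> M) (c : chart R n M) (j : 'I_n) (b : chart R n N) : Prop :=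
  forall y, dom b y -> dom c (p y) /\ coord c (p y) = (coord b y) 0 j *: norm_at j (coord b y).

Lemma blowup_charts M N l (x : 'I_l -> M) (p : holomap N M) : is_blowup x p ->
  exists c : 'I_l -> chart R n M, forall i,
    [/\ holomorphic_chart (c i), dom (c i) (x i), coord (c i) (x i) = 0,
        forall j, j != i -> ~ dom (c i) (x j) &
        forall y, dom (c i) (p y) -> exists j b,
          [/\ holomorphic_chart b, dom b y & adapted p (c i) j b]].
Proof.
move=> [_ H]; pose P i c := [/\ holomorphic_chart c, dom c (x i), coord c (x i) = 0,
  forall j, j != i -> ~ dom c (x j) & forall y, dom c (p y) -> exists j b,
  [/\ holomorphic_chart b, dom b y & adapted p c j b]].
suff /boolp.choice[c Hc] : forall i, exists c, P i c by exists c.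
move=> i.
have [c [phi [[hc cx c0 cj] [phiU _ _] phi1 Hb]]] := H i.
exists c; split=> // y cy.
have l0 : hcoord (phi y).2 != 0.
  rewrite /hcoord vpick0; have := valP (phi y).2; apply: contraTN => /eqP ->.
  by rewrite dimv0.
have /rV0Pn[j lj] := l0; have [b [hb bdom bE]] := Hb j.
exists j, b; split=> //; first by rewrite bdom.
move=> y' by'; have := by'; rewrite bdom => -[cy' lj']; split=> //.
have [_ model] := phiU y' cy'; have z1 := phi1 y' cy'.
apply/rowP => k; rewrite bE// !mxE eqxx z1; have [->|kj] := eqVneq k j; first by rewrite mulr1.
(* The equation z_k l_j = z_j l_k of the model, divided by l_j, gives z_k = z_j (l_k / l_j). *)
have := model k j; rewrite z1 => /(congr1 (fun t => t / hcoord (phi y').2 0 j)).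
by rewrite mulfK// mulrA.
Qed.

Lemma hol_in_coord N (b c : chart R n N) y j : dom b y -> dom c y -> holomorphic_transition c b ->
  hol_in c (fun y => (coord b y) 0 j) y.
Proof.
move=> bY cy h; have := hol_at_transition cy bY h.
by apply: filterS => w dw; exact: (diff_row_coord j dw).1.
Qed.

(** Since the coordinate w_j vanishes on E, it is q e with q holomorphic. Where e does not vanish,
    neither does w_j, hence nor q; where e vanishes, q is nonzero by differentiation. *)
Lemma hypersurface_quotient N (E U : set N) (e : N -> C) (b : chart R n N) j y :
  open U -> U y -> hypersurface_equation E U e -> holomorphic_chart b -> dom b y ->
  (forall y', dom b y' -> E y' <-> (coord b y') 0 j = 0) ->
  exists q : N -> C, [/\ q y != 0, forall c, atlas N c -> dom c y -> hol_in c q y &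
    \forall y' \near y, (coord b y') 0 j = q y' * e y'].
Proof.
move=> oU Uy [he eE ediv] hb bY Ew.
pose w y' := (coord b y') 0 j : C.
have hw : holomorphic_fun (dom b) w.
  move=> c Nc _ [y' [by' cy'] <-]; have [_ tr] := hb c Nc.
  exact: hol_at_diff (hol_in_coord j by' cy' tr).
have [|V' [q [oV' V'y V'U hq wq]]] := ediv y (dom b) w (@open_dom _ _ _ b) Uy bY hw.
  by move=> y' by' /(Ew y' by').1.
have nq : \forall y' \near y, w y' = q y' * e y' by have : \forall y' \near y, V' y' by [exact: open_nbhs_nbhs]; apply: filterS.
have qh c : atlas N c -> dom c y -> hol_in c q y by move=> Nc cy; exact: hol_in_fun oV' V'y Nc cy hq.
exists q; split=> //.
have wy := wq y V'y.
have [ey|ey] := eqVneq (e y) 0; last first.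
  apply: contra_neq ey => q0; apply/(eE y Uy); apply/(Ew y bY).
  by rewrite -/(w y) wy q0 mul0r.
have [c Nc cy] := atlas_cover y; have [tr _] := hb c Nc.
have hqb := hol_in_transition bY cy tr (qh c Nc cy).
have heb := hol_in_transition bY cy tr (hol_in_fun oU Uy Nc cy he).
(* Along this direction w_j has derivative 1, while that of q e at a zero of e is q times the
   derivative of e; hence q is not 0. *)
pose v : 'rV[C]_n := delta_mx 0 j.
have r1 := is_rd_hol v (hol_at_diff hqb); have r2 := is_rd_hol v (hol_at_diff heb).
have r := is_rdM r1 r2.
have nw : \forall z \near coord b y, (q \o param b) z * (e \o param b) z = z 0 j.
  apply: filterS (near_param bY nq) => z [bz zE] /= <-.
  by rewrite /w zE.
have := is_rd_eq (is_rd_near nw r); rewrite (is_rd_eq (is_rd_coord j v _)) /= coordK// ey mulr0 add0r.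
rewrite /v mxE !eqxx /= => q1.
by apply/eqP => q0; move: q1; rewrite q0 mul0r => /eqP; rewrite oner_eq0.
Qed.

End BlowUpCharts.

Lemma sqnRZ {R : realType} {n : nat} (a : R[i]) (z : 'rV[R[i]]_n) :
  sqnR (a *: z) = nrm a ^+ 2 * sqnR z.
Proof.
have E : (nrm a ^+ 2 * sqnR z)%:C = a * conjc a * sqn z by rewrite conjc_norm2 sqnRE rmorphM.
apply: complexI; apply: etrans (esym (sqnRE _)) _; apply: etrans _ (esym E).
rewrite /sqn mulr_sumr.
by apply: eq_bigr => i _; rewrite !mxE (conjcM a (z 0 i)) mulrACA.
Qed.

(** The cancellation across E_i: s is |e_i|, t is |q|, g is the modulus of the unit part and b is
    |t|^2 for the normalized vector t. *)
Lemma frame_norm_algebra {F : fieldType} (g s t b : F) m : s != 0 ->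
  (g * s ^+ m) ^+ 2 * ((t * s) ^+ 2 * b)^-1 ^+ m = (g * (t ^+ m)^-1) ^+ 2 * b^-1 ^+ m.
Proof.
move=> s0; have aux (T S B : F) : S != 0 -> (g * S) ^+ 2 * ((T * S^-1) ^+ 2 * B) = (g * T) ^+ 2 * B.
  by move=> S0; field.
rewrite -(aux (t ^+ m)^-1 (s ^+ m) (b^-1 ^+ m)) ?expf_neq0//; congr (_ * _).
rewrite invfM exprMn; congr (_ * _).
by rewrite -!exprVn -exprMn exprAC -invfM.
Qed.

Lemma diff_comp_eq0 {R : realType} {n k l : nat} (F : 'rV[R[i]]_n -> 'rV[R[i]]_k)
    (G : 'rV[R[i]]_k -> 'rV[R[i]]_l) z v :
  differentiable F z -> differentiable G (F z) -> 'd F z v = 0 -> 'd (G \o F) z v = 0.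
Proof.
move=> dF dG dv; have := @diff_comp _ _ _ _ F G z dF dG.
move=> /(congr1 (fun h : 'rV[R[i]]_n -> 'rV[R[i]]_l => h v)) /= ->.
by rewrite dv linear0.
Qed.

Lemma holomap_hol_at {R : realType} {n : nat} (M N : cmanifold R n) (p : holomap N M)
    (c : chart R n N) (d : chart R n M) y : atlas N c -> atlas M d -> dom c y -> dom d (p y) ->
  hol_at (coord d \o p \o param c) (coord c y).
Proof.
move=> Nc Md cy dpy; have [cp hp] := holomapP p.
have op : open (p @^-1` dom d).
  by apply: open_comp; [move=> y' _; exact: cp|exact: open_dom].
have i : (coord c @` (p @^-1` dom d `&` dom c)) (coord c y) by exists y.
apply: (near_open (open_coord_image (c := c) op) i) => _ [y' [dy' cy'] <-].
by apply: hp => //; exists y'.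
Qed.

(** * Local form of the norm on the blow up *)

Section LocalModel.
Context {R : realType} {n : nat} {M N : cmanifold R n}.
Local Notation C := R[i].
Local Notation V := 'rV[R[i]]_n.
Context {l : nat}.
Variables (x : 'I_l -> M) (c : 'I_l -> chart R n M) (rad : 'I_l -> R) (m : 'I_l -> nat).
Variable (p : holomap N M).
Hypotheses (hc : forall i, holomorphic_chart (c i)) (cx : forall i, dom (c i) (x i))
  (c0 : forall i, coord (c i) (x i) = 0) (cxj : forall i j, j != i -> ~ dom (c i) (x j))
  (rad0 : forall i, 0 < rad i) (m0 : forall i, (0 < m i)%N).
Hypothesis bihol : biholomorphic_on (~` (p @^-1` range x)) (~` range x) p.
Hypothesis pcharts : forall i y, dom (c i) (p y) -> exists j b,
  [/\ holomorphic_chart b, dom b y & adapted p (c i) j b].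

Local Notation E := (fun i => p @^-1` [set x i]).
Local Notation rest := (rest x c rad m).
Local Notation admissible := (admissible x c rad).

Let near_p y (P : M -> Prop) : (\forall z \near p y, P z) -> \forall y' \near y, P (p y').
Proof. by move=> nP; have [cp _] := holomapP p; have h : p @ y --> p y := cp y I; exact: (h P). Qed.

Lemma blowup_diff_inj y (c' : chart R n N) d v : atlas N c' -> dom c' y -> atlas M d -> dom d (p y) ->
  ~ range x (p y) -> 'd (coord d \o p \o param c') (coord c' y) v = 0 -> v = 0.
Proof.
move=> Nc' c'y Md dpy ny; have [g [pg _ _ [_ hg]]] := bihol.
have [_ gp] := pg y ny.
apply: (@diff_injective _ _ _ _ (coord c' \o g \o param d)).
- by apply: hol_at_diff; exact: holomap_hol_at.
- rewrite /= coordK//; apply: hg => //; exists (p y) => //.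
  by split=> //=; rewrite gp.
- have a0 : admissible None (p y) by [].
  have n1 : \forall y' \near y, dom d (p y') /\ admissible None (p y').
    exact: (near_p (filterI (near_dom dpy) (admissible_near a0))).
  have n2 := near_param c'y n1.
  apply: filterS n2 => z [cz zE [dz nz]].
  by rewrite /= coordK// (pg _ nz).2.
Qed.

(** Meaningful only off the exceptional divisors: on them [f] is arbitrary and [rest None] contains
    an inverse of zero. *)
Definition base_norm (f : N -> C) y : R := (nrm (f y) ^+ 2)^-1 * rest None (p y).

(* [B] times [rest o] extends the norm of the frame [f] across the exceptional divisors *)
Definition local_model f y o (B : N -> R) : Prop :=
  [/\ forall c', atlas N c' -> dom c' y -> snz_in c' (fun y => (B y)%:C) y,
      0 < B y,
      forall c' v, atlas N c' -> dom c' y -> levi_in c' (fun y => (B y)%:C) y v <= 0,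
      forall c' d v, atlas N c' -> dom c' y -> atlas M d -> dom d (p y) -> v != 0 ->
        'd (coord d \o p \o param c') (coord c' y) v = 0 ->
        levi_in c' (fun y => (B y)%:C) y v < 0 &
      \forall y' \near y, (forall i, ~ E i y') -> base_norm f y' = B y' * rest o (p y')].

Section Model.
Variables (f : N -> C) (y : N).
Variables (W : set N) (u : N -> C) (e : 'I_l -> N -> C).
Hypotheses (oW : open W) (Wy : W y) (hu : holomorphic_fun W u) (u0 : forall y, W y -> u y != 0)
  (he : forall i, hypersurface_equation (E i) W (e i))
  (fE : forall y, W y -> (forall i, ~ E i y) -> f y = u y * \prod_i e i y ^ (- (m i)%:Z)).

(** For [o = None] this is 1 / f off the exceptional divisors; leaving out the factor that may
    vanish gives a holomorphic unit at [y] when [o] is admissible. *)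
Definition unit_part o y : C := (u y)^-1 * \prod_(i | Some i != o) e i y ^+ m i.

Lemma unit_part_hol o c' : atlas N c' -> dom c' y -> hol_in c' (unit_part o) y.
Proof.
move=> Nc' c'y; apply: hol_atM.
  apply: (hol_atV (f := u \o param c')); first exact: hol_in_fun oW Wy Nc' c'y hu.
  by rewrite at_coord// u0.
apply: (@hol_at_prod _ _ _ _ _ (fun i => (fun y => e i y ^+ m i) \o param c')) => i io.
apply: (@hol_atX _ _ (e i \o param c')).
by have [hei _ _] := he i; exact: hol_in_fun oW Wy Nc' c'y hei.
Qed.

Lemma unit_part_neq0 o : admissible o (p y) -> unit_part o y != 0.
Proof.
move=> ao; rewrite mulf_neq0 ?invr_neq0 ?u0//.
apply/prodf_neq0 => i io; rewrite expf_neq0//; have [_ eE _] := he i.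
by apply/eqP => /(eE y Wy); exact: (admissible_neq cxj ao io).
Qed.

Lemma inv_frame y' : W y' -> (forall i, ~ E i y') -> (f y')^-1 = unit_part None y'.
Proof.
move=> Wy' nE; rewrite fE// invfM; congr (_ * _); rewrite -prodfV.
by apply: eq_bigr => i _; rewrite -exprnN invrK.
Qed.

Lemma unit_part_split i y' : unit_part None y' = unit_part (Some i) y' * e i y' ^+ m i.
Proof.
rewrite /unit_part (bigD1 i)//= mulrA [LHS]mulrAC; congr (_ * _ * _).
Qed.

Lemma base_normE y' : W y' -> (forall i, ~ E i y') ->
  base_norm f y' = nrm (unit_part None y') ^+ 2 * rest None (p y').
Proof. by move=> Wy' nE; rewrite /base_norm -inv_frame// nrmV exprVn. Qed.

Let nW : \forall y' \near y, W y'.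
Proof. exact: open_nbhs_nbhs. Qed.

(** Here the blow up is biholomorphic, so no nonzero vector is killed by its differential and a
    pluriharmonic logarithm suffices. *)
Lemma model_away : admissible None (p y) -> exists B, local_model f y None B.
Proof.
move=> ao; exists (fun y => nrm (unit_part None y) ^+ 2).
have g0 := unit_part_neq0 ao; split.
- by move=> c' Nc' c'y; apply: snz_in_abs2 => //; exact: unit_part_hol.
- rewrite exprn_gt0// lt_def nrm_ge0 andbT; apply: contra_neq g0; exact: nrm_eq0.
- by move=> c' v Nc' c'y; rewrite levi_in_abs2//; exact: unit_part_hol.
- move=> c' d v Nc' c'y Md dpy v0 /(blowup_diff_inj Nc' c'y Md dpy ao) h.
  by move: v0; rewrite h eqxx.
- by apply: filterS nW => y' Wy' nE; exact: base_normE.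
Qed.

Section Near.
Variables (i : 'I_l) (j : 'I_n) (b : chart R n N) (q : N -> C).
Hypotheses (hb : holomorphic_chart b) (bY : dom b y) (ab : adapted p (c i) j b).
Hypotheses (q0 : q y != 0) (hq : forall c', atlas N c' -> dom c' y -> hol_in c' q y).
Hypothesis nq : \forall y' \near y, (coord b y') 0 j = q y' * e i y'.
Hypothesis ao : admissible (Some i) (p y).

Definition fiber_norm y : R := sqnR (norm_at j (coord b y)).

Lemma fiber_norm_gt0 y' : 0 < fiber_norm y'.
Proof. exact: sqnR_gt0 (norm_at_neq0 j _). Qed.

Let nfib : \forall z \near coord b y, (sqn \o norm_at j) z =
  ((fun y => (fiber_norm y)%:C) \o param b) z.
Proof.
apply: filterS (near_param bY (near_dom bY)) => z [_ zE _].
by rewrite /= /fiber_norm -sqnRE zE.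
Qed.

Lemma snz_fiber_norm_adapted : snz_in b (fun y => (fiber_norm y)%:C) y.
Proof. exact: (snz_at_near nfib (snz_sqn_norm_at _ _)). Qed.

Let cid : {for y, continuous (id : N -> N)}.
Proof. by []. Qed.

Lemma snz_fiber_norm c' : atlas N c' -> dom c' y -> snz_in c' (fun y => (fiber_norm y)%:C) y.
Proof.
move=> Nc' c'y; have [_ tr] := hb Nc'.
exact: (snz_in_pull c'y bY cid (hol_at_transition c'y bY tr) snz_fiber_norm_adapted).
Qed.

Lemma levi_fiber_norm c' v : atlas N c' -> dom c' y ->
  levi_in c' (fun y => (fiber_norm y)%:C) y v =
  levi (sqn \o norm_at j) (coord b y) ('d (coord b \o param c') (coord c' y) v).
Proof.
move=> Nc' c'y; have [_ tr] := hb Nc'.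
have h1 := levi_in_pull c'y bY cid (hol_at_transition c'y bY tr) v snz_fiber_norm_adapted.
exact: (etrans h1 (levi_at_near _ nfib (snz_sqn_norm_at _ _))).
Qed.

(** The coordinate w_j is also the j-th coordinate of [p], because t_j = 1. *)
Lemma vertical_coord c' d v : atlas N c' -> dom c' y -> atlas M d -> dom d (p y) ->
  'd (coord d \o p \o param c') (coord c' y) v = 0 ->
  ('d (coord b \o param c') (coord c' y) v) 0 j = 0.
Proof.
move=> Nc' c'y Md dpy dv0; have [_ tr] := hb Nc'.
have hT := hol_at_diff (hol_at_transition c'y bY tr).
have [dTj dTjE] := diff_row_coord j hT.
have cipy := (ab bY).1; have [ci1 ci2] := hc i Md.
have hF := hol_at_diff (holomap_hol_at (p := p) Nc' Md c'y dpy).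
have hP : differentiable (coord (c i) \o param d) ((coord d \o p \o param c') (coord c' y)).
  have -> : (coord d \o p \o param c') (coord c' y) = coord d (p y) by rewrite /= coordK.
  exact: (hol_at_diff (hol_at_transition dpy cipy ci2)).
have dPF := differentiable_comp hF hP.
have [dj djE] := diff_row_coord j dPF.
have nE : \forall z \near coord c' y, (((coord (c i) \o param d) \o (coord d \o p \o param c')) z) 0 j =
    ((coord b \o param c') z) 0 j.
  have n1 : \forall y' \near y, dom b y' /\ dom d (p y').
    exact: filterI (near_dom bY) (near_p (near_dom dpy)).
  apply: filterS (near_param c'y n1) => z [_ _ [bz dz]].
  by rewrite /= coordK// (ab bz).2 !mxE eqxx mulr1.
rewrite -dTjE -(is_rd_eq (is_rd_hol v dTj)) (is_rd_eq (is_rd_near nE (is_rd_hol v dj))) djE.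
by rewrite (diff_comp_eq0 hF hP dv0) mxE.
Qed.

Lemma model_near : exists B, local_model f y (Some i) B.
Proof.
(* From e_i = w_j / q one has 1 / f = G w_j^m, and S_i = |w_j|^2 |t|^2; so |f|^-2 S_i^(-m) = |G|^2
   |t|^(-2m), whose Levi form comes from the factor in t alone. *)
pose G y := unit_part (Some i) y * (q y ^+ m i)^-1.
have G0 : G y != 0 by rewrite mulf_neq0 ?unit_part_neq0// invr_neq0// expf_neq0.
have hG c' : atlas N c' -> dom c' y -> hol_in c' G y.
  move=> Nc' c'y; apply: hol_atM; first exact: unit_part_hol.
  apply: (hol_atV (f := (fun y => q y ^+ m i) \o param c')).
    by apply: (@hol_atX _ _ (q \o param c')); exact: hq.
  by rewrite (at_coord c'y (fun y => q y ^+ m i)) expf_neq0.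
pose B y := nrm (G y) ^+ 2 * (fiber_norm y)^-1 ^+ m i.
have BE y' : (B y')%:C = (nrm (G y') ^+ 2)%:C * ((fiber_norm y')%:C)^-1 ^+ m i.
  rewrite /B rmorphM; congr (_ * _); rewrite rmorphXn; congr (_ ^+ _); exact: (fmorphV (real_complex R)).
have BE' : (fun y => (B y)%:C) = fun y => (nrm (G y) ^+ 2)%:C * ((fiber_norm y)%:C)^-1 ^+ m i.
  by apply/funext => y'; exact: BE.
have leviB c' v : atlas N c' -> dom c' y -> levi_in c' (fun y => (B y)%:C) y v =
    - ((m i)%:R * levi (sqn \o norm_at j) (coord b y) ('d (coord b \o param c') (coord c' y) v)).
  move=> Nc' c'y; have s1 := snz_in_abs2 c'y (hG c' Nc' c'y) G0.
  have s2 := snz_fiber_norm Nc' c'y; have s3 := snz_inV s2; have s4 := snz_inX (m i) s3.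
  rewrite BE' (levi_inM v s1 s4) (levi_in_abs2 c'y v (hG c' Nc' c'y) G0) add0r.
  by rewrite (levi_inX (m i) v s3) (levi_inV v s2) mulrN levi_fiber_norm.
exists B; split.
- move=> c' Nc' c'y; rewrite BE'; apply: snz_inM.
    by apply: snz_in_abs2 => //; exact: hG.
  by apply: snz_inX; apply: snz_inV; exact: snz_fiber_norm.
- rewrite mulr_gt0 ?exprn_gt0 ?invr_gt0 ?fiber_norm_gt0//.
  by rewrite lt_def nrm_ge0 andbT; apply: contra_neq G0; exact: nrm_eq0.
- move=> c' v Nc' c'y; rewrite leviB// oppr_le0 mulr_ge0//; exact: levi_sqn_norm_at_ge0.
- move=> c' d v Nc' c'y Md dpy v0 dv0; rewrite leviB// oppr_lt0 mulr_gt0 ?ltr0n//.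
  have [t1 t2] := hb Nc'.
  apply: levi_sqn_norm_at_gt0; first exact: transition_diff_neq0.
  exact: vertical_coord dv0.
- have n1 := near_p (admissible_near ao).
  apply: filterS (filterI (filterI nW nq) (filterI n1 (near_dom bY))) => y' [[Wy' qe] [[cy' ry'] by']] nE.
  rewrite base_normE// (unit_part_split i) (rest_split _ _ _ _ i) (dist2_near c0 rad0 cy' ry').
  rewrite (ab by').2 qe sqnRZ -/(fiber_norm y') /B /G mulrA; congr (_ * _).
  rewrite (nrmM (q y') (e i y')) (nrmM (unit_part (Some i) y') (e i y' ^+ m i)).
  rewrite (nrmM (unit_part (Some i) y') (q y' ^+ m i)^-1) (nrmV (q y' ^+ m i)) !nrmX.
  have e0 : nrm (e i y') != 0.
    have [_ eE _] := he i; apply/eqP => /nrm_eq0/(eE y' Wy'); exact: nE.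
  exact: (frame_norm_algebra _ _ _ _ e0).
Qed.

End Near.
End Model.

Lemma model_exists f (U : set N) y o : divisor_equation E (fun i => - (m i)%:Z) U f -> U y ->
  admissible o (p y) -> exists B, local_model f y o B.
Proof.
move=> df Uy; have [W [u [e [[oW Wy] _ [hu u0] he fE]]]] := df y Uy.
case: o => [i|] ao; last exact: model_away oW Wy hu u0 he fE ao.
have [j [b [hb bY ab]]] := pcharts ao.1.
have Ew y' : dom b y' -> E i y' <-> (coord b y') 0 j = 0.
  move=> by'; have [cy' cE] := ab y' by'; split=> h.
    have /rV0Pn[k _] := norm_at_neq0 j (coord b y').
    move: cE; rewrite /= in h; rewrite h c0 => /rowP/(_ j).
    by rewrite !mxE eqxx mulr1.
  by rewrite /= -(coordK cy') cE h scale0r -(c0 i) coordK.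
have [q [q0 hq nq]] := hypersurface_quotient oW Wy (he i) hb bY Ew.
exact: (model_near oW Wy hu u0 he fE hb bY ab q0 hq nq ao).
Qed.

End LocalModel.

Lemma real_continuous {R : realType} {T : topologicalType} (g : T -> R) y :
  {for y, continuous (fun y => (g y)%:C)} -> {for y, continuous g}.
Proof.
move=> h; apply/cvgrPdist_lt => e e0.
have e1 : (0 : R[i]) < e%:C by rewrite ltcR.
have /cvgrPdist_lt/(_ _ e1) := h.
by apply: filterS => y'; rewrite nrmE -rmorphB nrmR ltcR.
Qed.

Lemma snz_in_nearby {R : realType} {n : nat} {T : topologicalType} (c : chart R n T) (f : T -> R[i]) y :
  dom c y -> snz_in c f y -> \forall y' \near y, dom c y' /\ snz_in c f y'.
Proof. by move=> cy sf; exact: (near_coord cy (snz_near sf)). Qed.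

(** * Extension across the exceptional divisors *)

Section Extension.
Context {R : realType} {n : nat} {M N : cmanifold R n}.
Local Notation C := R[i].
Local Notation V := 'rV[R[i]]_n.
Context {l : nat}.
Variables (x : 'I_l -> M) (c : 'I_l -> chart R n M) (rad : 'I_l -> R) (m : 'I_l -> nat).
Variable (p : holomap N M).
Hypotheses (hc : forall i, holomorphic_chart (c i)) (cx : forall i, dom (c i) (x i))
  (c0 : forall i, coord (c i) (x i) = 0) (cxj : forall i j, j != i -> ~ dom (c i) (x j))
  (rad0 : forall i, 0 < rad i) (clB : forall i, closed (chart_ball (c i) (x i) (rad i)))
  (m0 : forall i, (0 < m i)%N).
Hypothesis bihol : biholomorphic_on (~` (p @^-1` range x)) (~` range x) p.
Hypothesis pcharts : forall i y, dom (c i) (p y) -> exists j b,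
  [/\ holomorphic_chart b, dom b y & adapted p (c i) j b].

Local Notation E := (fun i => p @^-1` [set x i]).
Local Notation rest := (rest x c rad m).
Local Notation admissible := (admissible x c rad).
Local Notation frame_norm := (base_norm x c rad m p).
Local Notation local_model := (local_model x c rad m p).

(** In an adapted chart the exceptional divisor is w_j = 0, so a small step in the j-th direction
    leaves it. *)
Lemma exceptional_codense (y : N) (P : N -> Prop) : (\forall y' \near y, P y') ->
  exists y', P y' /\ forall i, ~ E i y'.
Proof.
move=> nP; have [[i _ xi]|ny] := pselect (range x (p y)); last first.
  by exists y; split=> [|i pyi]; [exact: nbhs_singleton nP|apply: ny; exists i].
have cpy : dom (c i) (p y) by rewrite -xi.
have [j [b [hb bY ab]]] := pcharts cpy.
have /near_nrmP[d d0 H] := near_param bY nP.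
have zj : (coord b y) 0 j = 0.
  have := (ab y bY).2; rewrite -xi c0 => /rowP/(_ j).
  by rewrite !mxE eqxx mulr1.
pose t := d / 2; have t0 : 0 < t by rewrite divr_gt0.
pose h : V := t%:C *: delta_mx 0 j.
have hd : nrm h < d.
  apply: (@le_lt_trans _ _ t); last by rewrite /t ltr_pdivrMr// ltr_pMr// ltr1n.
  apply: nrm_row_le => [|k]; first exact: ltW.
  rewrite !mxE eqxx /=; case: eqP => _; rewrite ?mulr1 ?mulr0 ?nrm0 ?(ltW t0)//.
  by rewrite nrmR ger0_norm ?(ltW t0).
have [bz zE Pz] := H h hd.
exists (param b (coord b y + h)); split=> // k pk.
have [cz cE] := ab _ bz; have [ki|ki] := eqVneq k i; last first.
  by apply: (cxj ki); rewrite -pk.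
move: cE; rewrite /= in pk; rewrite pk ki c0 zE => /rowP/(_ j).
rewrite !mxE !eqxx /= zj add0r !mulr1 => /esym/eqP.
by rewrite eq_complex /= eqxx andbT gt_eqF.
Qed.

(* the continuous extension of [phi] across the exceptional divisors, 0 where there is none *)
Definition extend (phi : N -> R) (y : N) : R := xget 0 [set v | exists g : N -> R,
  [/\ {for y, continuous g}, \forall y' \near y, (forall i, ~ E i y') -> phi y' = g y' & v = g y]].

Lemma extendE phi (g : N -> R) (y : N) : {for y, continuous g} ->
  (\forall y' \near y, (forall i, ~ E i y') -> phi y' = g y') -> extend phi y = g y.
Proof.
move=> cg ng; apply: xget_unique; first by exists g.
move=> _ [g' [cg' ng' ->]]; apply/eqP; rewrite eq_sym -subr_eq0 -normr_eq0; apply/eqP/le_anti.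
rewrite normr_ge0 andbT; apply/ler_addgt0Pr => e e0; rewrite add0r.
have e2 : 0 < e / 2 by rewrite divr_gt0.
have /cvgrPdist_lt/(_ _ e2) h := cg; have /cvgrPdist_lt/(_ _ e2) h' := cg'.
have [y' [[[a a'] [b b']] nE]] := exceptional_codense (filterI (filterI h h') (filterI ng ng')).
move: a'; rewrite distrC -(b' nE) (b nE) => a'.
rewrite -(subrKA (g y')) [leRHS]splitr; apply: le_trans (ler_normD _ _) _.
by apply: lerD; exact: ltW.
Qed.

Lemma model_germ_snz f y o B c' : local_model f y o B -> admissible o (p y) ->
  atlas N c' -> dom c' y -> snz_in c' (fun y => (B y * rest o (p y))%:C) y.
Proof.
move=> [sB _ _ _ _] ao Nc' c'y; have [d Md dpy] := atlas_cover (p y).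
rewrite (_ : (fun y => _) = fun y => (B y)%:C * ((fun z => (rest o z)%:C) \o p) y); last first.
  by apply/funext => y'; rewrite rmorphM.
apply: snz_inM; first exact: sB.
have [cp _] := holomapP p.
apply: (snz_in_pull (d := d) c'y dpy (cp y I)); first exact: holomap_hol_at.
exact: (snz_rest m hc cx c0 cxj rad0 clB Md dpy ao).
Qed.

Lemma model_extend f (y : N) o B : local_model f y o B -> admissible o (p y) ->
  \forall y' \near y, extend (frame_norm f) y' = B y' * rest o (p y').
Proof.
move=> hB ao; have [c' Nc' c'y] := atlas_cover y.
have [_ _ _ _ nB] := hB.
have n1 := snz_in_nearby c'y (model_germ_snz hB ao Nc' c'y).
(* [near_join] provides the identity near every nearby point, so the extension equals the model on a
   neighbourhood of [y], including its points on the divisors. *)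
apply: filterS2 n1 (near_join nB) => y' [c'y' sy'] ny'.
apply: (extendE (g := fun y => B y * rest o (p y))) => //.
by apply: real_continuous; exact: (smooth_in_cont c'y' (snz_at_smooth sy')).
Qed.

End Extension.

Lemma product_metric_algebra {F : comRingType} (g1 g2 g3 h1 h2 h3 : F) k :
  (g1 ^+ 2 * h1) ^+ k * (g2 ^+ 2 * h2) * (g3 ^+ 2 * h3) =
  (g1 ^+ k * g2 * g3) ^+ 2 * (h1 ^+ k * h2 * h3).
Proof. by rewrite exprMn exprAC; ring. Qed.

(** * The metric on the twisted bundle *)

Section TwistedMetric.
Context {R : realType} {n : nat} {M N : cmanifold R n}.
Local Notation C := R[i].
Local Notation V := 'rV[R[i]]_n.
Context {l : nat}.
Variables (x : 'I_l -> M) (c : 'I_l -> chart R n M) (rad : 'I_l -> R) (m : 'I_l -> nat).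
Variable (p : holomap N M).
Hypotheses (hc : forall i, holomorphic_chart (c i)) (cx : forall i, dom (c i) (x i))
  (c0 : forall i, coord (c i) (x i) = 0) (cxj : forall i j, j != i -> ~ dom (c i) (x j))
  (rad0 : forall i, 0 < rad i) (clB : forall i, closed (chart_ball (c i) (x i) (rad i)))
  (m0 : forall i, (0 < m i)%N).
Hypothesis bihol : biholomorphic_on (~` (p @^-1` range x)) (~` range x) p.
Hypothesis pcharts : forall i y, dom (c i) (p y) -> exists j b,
  [/\ holomorphic_chart b, dom b y & adapted p (c i) j b].

Local Notation E := (fun i => p @^-1` [set x i]).
Local Notation rest := (rest x c rad m).
Local Notation admissible := (admissible x c rad).
Local Notation frame_norm := (base_norm x c rad m p).
Local Notation local_model := (local_model x c rad m p).

Variables (L K : line_bundle M) (hL : lb_index L -> M -> R) (hK : lb_index K -> M -> R).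
Hypotheses (hhL : hermitian_metric hL) (hhK : hermitian_metric hK).
Variables (D : line_bundle N) (f : lb_index D -> N -> C).
Hypothesis fdiv : forall a, divisor_equation E (fun i => - (m i)%:Z) (lb_open a) (f a).
Hypothesis ftrans : forall a b y, lb_open a y -> lb_open b y -> (forall i, ~ E i y) ->
  lb_trans a b y = f a y / f b y.
Variable k : nat.
Hypothesis ok : forall z, curvature_ok x c rad m hL hK k z.

Let norm_D e := extend x p (frame_norm (f e)).

Let model e y o (ey : lb_open e y) (ao : admissible o (p y)) :=
  model_exists hc cx c0 cxj rad0 m0 bihol pcharts (fdiv (a := e)) ey ao.

Let model_norm e y o B (hB : local_model (f e) y o B) (ao : admissible o (p y)) :
  \forall y' \near y, norm_D e y' = B y' * rest o (p y') :=
  model_extend hc cx c0 cxj rad0 clB pcharts hB ao.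

Lemma norm_D_gt0 e y : lb_open e y -> 0 < norm_D e y.
Proof.
move=> ey; have [ o ao] := admissible_exists cx c0 rad0 (p y).
have [B hB] := model ey ao; rewrite (nbhs_singleton (model_norm hB ao)).
by rewrite mulr_gt0//; [have [_ B0 _ _ _] := hB|exact: (rest_gt0 m cx c0 cxj rad0 ao)].
Qed.

(** The local model makes [base_norm] positive here, whereas a zero of [f e] would make it 0, since
    the inverse of 0 is 0. *)
Lemma frame_neq0 e y : lb_open e y -> (forall i, ~ E i y) -> f e y != 0.
Proof.
move=> ey nE; have ao : admissible None (p y) by move=> [i _ xi]; exact: (nE i).
have [B [_ B0 _ _ nB]] := model ey ao.
have := mulr_gt0 B0 (rest_gt0 m cx c0 cxj rad0 ao); rewrite -(nbhs_singleton nB nE).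
by apply: contraTneq => f0; rewrite /base_norm f0 nrm0 expr0n invr0 mul0r ltxx.
Qed.

(** Off the divisors this is the quotient rule [ftrans]. The right side is continuous by the local
    model, so it is the extension of the left side. *)
Lemma norm_D_trans e e' y : lb_open e y -> lb_open e' y ->
  norm_D e' y = nrm (lb_trans e e' y) ^+ 2 * norm_D e y.
Proof.
move=> ey e'y; have [ o ao] := admissible_exists cx c0 rad0 (p y).
have [B hB] := model ey ao; rewrite (nbhs_singleton (model_norm hB ao)).
have [c' Nc' c'y] := atlas_cover y.
have := @extendE _ _ _ _ _ x c p cx c0 cxj pcharts (frame_norm (f e'))
  (fun y => nrm (lb_trans e e' y) ^+ 2 * (B y * rest o (p y))) y; apply.
  apply: real_continuous; apply: (smooth_in_cont c'y).
  rewrite (_ : (fun y => _) = fun y => (nrm (lb_trans e e' y) ^+ 2)%:C * (B y * rest o (p y))%:C); last first.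
    by apply/funext => y'; rewrite rmorphM.
  apply: smooth_atM.
    by apply: (smooth_in_abs2 (c := c')); exact: trans_hol_in.
  exact: snz_at_smooth (model_germ_snz hc cx c0 cxj rad0 clB hB ao Nc' c'y).
have n1 : \forall y' \near y, (lb_open e `&` lb_open e') y'.
  by apply: open_nbhs_nbhs; split=> //; apply: openI; exact: open_lb_open.
have [_ _ _ _ nB] := hB.
apply: filterS2 n1 nB => y' [ey' e'y'] nB nE.
rewrite -(nB nE) ftrans// /base_norm mulrA; congr (_ * _).
have f0 : nrm (f e y') ^+ 2 != 0.
  by rewrite expf_neq0//; apply: contra_neq (frame_neq0 ey' nE); exact: nrm_eq0.
by rewrite nrmM nrmV exprMn exprVn mulrAC mulfV// mul1r.
Qed.

Let bundle := lb_tensor (lb_pullback p (lb_tensor (lb_pow L k) K)) D.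

Let H (a : lb_index bundle) y : R := hL a.1.1 (p y) ^+ k * hK a.1.2 (p y) * norm_D a.2 y.

Let base a b o z : C := (hL a z)%:C ^+ k * ((hK b z)%:C * (rest o z)%:C).

Let base_snz a b o d z : atlas M d -> dom d z -> lb_open a z -> lb_open b z -> admissible o z ->
  snz_in d (base a b o) z.
Proof.
move=> Md dz az bz ao; apply: snz_inM; first by apply: snz_inX; exact: metric_snz.
by apply: snz_inM; [exact: metric_snz|exact: (snz_rest m hc cx c0 cxj rad0 clB Md dz ao)].
Qed.

Let base_levi a b o d z v : atlas M d -> dom d z -> lb_open a z -> lb_open b z -> admissible o z ->
  levi_in d (base a b o) z v = twist x c rad m hL hK o a b d k z v.
Proof.
move=> Md dz az bz ao; have s1 := metric_snz hhL Md dz az.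
have s2 := snz_inM (metric_snz hhK Md dz bz) (snz_rest m hc cx c0 cxj rad0 clB Md dz ao).
by rewrite (levi_inM v (snz_inX k s1) s2) (levi_inX k v s1).
Qed.

(** Moving [rest o] to the base factor separates what is pulled back from M from the factor that
    lives on the blow up. *)
Let H_near (a : lb_index bundle) (y : N) o B (ay : lb_open a y) (hB : local_model (f a.2) y o B) (ao : admissible o (p y)) :
  \forall y' \near y, (base a.1.1 a.1.2 o \o p) y' * (B y')%:C = (H a y')%:C.
Proof.
apply: filterS (model_norm hB ao) => y' nE.
rewrite /H nE /base /= !rmorphM rmorphXn /= -!mulrA; congr (_ * (_ * _)).
by rewrite mulrC.
Qed.

Let p_cont y : {for y, continuous p}.
Proof. by have [cp _] := holomapP p; exact: cp. Qed.

Let H_snz (a : lb_index bundle) (y : N) c' : lb_open a y -> atlas N c' -> dom c' y -> snz_in c' (fun y => (H a y)%:C) y.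
Proof.
move=> ay Nc' c'y; have [ o ao] := admissible_exists cx c0 rad0 (p y).
have [[az bz] ey] := ay; have [B hB] := model ey ao.
have [d Md dpy] := atlas_cover (p y); have [sB _ _ _ _] := hB.
have s1 := base_snz Md dpy az bz ao.
have s2 := snz_in_pull c'y dpy (@p_cont y) (holomap_hol_at Nc' Md c'y dpy) s1.
exact: (snz_in_near c'y (H_near ay hB ao) (snz_inM s2 (sB c' Nc' c'y))).
Qed.

(** If dp kills [v], the base term is 0 and [B] is strictly negative; otherwise the base term is
    strictly negative by the choice of [k] and [B] contributes at most 0. *)
Let H_levi (a : lb_index bundle) (y : N) c' v : lb_open a y -> atlas N c' -> dom c' y -> v != 0 ->
  levi_in c' (fun y => (H a y)%:C) y v < 0.
Proof.
move=> ay Nc' c'y v0; have [ o ao neg] := ok (p y).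
have [[az bz] ey] := ay; have [B hB] := model ey ao.
have [d Md dpy] := atlas_cover (p y); have [sB _ le lt _] := hB.
have hF := holomap_hol_at Nc' Md c'y dpy.
have s1 := base_snz Md dpy az bz ao.
have s2 := snz_in_pull c'y dpy (@p_cont y) hF s1; have s3 := sB c' Nc' c'y.
rewrite (levi_in_near v c'y (H_near ay hB ao) (snz_inM s2 s3)) (levi_inM v s2 s3).
rewrite (levi_in_pull c'y dpy (@p_cont y) hF v s1).
have [dv0|dv0] := eqVneq ('d (coord d \o p \o param c') (coord c' y) v) 0.
  have -> : levi_in d (base a.1.1 a.1.2 o) (p y) ('d (coord d \o p \o param c') (coord c' y) v) = 0.
    by rewrite dv0; exact: (levi_at0 s1).
  by rewrite add0r; exact: lt dv0.
rewrite -[ltRHS]addr0; apply: ltr_leD; last exact: le.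
by rewrite base_levi//; exact: neg.
Qed.

Theorem twisted_bundle_positive : positive bundle.
Proof.
have hH : hermitian_metric H.
  split.
  - move=> a c' Nc'; apply: smooth_of_snz_at => _ [y [ay c'y] <-].
    exact: (H_snz ay Nc' c'y).
  - move=> a y [[az bz] ey]; have [_ pL _] := hhL; have [_ pK _] := hhK.
    by rewrite !mulr_gt0 ?exprn_gt0 ?pL ?pK ?norm_D_gt0.
  - move=> a a' y [[az bz] ey] [[a'z b'z] e'y].
    rewrite /H (norm_D_trans ey e'y) (metric_transE hhL az a'z) (metric_transE hhK bz b'z).
    rewrite nrmE -rmorphXn -rmorphM; congr (_%:C).
    pose g1 := @lb_trans _ _ _ L a.1.1 a'.1.1 (p y); pose g2 := @lb_trans _ _ _ K a.1.2 a'.1.2 (p y).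
    pose g3 := @lb_trans _ _ _ D a.2 a'.2 y.
    rewrite -[lb_trans a a' y]/(g1 ^+ k * g2 * g3).
    rewrite (nrmM (g1 ^+ k * g2) g3) (nrmM (g1 ^+ k) g2) nrmX.
    exact: product_metric_algebra.
apply: (metric_positive hH) => a c' y v Nc' c'y ay v0; exact: H_levi.
Qed.

End TwistedMetric.

Theorem lemma6p2 (R : realType) (n : nat) (M : cmanifold R n)
    (M_compact : compact [set: M])
    (h : nat) (x : 'I_h -> M) (x_inj : injective x)
    (Mt : cmanifold R n) (p : holomap Mt M) (p_blowup : is_blowup x p)
    (m : 'I_h -> nat) (m_gt0 : forall i, (0 < m i)%N)
    (L K : line_bundle M) (L_pos : positive L)
    (D : line_bundle Mt)
    (D_div : is_divisor_bundle (fun i => p @^-1` [set x i])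
                               (fun i => - (m i)%:Z) D) :
  forall k0 : nat, exists2 k : nat, (k0 <= k)%N &
    positive (lb_tensor (lb_pullback p (lb_tensor (lb_pow L k) K)) D).
Proof.
move=> k0; have [bihol _] := p_blowup; have [c Hc] := blowup_charts p_blowup.
have hc i : holomorphic_chart (c i) by have [] := Hc i.
have cx i : dom (c i) (x i) by have [] := Hc i.
have c0 i : coord (c i) (x i) = 0 by have [] := Hc i.
have cxj i j : j != i -> ~ dom (c i) (x j) by have [_ _ _ h1 _] := Hc i; exact: h1.
have pch i y : dom (c i) (p y) -> exists j b, [/\ holomorphic_chart b, dom b y & adapted p (c i) j b].
  by have [_ _ _ _ h1] := Hc i; exact: h1.
(* Radii for which the coordinate balls are closed in M, so that the functions S_i extend smoothly
   by 1. *)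
have /choice[rad Hrad] : forall i, exists r : R, 0 < r /\ closed (chart_ball (c i) (x i) r).
  move=> i; have [r r0 H] := closed_chart_ball (@hausdorff_points _ _ M) (cx i) openT (I : [set: M] (x i)).
  by exists r; split=> //; have [] := H r (ltW r0) (lexx r).
have rad0 i : 0 < rad i := (Hrad i).1.
have clB i : closed (chart_ball (c i) (x i) (rad i)) := (Hrad i).2.
have [hL [hhL negL]] := positive_metric L_pos.
have [hK hhK] := hermitian_metric_exists K M_compact.
have negL' a d y v : atlas M d -> dom d y -> lb_open a y -> v != 0 ->
    levi_in d (fun y => (hL a y)%:C) y v < 0 by exact: negL.
have [k kk ok] := curvature_ok_large m hc cx c0 cxj rad0 clB hhL hhK negL' M_compact k0.
have [f [fdiv ftrans]] := D_div.
exists k => //.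
exact: (twisted_bundle_positive hc cx c0 cxj rad0 clB m_gt0 bihol pch hhL hhK fdiv ftrans ok).
Qed.
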